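(* For every $\epsilon$ with $0<\epsilon\le 6$ there is an algorithm that, given a set ${\cal P}$ of $n$ points and a set ${\cal D}$ of $m$ unit disks in the Euclidean plane with ${\cal P}\subseteq\bigcup{\cal D}$, computes a subset of ${\cal D}$ covering ${\cal P}$ whose cardinality is at most $(9+\epsilon)$ times the minimum cardinality of a subset of ${\cal D}$ covering ${\cal P}$, in $O(\max(m^6 n,\, m^{2(1+6/\epsilon)} n))$ time.
   Context: This is the discrete unit disk cover (DUDC) problem: given points ${\cal P}$ and unit disks ${\cal D}$, find a minimum-cardinality ${\cal D}^*\subseteq{\cal D}$ such that every point of ${\cal P}$ lies in some disk of ${\cal D}^*$. *)

(* Defs.v *)
From Stdlib Require Import Reals ZArith List.
Open Scope R_scope.

Definition point := (R * R)%type.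

Definition in_unit_disk (c p : point) : Prop :=
  (fst p - fst c) ^ 2 + (snd p - snd c) ^ 2 <= 1.

Definition covers (P D : list point) (S : list nat) : Prop :=
  (forall j, In j S -> (j < length D)%nat) /\
  forall p, In p P -> exists j c, In j S /\ nth_error D j = Some c /\ in_unit_disk c p.

(* Machine model: a unit-cost real RAM (no floor function), with      *)
(* unbounded memories of real registers and of integer registers,     *)
(* integer addition/subtraction only, real field operations, and      *)
(* indirect addressing through integer registers.                     *)
Inductive instr : Type :=
| IConst  (d : nat) (z : Z)          (* I[d] := z *)
| IAdd    (d a b : nat)              (* I[d] := I[a] + I[b] *)
| ISub    (d a b : nat)              (* I[d] := I[a] - I[b] *)
| ILoadI  (d a : nat)                (* I[d] := I[I[a]] *)
| IStoreI (a s : nat)                (* I[I[a]] := I[s] *)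
| RConst  (d : nat) (z : Z)          (* R[d] := z *)
| RAdd    (d a b : nat)              (* R[d] := R[a] + R[b] *)
| RSub    (d a b : nat)
| RMul    (d a b : nat)
| RDiv    (d a b : nat)              (* R[d] := R[a] / R[b] (0 if R[b]=0) *)
| RLoadI  (d a : nat)                (* R[d] := R[I[a]] *)
| RStoreI (a s : nat)                (* R[I[a]] := R[s] *)
| IToR    (d s : nat)                (* R[d] := I[s] *)
| JmpILt  (a b t : nat)              (* if I[a] < I[b] then goto t *)
| JmpRLt  (a b t : nat)              (* if R[a] < R[b] then goto t *)
| JmpRLe  (a b t : nat)              (* if R[a] <= R[b] then goto t *)
| Jmp     (t : nat)
| Halt.

Definition program := list instr.

Record mstate := MState { pc : nat; imem : nat -> Z; rmem : nat -> R }.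

Definition updZ (f : nat -> Z) (k : nat) (v : Z) : nat -> Z :=
  fun i => if Nat.eqb i k then v else f i.
Definition updR (f : nat -> R) (k : nat) (v : R) : nat -> R :=
  fun i => if Nat.eqb i k then v else f i.

Definition rdiv0 (x y : R) : R := if Req_EM_T y 0 then 0 else x / y.

Definition step (prg : program) (s : mstate) : mstate :=
  let '(MState p Im Rm) := s in
  let nx := S p in
  match nth_error prg p with
  | None | Some Halt => s
  | Some (IConst d z) => MState nx (updZ Im d z) Rm
  | Some (IAdd d a b) => MState nx (updZ Im d (Im a + Im b)%Z) Rm
  | Some (ISub d a b) => MState nx (updZ Im d (Im a - Im b)%Z) Rm
  | Some (ILoadI d a) => MState nx (updZ Im d (Im (Z.to_nat (Im a)))) Rm
  | Some (IStoreI a s') => MState nx (updZ Im (Z.to_nat (Im a)) (Im s')) Rm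
  | Some (RConst d z) => MState nx Im (updR Rm d (IZR z))
  | Some (RAdd d a b) => MState nx Im (updR Rm d (Rm a + Rm b))
  | Some (RSub d a b) => MState nx Im (updR Rm d (Rm a - Rm b))
  | Some (RMul d a b) => MState nx Im (updR Rm d (Rm a * Rm b))
  | Some (RDiv d a b) => MState nx Im (updR Rm d (rdiv0 (Rm a) (Rm b)))
  | Some (RLoadI d a) => MState nx Im (updR Rm d (Rm (Z.to_nat (Im a))))
  | Some (RStoreI a s') => MState nx Im (updR Rm (Z.to_nat (Im a)) (Rm s'))
  | Some (IToR d s') => MState nx Im (updR Rm d (IZR (Im s')))
  | Some (JmpILt a b t) => MState (if Z.ltb (Im a) (Im b) then t else nx) Im Rm
  | Some (JmpRLt a b t) => MState (if Rlt_dec (Rm a) (Rm b) then t else nx) Im Rm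
  | Some (JmpRLe a b t) => MState (if Rle_dec (Rm a) (Rm b) then t else nx) Im Rm
  | Some (Jmp t) => MState t Im Rm
  end.

Fixpoint run (prg : program) (t : nat) (s : mstate) : mstate :=
  match t with O => s | S t' => run prg t' (step prg s) end.

Definition halted (prg : program) (s : mstate) : Prop :=
  match nth_error prg (pc s) with None | Some Halt => True | _ => False end.

(* Input encoding: I[0] = n, I[1] = m; the point p_i is stored in
   R[2i], R[2i+1]; the centre of disk j in R[2n+2j], R[2n+2j+1];
   all other registers are 0. *)
Definition encode_real (P D : list point) (k : nat) : R :=
  let n := length P in
  if Nat.ltb k (2 * n) then
    match nth_error P (Nat.div k 2) with
    | Some q => if Nat.even k then fst q else snd q
    | None => 0 end
  else
    match nth_error D (Nat.div (k - 2 * n) 2) with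
    | Some q => if Nat.even k then fst q else snd q
    | None => 0 end.

Definition encode_int (P D : list point) (k : nat) : Z :=
  match k with
  | O => Z.of_nat (length P)
  | 1%nat => Z.of_nat (length D)
  | _ => 0%Z end.

Definition init_state (P D : list point) : mstate :=
  MState 0 (encode_int P D) (encode_real P D).

(* Output decoding: I[0] = k and the chosen disk indices (0-based) are
   I[1], ..., I[k]. *)
Definition output (s : mstate) : list Z :=
  map (fun i => imem s (S i)) (seq 0 (Z.to_nat (imem s 0))).

Definition outputs_within (prg : program) (P D : list point) (t : nat)
    (S : list nat) : Prop :=
  exists t', (t' <= t)%nat /\
    halted prg (run prg t' (init_state P D)) /\
    (0 <= imem (run prg t' (init_state P D)) 0)%Z /\
    Forall (fun z => 0 <= z)%Z (output (run prg t' (init_state P D))) /\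
    map Z.of_nat S = output (run prg t' (init_state P D)).

(* Main.v *)
Require Import Defs.
From Stdlib Require Import Reals ZArith List Lra Lia Permutation Sorted Bool Classical.
Import ListNotations.
Open Scope R_scope.

(** Local search: starting from all disks, exchange three chosen disks for at
    most two others as long as the result still covers the points.  There are
    at most [m] exchanges, and with the numbers of chosen disks covering each
    point at hand one of the [m^5] candidates is tested in time [O(n)], so that
    the running time is [O(m^6 n)].

    A local optimum [L] has at most [9 |O|] disks for every cover [O].  After
    removing the common disks, join, for every point [p], a centre of [L] to a
    centre of [O], both covering [p], as follows: move from [p] towards the
    nearest centre of the other colour up to a point [q] that has nearest
    centres of both colours.  The segments so obtained are chords of empty
    circles and form a plane bipartite graph.  Local optimality says that any
    [k <= 3] vertices of [L] have at least [k] neighbours; by Euler's formula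
    there are at most [|O|] vertices in [L] of degree 1, [2 * 3 |O|] of degree 2
    (each pair of neighbours occurs at most twice) and [2 |O|] of higher degree. *)

(** * Decidable equality and membership as booleans *)

Section DecidableEquality.
Context {T : Type} (eq_dec : forall x y : T, {x = y} + {x <> y}).

Definition eqb_of (x y : T) : bool := if eq_dec x y then true else false.

Lemma eqb_of_eq (x y : T) : eqb_of x y = true <-> x = y.
Proof. unfold eqb_of; destruct (eq_dec x y); intuition congruence. Qed.

Definition memb (l : list T) (x : T) : bool :=
  if in_dec eq_dec x l then true else false.

Lemma memb_in (l : list T) (x : T) : memb l x = true <-> In x l.
Proof. unfold memb; destruct (in_dec eq_dec x l); intuition congruence. Qed.

Lemma memb_cons (y : T) (l : list T) (x : T) :
  memb (y :: l) x = eqb_of x y || memb l x.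
Proof.
  apply eq_true_iff_eq. rewrite orb_true_iff, !memb_in, eqb_of_eq. simpl. intuition.
Qed.

Definition difference (l l' : list T) : list T :=
  filter (fun x => negb (memb l' x)) l.

Lemma in_difference (l l' : list T) (x : T) :
  In x (difference l l') <-> In x l /\ ~ In x l'.
Proof.
  unfold difference. now rewrite filter_In, negb_true_iff, <- not_true_iff_false, memb_in.
Qed.

Lemma length_difference_split (l l' : list T) :
  length l = (length (filter (memb l') l) + length (difference l l'))%nat.
Proof. symmetry; apply filter_length. Qed.

Lemma length_difference_ge (l l' : list T) :
  NoDup l -> (length l - length l' <= length (difference l l'))%nat.
Proof.
  intros distinct. rewrite (length_difference_split l l').
  enough (length (filter (memb l') l) <= length l')%nat by lia.
  apply NoDup_incl_length; [now apply NoDup_filter|].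
  intros x Hx. apply filter_In in Hx as [_ Hx]. now apply memb_in in Hx.
Qed.

Lemma length_le_of_difference_le (k : nat) (l l' : list T) :
  NoDup l -> (1 <= k)%nat ->
  (length (difference l l') <= k * length (difference l' l))%nat ->
  (length l <= k * length l')%nat.
Proof.
  intros distinct k_pos diff_le.
  rewrite (length_difference_split l l'), (length_difference_split l' l).
  enough (length (filter (memb l') l) <= length (filter (memb l) l'))%nat by nia.
  apply NoDup_incl_length; [now apply NoDup_filter|].
  intros x Hx. rewrite filter_In, memb_in in *. tauto.
Qed.

End DecidableEquality.

(** * Sorted lists *)

Lemma StronglySorted_app {T} (r : T -> T -> Prop) (l1 l2 : list T) :
  StronglySorted r (l1 ++ l2) <->
  StronglySorted r l1 /\ StronglySorted r l2 /\
  (forall x y, In x l1 -> In y l2 -> r x y).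
Proof.
  induction l1 as [|a l1 IH]; simpl.
  - split; [intros sorted; repeat split; [constructor|exact sorted|easy]|tauto].
  - split.
    + intros sorted. apply StronglySorted_inv in sorted as [sorted a_min].
      apply IH in sorted as (sorted1 & sorted2 & cross).
      apply Forall_app in a_min as [a_min1 a_min2]. rewrite Forall_forall in a_min2.
      repeat split; auto.
      * now constructor.
      * intros x y [<-|Hx] Hy; auto.
    + intros (sorted1 & sorted2 & cross).
      apply StronglySorted_inv in sorted1 as [sorted1 a_min].
      constructor; [now apply IH; auto|].
      apply Forall_app; split; auto. apply Forall_forall; auto.
Qed.

Lemma StronglySorted_impl {T} (r r' : T -> T -> Prop) (l : list T) :
  (forall x y, In x l -> In y l -> r x y -> r' x y) ->
  StronglySorted r l -> StronglySorted r' l.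
Proof.
  induction l as [|a l IH]; intros Himpl sorted; constructor;
    apply StronglySorted_inv in sorted as [sorted a_min].
  - apply IH; auto. intros; apply Himpl; simpl; auto.
  - rewrite Forall_forall in *. intros y Hy; apply Himpl; simpl; auto.
Qed.

Lemma sorted_key_partition {T} (k : T -> R) (c : R) (l : list T) :
  StronglySorted (fun x y => k x <= k y) l ->
  exists below level above, l = below ++ level ++ above /\
    (forall x, In x below -> k x < c) /\ (forall x, In x level -> k x = c) /\
    (forall x, In x above -> c < k x).
Proof.
  assert (all_above : forall x l, c < k x -> Forall (fun y => k x <= k y) l ->
    forall y, In y (x :: l) -> c < k y).
  { intros x l' Hx x_min y [<-|Hy]; auto. rewrite Forall_forall in x_min.
    specialize (x_min y Hy). lra. }
  induction l as [|x l IH]; intros sorted.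
  - exists [], [], []; repeat split; easy.
  - apply StronglySorted_inv in sorted as [sorted x_min].
    destruct (Rtotal_order (k x) c) as [Hx|[Hx|Hx]].
    + destruct (IH sorted) as (below & level & above & -> & Hbelow & Hrest).
      exists (x :: below), level, above; repeat split; try apply Hrest.
      intros y [<-|Hy]; auto.
    + destruct (IH sorted) as (below & level & above & -> & Hbelow & Hlevel & Habove).
      assert (below = []) as ->.
      { destruct below as [|y below]; auto. apply Forall_inv in x_min.
        specialize (Hbelow y (or_introl eq_refl)). lra. }
      exists [], (x :: level), above; repeat split; auto. intros y [<-|Hy]; auto.
    + exists [], [], (x :: l); repeat split; try easy. now apply all_above.
Qed.

Lemma exists_sorted_permutation {T} (k : T -> R) (l : list T) :
  exists l', Permutation l l' /\ StronglySorted (fun x y => k x <= k y) l'.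
Proof.
  induction l as [|x l (l' & perm & sorted)].
  - exists []; split; constructor.
  - destruct (sorted_key_partition k (k x) l' sorted)
      as (below & level & above & -> & Hbelow & Hlevel & Habove).
    apply StronglySorted_app in sorted as (sorted_below & sorted_rest & cross).
    exists (below ++ x :: level ++ above). split; [now apply Permutation_cons_app|].
    apply StronglySorted_app; repeat split; auto.
    + constructor; auto. apply Forall_forall. intros y Hy.
      apply in_app_iff in Hy as [Hy|Hy]; [rewrite (Hlevel y Hy)|apply Habove in Hy]; lra.
    + intros y z Hy [<-|Hz]; [apply Hbelow in Hy; lra|auto].
Qed.

Lemma exists_strictly_sorted_permutation {T} (k : T -> R) (l : list T) :
  NoDup (map k l) ->
  exists l', Permutation l l' /\ StronglySorted (fun x y => k x < k y) l'.
Proof.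
  intros distinct. destruct (exists_sorted_permutation k l) as (l' & perm & sorted).
  exists l'. split; auto. apply (Permutation_NoDup (Permutation_map k perm)) in distinct.
  clear perm. induction sorted as [|x l' sorted IH x_min]; simpl in *; constructor;
    apply NoDup_cons_iff in distinct as [x_new distinct]; auto.
  rewrite Forall_forall in *. intros y Hy. destruct (x_min y Hy) as [|E]; auto.
  exfalso; apply x_new. rewrite E. now apply in_map.
Qed.

(** * Parity of a boolean predicate along a list *)

Definition parity {T} (f : T -> bool) (l : list T) : bool :=
  fold_right (fun x b => xorb (f x) b) false l.

Lemma parity_app {T} (f : T -> bool) (l1 l2 : list T) :
  parity f (l1 ++ l2) = xorb (parity f l1) (parity f l2).
Proof.
  induction l1 as [|x l1 IH]; simpl; [now destruct (parity f l2)|].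
  rewrite IH. now rewrite xorb_assoc.
Qed.

Lemma parity_permutation {T} (f : T -> bool) (l1 l2 : list T) :
  Permutation l1 l2 -> parity f l1 = parity f l2.
Proof.
  induction 1 as [|x l1 l2 _ IH|x y l|l1 l2 l3 _ IH1 _ IH2]; simpl; auto; [congruence| |congruence].
  rewrite <- !xorb_assoc. now rewrite (xorb_comm (f y)).
Qed.

Lemma parity_ext_in {T} (f g : T -> bool) (l : list T) :
  (forall x, In x l -> f x = g x) -> parity f l = parity g l.
Proof.
  induction l as [|x l IH]; simpl; intros eq_fg; auto. rewrite eq_fg, IH; auto.
Qed.

Lemma parity_true_exists {T} (f : T -> bool) (l : list T) :
  parity f l = true -> exists x, In x l /\ f x = true.
Proof.
  induction l as [|x l IH]; simpl; [easy|]. destruct (f x) eqn:Hfx.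
  - intros _; exists x; auto.
  - simpl. intros odd. destruct (IH odd) as (y & Hy & Hfy). exists y; auto.
Qed.

Lemma parity_false_exists_other {T} (f : T -> bool) (l : list T) (x : T) :
  NoDup l -> parity f l = false -> In x l -> f x = true ->
  exists y, In y l /\ y <> x /\ f y = true.
Proof.
  intros distinct even Hx Hfx. apply in_split in Hx as (l1 & l2 & ->).
  apply NoDup_remove_2 in distinct.
  destruct (parity_true_exists f (l1 ++ l2)) as (y & Hy & Hfy).
  { rewrite parity_app in even |- *. simpl in even. rewrite Hfx in even.
    now destruct (parity f l1), (parity f l2). }
  exists y. split; [|split; [congruence|auto]].
  rewrite in_app_iff in *; simpl; tauto.
Qed.

(** * Face labellings of a growing drawing *)

Fixpoint chain {T} (up dn : T -> nat) (a : nat) (l : list T) (b : nat) : Prop :=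
  match l with
  | [] => a = b
  | e :: l' => dn e = a /\ chain up dn (up e) l' b
  end.

Lemma chain_app {T} (up dn : T -> nat) (a b : nat) (l1 l2 : list T) :
  chain up dn a (l1 ++ l2) b <->
  exists c, chain up dn a l1 c /\ chain up dn c l2 b.
Proof.
  revert a; induction l1 as [|e l1 IH]; simpl; intros a.
  - split; [intros Hl2; exists a; auto|intros (c & -> & Hl2); auto].
  - rewrite IH. firstorder.
Qed.

Lemma chain_ext_in {T} (up dn up' dn' : T -> nat) (a b : nat) (l : list T) :
  (forall e, In e l -> up' e = up e /\ dn' e = dn e) ->
  chain up dn a l b -> chain up' dn' a l b.
Proof.
  revert a; induction l as [|e l IH]; simpl; intros a same; auto.
  destruct (same e (or_introl eq_refl)) as [-> ->]. intros [<- Hl]; auto.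
Qed.

Lemma chain_map {T} (g : nat -> nat) (up dn : T -> nat) (a b : nat) (l : list T) :
  chain up dn a l b -> chain (fun e => g (up e)) (fun e => g (dn e)) (g a) l (g b).
Proof.
  revert a; induction l as [|e l IH]; simpl; intros a; [congruence|].
  intros [<- Hl]; auto.
Qed.

Lemma chain_end_in {T} (up dn : T -> nat) (labels : list nat) (a b : nat) (l : list T) :
  (forall e, In e l -> In (up e) labels) -> In a labels -> chain up dn a l b -> In b labels.
Proof.
  revert a; induction l as [|e l IH]; simpl; intros a Hup Ha; [now intros <-|].
  intros [_ Hl]. apply (IH (up e)); auto.
Qed.

Definition separates {T} (up dn : T -> nat) (phi : nat -> bool) (e : T) : bool :=
  xorb (phi (up e)) (phi (dn e)).

Lemma parity_chain {T} (up dn : T -> nat) (phi : nat -> bool) (a b : nat) (l : list T) :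
  chain up dn a l b -> parity (separates up dn phi) l = xorb (phi a) (phi b).
Proof.
  revert a; induction l as [|e l IH]; simpl; intros a.
  - intros ->. now rewrite xorb_nilpotent.
  - intros [<- Hl]. rewrite (IH _ Hl). unfold separates.
    destruct (phi (up e)), (phi (dn e)), (phi b); auto.
Qed.

Lemma chain_separates_end {T} (up dn : T -> nat) (a b : nat) (l : list T) :
  chain up dn a l b -> a <> b -> exists e, In e l /\ separates up dn (Nat.eqb b) e = true.
Proof.
  intros Hl Hab. apply parity_true_exists. rewrite (parity_chain _ _ _ _ _ _ Hl).
  apply not_eq_sym, Nat.eqb_neq in Hab. now rewrite Hab, Nat.eqb_refl.
Qed.

Lemma exists_strict_upper_bound (l : list nat) :
  exists N, forall a, In a l -> (a < N)%nat.
Proof.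
  exists (S (list_max l)). intros a Ha. apply Nat.lt_succ_r.
  assert (Hmax := proj1 (list_max_le l _) (Nat.le_refl _)).
  rewrite Forall_forall in Hmax. auto.
Qed.

Section Relabel.
Context {T : Type} (eq_dec : forall x y : T, {x = y} + {x <> y}).

Definition update (f : T -> nat) (x : T) (v : nat) : T -> nat :=
  fun y => if eq_dec y x then v else f y.

Lemma update_same f x v : update f x v x = v.
Proof. unfold update. destruct (eq_dec x x); congruence. Qed.

Lemma update_other f x v y : y <> x -> update f x v y = f y.
Proof. unfold update. destruct (eq_dec y x); congruence. Qed.

Lemma exists_fresh_chain (up dn : T -> nat) (hi : nat) (l : list T) :
  NoDup l -> l <> [] -> forall lo N, (lo < N)%nat ->
  exists up' dn', let fresh := seq N (pred (length l)) in
    (forall e, ~ In e l -> up' e = up e /\ dn' e = dn e) /\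
    chain up' dn' lo l hi /\
    (forall e, In e l -> In (up' e) (hi :: fresh) /\ In (dn' e) (lo :: fresh)) /\
    (forall a, In a fresh -> exists e, In e l /\ up' e = a /\ (dn' e < a)%nat).
Proof.
  intros distinct. induction distinct as [|x l x_new distinct IH]; [easy|].
  intros _ lo N Hlo. destruct l as [|y l].
  - exists (update up x hi), (update dn x lo). simpl. split; [|split; [|split]].
    + intros e He. rewrite !update_other by intuition congruence. auto.
    + now rewrite !update_same.
    + intros e [<-|[]]. rewrite !update_same. auto.
    + easy.
  - destruct (IH ltac:(discriminate) N (S N) ltac:(lia))
      as (up' & dn' & same & Hchain & labels & used).
    exists (update up' x N), (update dn' x lo).
    assert (tail_neq : forall e, In e (y :: l) -> e <> x) by congruence.
    simpl pred in *. cbv zeta. cbn [length seq] in *. split; [|split; [|split]].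
    + intros e He. rewrite !update_other by (simpl in He; intuition congruence).
      apply same. simpl in *; tauto.
    + split; [apply update_same|]. rewrite update_same.
      revert Hchain. apply chain_ext_in. intros e He.
      rewrite !update_other by auto. auto.
    + intros e [<-|He]; [rewrite !update_same; simpl; auto|].
      rewrite !update_other by auto. destruct (labels e He). simpl in *; tauto.
    + intros a [<-|Ha].
      * exists x. rewrite !update_same. simpl; auto.
      * destruct (used a Ha) as (e & He & Hup & Hdn). exists e.
        rewrite !update_other by auto. simpl in *; auto.
Qed.

End Relabel.

(* A plane drawing is swept from left to right.  [drawn] lists the edges met so
   far, [swept] the vertices, [front], from bottom to top, the edges meeting the
   sweep line; [up e] and [dn e] label the faces above and below [e], where [0]
   is the unbounded face, and [faces] lists the labels of the other faces. *)
Record face_labelling {T U} (star : U -> list T) (drawn : list T) (swept : list U)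
    (front : list T) (up dn : T -> nat) (faces : list nat) : Prop := {
  front_chain : chain up dn 0 front 0;
  front_drawn : incl front drawn;
  star_drawn : forall v, In v swept -> incl (star v) drawn;
  star_even : forall v phi, In v swept -> parity (separates up dn phi) (star v) = false;
  faces_distinct : NoDup (0%nat :: faces);
  labels_in : forall e, In e drawn ->
    In (up e) (0%nat :: faces) /\ In (dn e) (0%nat :: faces);
  face_bounded : forall a, In a faces ->
    exists e, In e drawn /\ separates up dn (Nat.eqb a) e = true;
  drawn_le : (length drawn <= length faces + length swept)%nat }.

Section FaceLabelling.
Context {T U : Type} (eq_dec : forall x y : T, {x = y} + {x <> y}) (star : U -> list T).
Variables (drawn : list T) (swept : list U) (lower closed upper : list T).
Variables (up dn : T -> nat) (faces : list nat) (v : U).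
Hypothesis labelling :
  face_labelling star drawn swept (lower ++ closed ++ upper) up dn faces.

Lemma front_parts_drawn : incl lower drawn /\ incl closed drawn /\ incl upper drawn.
Proof.
  assert (Hfront := front_drawn _ _ _ _ _ _ _ labelling).
  repeat split; intros e He; apply Hfront; rewrite !in_app_iff; auto.
Qed.

Lemma front_split : exists lo hi,
  chain up dn 0 lower lo /\ chain up dn lo closed hi /\ chain up dn hi upper 0 /\
  In lo (0%nat :: faces) /\ In hi (0%nat :: faces).
Proof.
  assert (Hchain := front_chain _ _ _ _ _ _ _ labelling).
  apply chain_app in Hchain as (lo & Hlower & Hchain).
  apply chain_app in Hchain as (hi & Hclosed & Hupper).
  destruct front_parts_drawn as (lower_drawn & closed_drawn & _).
  assert (Hup : forall e, In e drawn -> In (up e) (0%nat :: faces))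
    by (intros e He; now apply (labels_in _ _ _ _ _ _ _ labelling)).
  assert (Hlo : In lo (0%nat :: faces)) 
    by (apply (chain_end_in up dn _ 0 lo lower); auto; now left).
  assert (Hhi : In hi (0%nat :: faces)) 
    by (apply (chain_end_in up dn _ lo hi closed); auto).
  exists lo, hi; auto.
Qed.

Lemma face_labelling_merge lo hi src dst faces1 faces2 :
  chain up dn 0 lower lo -> chain up dn lo closed hi -> chain up dn hi upper 0 ->
  faces = faces1 ++ src :: faces2 -> In dst (0%nat :: faces1 ++ faces2) ->
  (lo = src /\ hi = dst) \/ (lo = dst /\ hi = src) ->
  Permutation (star v) closed ->
  let merge a := if Nat.eq_dec a src then dst else a in
  face_labelling star drawn (v :: swept) (lower ++ upper)
    (fun e => merge (up e)) (fun e => merge (dn e)) (faces1 ++ faces2).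
Proof.
  intros Hlower Hclosed Hupper Hfaces Hdst Hends Hstar merge.
  destruct front_parts_drawn as (lower_drawn & closed_drawn & upper_drawn).
  destruct labelling as [_ _ Hstars Heven distinct Hlabels Hbounded Hcount].
  rewrite Hfaces in distinct, Hlabels, Hbounded, Hcount.
  apply (NoDup_remove (0%nat :: faces1)) in distinct as [distinct src_new].
  change ((0%nat :: faces1) ++ faces2) with (0%nat :: faces1 ++ faces2) in *.
  assert (merge_other : forall a, a <> src -> merge a = a)
    by (intros a Ha; unfold merge; now destruct (Nat.eq_dec a src)).
  assert (merge_0 : merge 0%nat = 0%nat) by (apply merge_other; simpl in src_new; tauto).
  assert (merge_ends : merge lo = dst /\ merge hi = dst)
    by (unfold merge; destruct (Nat.eq_dec lo src), (Nat.eq_dec hi src); intuition congruence).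
  destruct merge_ends as [merge_lo merge_hi].
  apply (chain_map merge) in Hlower, Hupper.
  rewrite merge_0, merge_lo in Hlower. rewrite merge_0, merge_hi in Hupper.
  split; auto.
  - apply chain_app. exists dst; auto.
  - intros e He. apply in_app_iff in He as [He|He]; auto.
  - intros u [<-|Hu]; auto. intros e He. apply closed_drawn. now rewrite <- Hstar.
  - intros u phi [<-|Hu]; [|exact (Heven u (fun a => phi (merge a)) Hu)].
    rewrite (parity_permutation _ _ _ Hstar).
    rewrite (parity_chain _ _ _ _ _ _ (chain_map merge _ _ _ _ _ Hclosed)).
    rewrite merge_lo, merge_hi. apply xorb_nilpotent.
  - assert (Hmerge : forall a, In a (0%nat :: faces1 ++ src :: faces2) ->
      In (merge a) (0%nat :: faces1 ++ faces2)).
    { intros a Ha. unfold merge. destruct (Nat.eq_dec a src) as [|Hne]; auto.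
      simpl in *; rewrite in_app_iff in *; simpl in *; intuition congruence. }
    intros e He. destruct (Hlabels e He); auto.
  - intros a Ha. destruct (Nat.eq_dec a dst) as [->|a_dst].
    + destruct (chain_separates_end _ _ _ _ _ Hlower) as (e & He & Hsep); eauto.
      intros <-. inversion distinct; auto.
    + destruct (Hbounded a) as (e & He & Hsep).
      { rewrite in_app_iff in *; simpl; tauto. }
      assert (Hmerge : forall b, Nat.eqb a (merge b) = Nat.eqb a b).
      { intros b. unfold merge. destruct (Nat.eq_dec b src) as [->|]; auto.
        assert (a <> src) by (intros ->; simpl in src_new; tauto).
        transitivity false; [|symmetry]; now apply Nat.eqb_neq. }
      exists e. split; auto. unfold separates in *. now rewrite !Hmerge.
  - rewrite !length_app in *. simpl in *. lia.
Qed.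

Lemma face_labelling_close :
  Permutation (star v) closed ->
  exists up' dn' faces',
    face_labelling star drawn (v :: swept) (lower ++ upper) up' dn' faces'.
Proof.
  intros Hstar. destruct front_split as (lo & hi & Hlower & Hclosed & Hupper & Hlo & Hhi).
  destruct (Nat.eq_dec lo hi) as [<-|Hne].
  - exists up, dn, faces.
    destruct front_parts_drawn as (lower_drawn & closed_drawn & upper_drawn).
    destruct labelling as [_ _ Hstars Heven distinct Hlabels Hbounded Hcount]. split; auto.
    + apply chain_app; eauto.
    + intros e He. apply in_app_iff in He as [He|He]; auto.
    + intros u [<-|Hu]; auto. intros e He. apply closed_drawn. now rewrite <- Hstar.
    + intros u phi [<-|Hu]; auto. rewrite (parity_permutation _ _ _ Hstar).
      rewrite (parity_chain _ _ _ _ _ _ Hclosed). apply xorb_nilpotent.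
    + simpl; lia.
  - assert (Hmerge : exists src dst,
      ((lo = src /\ hi = dst) \/ (lo = dst /\ hi = src)) /\
      In src faces /\ In dst (0%nat :: faces)).
    { destruct Hlo as [<-|Hlo]; [exists hi, 0%nat|exists lo, hi]; simpl in *; intuition. }
    destruct Hmerge as (src & dst & Hends & Hsrc & Hdst).
    apply in_split in Hsrc as (faces1 & faces2 & Hfaces).
    eexists _, _, _. eapply (face_labelling_merge lo hi src dst faces1 faces2); eauto.
    rewrite Hfaces in Hdst. simpl in *; rewrite in_app_iff in *; simpl in *.
    intuition congruence.
Qed.

Lemma face_labelling_open (opened : list T) :
  NoDup opened -> opened <> [] -> (forall e, In e opened -> ~ In e drawn) ->
  Permutation (star v) (closed ++ opened) ->
  exists up' dn' faces',
    face_labelling star (opened ++ drawn) (v :: swept) (lower ++ opened ++ upper) up' dn' faces'.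
Proof.
  intros opened_distinct opened_nonempty opened_new Hstar.
  destruct front_split as (lo & hi & Hlower & Hclosed & Hupper & Hlo & Hhi).
  destruct front_parts_drawn as (lower_drawn & closed_drawn & upper_drawn).
  destruct labelling as [_ _ Hstars Heven distinct Hlabels Hbounded Hcount].
  destruct (exists_strict_upper_bound (0%nat :: faces)) as [N below_N].
  destruct (exists_fresh_chain eq_dec up dn hi opened opened_distinct opened_nonempty lo N)
    as (up' & dn' & same & Hopened & fresh_labels & fresh_used); auto.
  set (fresh := seq N (pred (length opened))) in *.
  assert (same_drawn : forall e, In e drawn -> up' e = up e /\ dn' e = dn e)
    by (intros e He; apply same; intros Ho; exact (opened_new e Ho He)).
  assert (keep_chain : forall l a b, incl l drawn -> chain up dn a l b -> chain up' dn' a l b)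
    by (intros l a b Hl; apply chain_ext_in; auto).
  assert (keep_separates : forall phi e, In e drawn ->
    separates up' dn' phi e = separates up dn phi e)
    by (intros phi e He; unfold separates; now destruct (same_drawn e He) as [-> ->]).
  exists up', dn', (faces ++ fresh). split.
  - apply chain_app. exists lo. split; auto. apply chain_app. exists hi; auto.
  - intros e He. rewrite !in_app_iff in *. intuition.
  - intros u [<-|Hu] e He; apply in_app_iff; [|right; now apply (Hstars u)].
    apply (Permutation_in e Hstar), in_app_iff in He as [He|He]; auto.
  - intros u phi [<-|Hu].
    + rewrite (parity_permutation _ _ _ Hstar), parity_app.
      rewrite (parity_chain up' dn' phi lo hi closed) by auto.
      rewrite (parity_chain up' dn' phi lo hi opened) by auto. apply xorb_nilpotent.
    + rewrite <- (Heven u phi Hu). apply parity_ext_in. intros e He.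
      apply keep_separates. now apply (Hstars u).
  - apply (NoDup_app distinct (seq_NoDup _ _)). intros a Ha Hfresh.
    apply in_seq in Hfresh. apply below_N in Ha. lia.
  - intros e He. change (0%nat :: faces ++ fresh) with ((0%nat :: faces) ++ fresh).
    rewrite !in_app_iff. apply in_app_iff in He as [He|He].
    + destruct (fresh_labels e He) as [[<-|Hup] [<-|Hdn]]; auto.
    + destruct (same_drawn e He) as [-> ->]. destruct (Hlabels e He); auto.
  - intros a Ha. apply in_app_iff in Ha as [Ha|Ha].
    + destruct (Hbounded a Ha) as (e & He & Hsep). exists e.
      rewrite in_app_iff, keep_separates; auto.
    + destruct (fresh_used a Ha) as (e & He & Hup & Hdn). exists e.
      rewrite in_app_iff. split; auto. unfold separates. rewrite Hup, Nat.eqb_refl.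
      destruct (Nat.eqb_spec a (dn' e)); [lia|auto].
  - rewrite !length_app. unfold fresh. rewrite length_seq. simpl.
    destruct opened; [easy|]. simpl. lia.
Qed.

End FaceLabelling.

(** * Plane graphs: Euler's formula by a sweep *)

Lemma point_eq_dec (p q : point) : {p = q} + {p <> q}.
Proof. decide equality; apply Req_EM_T. Qed.

Lemma Permutation_filter_orb {T} (f g : T -> bool) (l : list T) :
  (forall x, In x l -> f x && g x = false) ->
  Permutation (filter (fun x => f x || g x) l) (filter f l ++ filter g l).
Proof.
  induction l as [|x l IH]; simpl; intros disjoint; auto.
  specialize (IH (fun y Hy => disjoint y (or_intror Hy))).
  specialize (disjoint x (or_introl eq_refl)).
  destruct (f x), (g x); simpl in *; try easy.
  - now constructor.
  - now apply Permutation_cons_app.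
Qed.

Section PlaneGraph.
Context {T : Type} (lf rg : T -> point).

Definition slope (e : T) : R := (snd (rg e) - snd (lf e)) / (fst (rg e) - fst (lf e)).

Definition height (e : T) (x : R) : R := snd (lf e) + (x - fst (lf e)) * slope e.

Record plane_graph (E : list T) (V : list point) : Prop := {
  edges_distinct : NoDup E;
  left_to_right : forall e, In e E -> fst (lf e) < fst (rg e);
  left_end_in : forall e, In e E -> In (lf e) V;
  right_end_in : forall e, In e E -> In (rg e) V;
  edges_not_crossing : forall e f x, In e E -> In f E -> e <> f ->
    fst (lf e) < x < fst (rg e) -> fst (lf f) < x < fst (rg f) -> height e x <> height f x;
  edges_avoid_vertices : forall e v, In e E -> In v V ->
    fst (lf e) < fst v < fst (rg e) -> height e (fst v) <> snd v }.

Lemma height_left e : height e (fst (lf e)) = snd (lf e).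
Proof. unfold height; ring. Qed.

Lemma height_right e : fst (lf e) < fst (rg e) -> height e (fst (rg e)) = snd (rg e).
Proof. intros Hlr; unfold height, slope; field; lra. Qed.

Variables (E : list T) (V : list point).

Definition star (v : point) : list T :=
  filter (fun e => eqb_of point_eq_dec (lf e) v || eqb_of point_eq_dec (rg e) v) E.

Lemma in_star v e : In e (star v) <-> In e E /\ (lf e = v \/ rg e = v).
Proof. unfold star. rewrite filter_In, orb_true_iff, !eqb_of_eq. tauto. Qed.

Hypothesis plane : plane_graph E V.
Hypothesis V_sorted : StronglySorted (fun u v => fst u < fst v) V.

(* Otherwise the edges would meet where their affine heights cross. *)
Lemma height_order_preserved e f x1 x2 :
  In e E -> In f E -> e <> f ->
  fst (lf e) <= x1 -> fst (lf f) <= x1 -> x1 < x2 ->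
  x2 <= fst (rg e) -> x2 <= fst (rg f) ->
  height e x1 < height f x1 -> height e x2 <= height f x2.
Proof.
  intros He Hf e_neq_f e_left f_left Hx e_right f_right order1.
  apply Rnot_lt_le; intros order2.
  set (gap1 := height f x1 - height e x1). set (gap2 := height e x2 - height f x2).
  assert (gap1_pos : 0 < gap1) by (unfold gap1; lra).
  assert (gap2_pos : 0 < gap2) by (unfold gap2; lra).
  set (t := gap1 / (gap1 + gap2)).
  assert (t_gap : t * (gap1 + gap2) = gap1) by (unfold t; field; lra).
  assert (t_range : 0 < t < 1)
    by (split; apply Rmult_lt_reg_r with (gap1 + gap2); lra).
  set (x := x1 + t * (x2 - x1)).
  assert (x_range : x1 < x < x2) by (unfold x; nra).
  assert (height_x : forall g, height g x = (1 - t) * height g x1 + t * height g x2)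
    by (intros g; unfold height, x; ring).
  apply (edges_not_crossing _ _ plane e f x); auto; try lra.
  rewrite !height_x. unfold gap1, gap2 in t_gap. lra.
Qed.

Definition lies_below (swept : list point) (e f : T) : Prop :=
  forall x, (forall u, In u swept -> fst u < x) ->
  x <= fst (rg e) -> x <= fst (rg f) -> height e x <= height f x.

Lemma lies_below_cons swept v e f : lies_below swept e f -> lies_below (v :: swept) e f.
Proof. intros Hef x Hx. apply Hef. intros u Hu. apply Hx; now right. Qed.

Record sweep_front (swept unswept : list point) (front : list T) : Prop := {
  front_distinct : NoDup front;
  in_front : forall e, In e front <-> In e E /\ In (lf e) swept /\ In (rg e) unswept;
  front_sorted : StronglySorted (lies_below swept) front }.

Section SweepVertex.
Variables (swept : list point) (v : point) (unswept : list point).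
Hypothesis V_split : V = rev swept ++ v :: unswept.

Lemma swept_before u : In u swept -> fst u < fst v.
Proof.
  intros Hu. rewrite V_split in V_sorted.
  apply StronglySorted_app in V_sorted as (_ & _ & cross).
  apply cross; [now apply in_rev in Hu|now left].
Qed.

Lemma unswept_after u : In u unswept -> fst v < fst u.
Proof.
  intros Hu. rewrite V_split in V_sorted.
  apply StronglySorted_app in V_sorted as (_ & sorted & _).
  apply StronglySorted_inv in sorted as [_ v_min]. rewrite Forall_forall in v_min. auto.
Qed.

Lemma in_V_cases u : In u V -> In u swept \/ u = v \/ In u unswept.
Proof.
  rewrite V_split, in_app_iff, <- in_rev. simpl. intuition.
Qed.

Lemma edge_into_v e : In e E -> rg e = v -> In (lf e) swept.
Proof.
  intros He e_right. assert (Hlr := left_to_right _ _ plane e He).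
  destruct (in_V_cases (lf e) (left_end_in _ _ plane e He)) as [Hl|[Hl|Hl]]; auto.
  - rewrite Hl, e_right in Hlr. lra.
  - apply unswept_after in Hl. rewrite e_right in Hlr. lra.
Qed.

Lemma edge_from_v e : In e E -> lf e = v -> In (rg e) unswept.
Proof.
  intros He e_left. assert (Hlr := left_to_right _ _ plane e He).
  destruct (in_V_cases (rg e) (right_end_in _ _ plane e He)) as [Hr|[Hr|Hr]]; auto.
  - apply swept_before in Hr. rewrite e_left in Hlr. lra.
  - rewrite Hr, e_left in Hlr. lra.
Qed.

Lemma lies_below_at_v e f :
  In e E -> In f E -> e <> f -> fst (lf e) <= fst v -> fst (lf f) <= fst v ->
  height e (fst v) < height f (fst v) -> lies_below (v :: swept) e f.
Proof.
  intros He Hf e_neq_f e_left f_left order x Hx e_right f_right.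
  apply (height_order_preserved e f (fst v) x); auto. apply Hx; now left.
Qed.

Lemma lies_below_from_v e f :
  lf e = v -> lf f = v -> slope e <= slope f -> lies_below (v :: swept) e f.
Proof.
  intros e_left f_left Hslope x Hx _ _. specialize (Hx v (or_introl eq_refl)).
  unfold height. rewrite e_left, f_left. nra.
Qed.

Variables lower closed upper opened : list T.
Hypothesis front : sweep_front swept (v :: unswept) (lower ++ closed ++ upper).
Hypothesis lower_height : forall e, In e lower -> height e (fst v) < snd v.
Hypothesis closed_height : forall e, In e closed -> height e (fst v) = snd v.
Hypothesis upper_height : forall e, In e upper -> snd v < height e (fst v).
Hypothesis opened_perm : Permutation (filter (fun e => eqb_of point_eq_dec (lf e) v) E) opened.
Hypothesis opened_sorted : StronglySorted (fun e f => slope e <= slope f) opened.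

Lemma in_opened e : In e opened <-> In e E /\ lf e = v.
Proof. now rewrite <- opened_perm, filter_In, eqb_of_eq. Qed.

Lemma opened_distinct : NoDup opened.
Proof.
  apply (Permutation_NoDup opened_perm), NoDup_filter, (edges_distinct _ _ plane).
Qed.

Lemma front_edge e :
  In e lower \/ In e closed \/ In e upper ->
  In e E /\ In (lf e) swept /\ (rg e = v \/ In (rg e) unswept).
Proof.
  intros He.
  assert (Hfront : In e (lower ++ closed ++ upper)) by (rewrite !in_app_iff; tauto).
  apply (in_front _ _ _ front) in Hfront. simpl in Hfront. intuition.
Qed.

Lemma opened_not_in_front e : In e opened -> In (lf e) swept -> False.
Proof.
  intros He Hl. apply in_opened in He as [_ e_left].
  rewrite e_left in Hl. apply swept_before in Hl. lra.
Qed.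

Lemma in_closed e :
  In e lower \/ In e closed \/ In e upper -> rg e = v <-> In e closed.
Proof.
  intros He. destruct (front_edge e He) as (HeE & Hl & Hr). split.
  - intros e_right. assert (Hh : height e (fst v) = snd v).
    { rewrite <- e_right. apply height_right, (left_to_right _ _ plane e HeE). }
    destruct He as [He|[He|He]]; auto.
    + apply lower_height in He; lra.
    + apply upper_height in He; lra.
  - intros Hclosed. destruct Hr as [|Hr]; auto. exfalso.
    apply (edges_avoid_vertices _ _ plane e v HeE); auto.
    + rewrite V_split, in_app_iff; simpl; auto.
    + split; [now apply swept_before|now apply unswept_after].
Qed.

Lemma Permutation_star : Permutation (star v) (closed ++ opened).
Proof.
  transitivity (filter (fun e => eqb_of point_eq_dec (rg e) v || eqb_of point_eq_dec (lf e) v) E).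
  { unfold star. erewrite filter_ext; [reflexivity|]. intros e; apply orb_comm. }
  etransitivity; [apply Permutation_filter_orb|].
  - intros e He. apply andb_false_iff. rewrite <- !not_true_iff_false, !eqb_of_eq.
    apply (left_to_right _ _ plane) in He.
    destruct (point_eq_dec (rg e) v) as [e_right|]; auto. right; intros e_left.
    rewrite e_right, e_left in He; lra.
  - apply Permutation_app; [|exact opened_perm]. apply NoDup_Permutation.
    + apply NoDup_filter, (edges_distinct _ _ plane).
    + assert (distinct := front_distinct _ _ _ front).
      apply NoDup_app_remove_l in distinct. now apply NoDup_app_remove_r in distinct.
    + intros e. rewrite filter_In, eqb_of_eq. split.
      * intros [He e_right]. apply in_closed; auto. rewrite <- !in_app_iff.
        apply (in_front _ _ _ front). split; [auto|split; [now apply edge_into_v|now left]].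
      * intros He. split; [now apply front_edge; auto|now apply in_closed; auto].
Qed.

Lemma in_new_front e :
  In e (lower ++ opened ++ upper) <-> In e E /\ In (lf e) (v :: swept) /\ In (rg e) unswept.
Proof.
  rewrite !in_app_iff. split.
  - intros He. assert (Hcases : In e opened \/ (In e lower \/ In e upper)) by tauto.
    destruct Hcases as [Hopened|Hkept].
    + assert (Hopened' := Hopened). apply in_opened in Hopened as [HeE Hl].
      split; [auto|split; [left; congruence|now apply edge_from_v]].
    + assert (not_closed : ~ In e closed).
      { intros Hc; apply closed_height in Hc.
        destruct Hkept as [H|H]; [apply lower_height in H|apply upper_height in H]; lra. }
      rewrite <- in_closed in not_closed by tauto.
      destruct (front_edge e) as (HeE & Hl & Hr); [tauto|]. simpl; tauto.
  - intros (HeE & [Hl|Hl] & Hr); [right; left; now apply in_opened|].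
    assert (Hfront : In e (lower ++ closed ++ upper))
      by (apply (in_front _ _ _ front); simpl; auto).
    rewrite !in_app_iff in Hfront.
    assert (not_closed : ~ In e closed).
    { rewrite <- in_closed by auto. intros e_right. rewrite e_right in Hr.
      apply unswept_after in Hr. lra. }
    tauto.
Qed.

Lemma new_front_distinct : NoDup (lower ++ opened ++ upper).
Proof.
  assert (distinct := front_distinct _ _ _ front).
  apply (Permutation_NoDup (l := opened ++ lower ++ upper)).
  { apply Permutation_app_swap_app. }
  apply NoDup_app; [apply opened_distinct| |].
  - apply (Permutation_NoDup (l' := closed ++ lower ++ upper)) in distinct.
    + now apply NoDup_app_remove_l in distinct.
    + apply Permutation_app_swap_app.
  - intros e Hopened Hkept. apply (opened_not_in_front e Hopened).
    apply in_app_iff in Hkept. apply front_edge; tauto.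
Qed.

Lemma new_front_sorted : StronglySorted (lies_below (v :: swept)) (lower ++ opened ++ upper).
Proof.
  assert (sorted := front_sorted _ _ _ front).
  apply StronglySorted_app in sorted as (lower_sorted & sorted & lower_rest).
  apply StronglySorted_app in sorted as (_ & upper_sorted & _).
  assert (keep : forall l, StronglySorted (lies_below swept) l ->
    StronglySorted (lies_below (v :: swept)) l)
    by (intros l; apply StronglySorted_impl; intros; now apply lies_below_cons).
  assert (kept_left : forall e, In e lower \/ In e upper -> In e E /\ fst (lf e) <= fst v).
  { intros e He. destruct (front_edge e) as (HeE & Hl & _); [tauto|].
    apply swept_before in Hl. split; auto; lra. }
  assert (kept_neq : forall e f, In e lower \/ In e upper -> In f opened -> e <> f).
  { intros e f He Hf ->. apply (opened_not_in_front f Hf). apply front_edge; tauto. }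
  assert (opened_left : forall e, In e opened -> In e E /\ fst (lf e) <= fst v /\
    height e (fst v) = snd v).
  { intros e He. apply in_opened in He as [HeE <-]. rewrite height_left. intuition lra. }
  apply StronglySorted_app; repeat split; [auto|apply StronglySorted_app; repeat split|].
  - revert opened_sorted. apply StronglySorted_impl. intros e f He Hf.
    apply in_opened in He, Hf. now apply lies_below_from_v.
  - auto.
  - intros e f He Hf. destruct (opened_left e He) as (HeE & e_left & e_height).
    destruct (kept_left f) as [HfE f_left]; auto.
    apply lies_below_at_v; auto.
    + intros <-. now apply (kept_neq e e); auto.
    + rewrite e_height; auto.
  - intros e f He Hf. apply in_app_iff in Hf as [Hf|Hf].
    + destruct (opened_left f Hf) as (HfE & f_left & f_height).
      destruct (kept_left e) as [HeE e_left]; auto.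
      apply lies_below_at_v; auto. rewrite f_height; auto.
    + apply lies_below_cons, lower_rest; auto. apply in_app_iff; auto.
Qed.

Lemma new_sweep_front : sweep_front (v :: swept) unswept (lower ++ opened ++ upper).
Proof.
  split; [apply new_front_distinct|apply in_new_front|apply new_front_sorted].
Qed.

End SweepVertex.

Variable eq_dec : forall e f : T, {e = f} + {e <> f}.

Definition sweep_state (swept unswept : list point) : Prop :=
  exists drawn front up dn faces,
    NoDup drawn /\ (forall e, In e drawn <-> In e E /\ In (lf e) swept) /\
    sweep_front swept unswept front /\
    face_labelling star drawn swept front up dn faces.

Lemma sweep_front_partition swept v unswept front :
  V = rev swept ++ v :: unswept -> sweep_front swept (v :: unswept) front ->
  exists lower closed upper, front = lower ++ closed ++ upper /\
    (forall e, In e lower -> height e (fst v) < snd v) /\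
    (forall e, In e closed -> height e (fst v) = snd v) /\
    (forall e, In e upper -> snd v < height e (fst v)).
Proof.
  intros V_split [_ Hin sorted]. apply sorted_key_partition.
  revert sorted. apply StronglySorted_impl. intros e f He Hf Hef.
  assert (reaches_v : forall g, In g front -> fst v <= fst (rg g)).
  { intros g Hg. apply Hin in Hg as (_ & _ & [<-|Hg]); [lra|].
    apply (unswept_after _ _ _ V_split) in Hg; lra. }
  apply Hef; auto. intros u Hu. now apply (swept_before _ _ _ V_split).
Qed.

Lemma sweep_state_step swept v unswept :
  V = rev swept ++ v :: unswept ->
  sweep_state swept (v :: unswept) -> sweep_state (v :: swept) unswept.
Proof.
  intros V_split (drawn & front & up & dn & faces & distinct & Hdrawn & Hfront & labelling).
  destruct (sweep_front_partition _ _ _ _ V_split Hfront)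
    as (lower & closed & upper & -> & Hlower & Hclosed & Hupper).
  destruct (exists_sorted_permutation slope (filter (fun e => eqb_of point_eq_dec (lf e) v) E))
    as (opened & Hperm & opened_sorted).
  assert (Hstar := Permutation_star _ _ _ V_split _ _ _ _ Hfront Hlower Hclosed Hupper Hperm).
  assert (Hnew := new_sweep_front _ _ _ V_split _ _ _ _ Hfront Hlower Hclosed Hupper
    Hperm opened_sorted).
  assert (Hopened := in_opened v opened Hperm).
  assert (opened_new : forall e, In e opened -> ~ In e drawn).
  { intros e He Hd. apply Hdrawn in Hd as [_ Hl].
    exact (opened_not_in_front _ _ _ V_split _ Hperm e He Hl). }
  assert (Hdrawn' : forall e, In e (opened ++ drawn) <-> In e E /\ In (lf e) (v :: swept)).
  { intros e. rewrite in_app_iff, Hopened, Hdrawn. simpl. intuition. }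
  assert (distinct' : NoDup (opened ++ drawn))
    by (apply NoDup_app; auto; exact (opened_distinct _ _ Hperm)).
  destruct (list_eq_dec eq_dec opened []) as [->|opened_nonempty].
  - rewrite app_nil_r in Hstar.
    destruct (face_labelling_close star _ _ _ _ _ _ _ _ v labelling Hstar)
      as (up' & dn' & faces' & labelling').
    exists drawn, (lower ++ upper), up', dn', faces'. auto.
  - destruct (face_labelling_open eq_dec star _ _ _ _ _ _ _ _ v labelling opened)
      as (up' & dn' & faces' & labelling'); auto.
    { exact (opened_distinct _ _ Hperm). }
    exists (opened ++ drawn), (lower ++ opened ++ upper), up', dn', faces'. auto.
Qed.

Lemma sweep_state_initial : sweep_state [] V.
Proof.
  exists [], [], (fun _ => 0%nat), (fun _ => 0%nat), [].
  split; [constructor|split; [simpl; tauto|split]].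
  - split; [constructor|simpl; tauto|constructor].
  - split; simpl; try easy. repeat constructor; easy.
Qed.

Lemma sweep_state_final : sweep_state (rev V) [].
Proof.
  assert (Hsweep : forall unswept swept, V = rev swept ++ unswept ->
    sweep_state swept unswept -> sweep_state (rev V) []).
  { induction unswept as [|v unswept IH]; intros swept V_split state.
    - rewrite app_nil_r in V_split. now rewrite V_split, rev_involutive.
    - apply (IH (v :: swept)); [simpl; now rewrite <- app_assoc|].
      now apply sweep_state_step. }
  apply (Hsweep V []); [reflexivity|apply sweep_state_initial].
Qed.

End PlaneGraph.

Lemma plane_graph_perm {T} (lf rg : T -> point) (E : list T) (V V' : list point) :
  Permutation V V' -> plane_graph lf rg E V -> plane_graph lf rg E V'.
Proof.
  intros perm [distinct ltr Hleft Hright not_crossing avoid]. split; auto.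
  - intros e He. rewrite <- perm. auto.
  - intros e He. rewrite <- perm. auto.
  - intros e v He Hv. apply avoid; auto. now rewrite perm.
Qed.

Definition incident {T U} (lf rg : T -> U) (v : U) (e : T) : Prop :=
  lf e = v \/ rg e = v.

Definition leafless {T U} (lf rg : T -> U) (E : list T) (Z : T -> bool) : Prop :=
  (exists e, In e E /\ Z e = true) /\
  forall v e, In e E -> Z e = true -> incident lf rg v e ->
    exists e', In e' E /\ e' <> e /\ Z e' = true /\ incident lf rg v e'.

(* Mac Lane's form of Euler's formula: the sets [Zs] are the boundaries of the
   bounded faces. *)
Lemma plane_graph_faces {T} (eq_dec : forall e f : T, {e = f} + {e <> f})
    (lf rg : T -> point) (E : list T) (V : list point) :
  plane_graph lf rg E V -> NoDup (map fst V) ->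
  exists Zs : list (T -> bool),
    (length E <= length Zs + length V)%nat /\
    (forall Z, In Z Zs -> leafless lf rg E Z) /\
    (forall e, In e E -> (length (filter (fun Z => Z e) Zs) <= 2)%nat).
Proof.
  intros plane distinct_x.
  destruct (exists_strictly_sorted_permutation (T := point) fst V distinct_x)
    as (V' & perm & sorted).
  apply (plane_graph_perm _ _ _ _ _ perm) in plane.
  destruct (sweep_state_final lf rg E V' plane sorted eq_dec)
    as (drawn & front & up & dn & faces & distinct & Hdrawn & _ & labelling).
  destruct labelling as [_ _ _ even faces_distinct labels bounded count].
  assert (all_drawn : forall e, In e drawn <-> In e E).
  { intros e. rewrite Hdrawn, <- in_rev. split; [tauto|]. intros He.
    split; auto. now apply (left_end_in _ _ _ _ plane). }
  assert (same_length : length drawn = length E).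
  { apply Permutation_length, NoDup_Permutation; auto. apply (edges_distinct _ _ _ _ plane). }
  rewrite same_length, length_rev in count.
  exists (map (fun a => separates up dn (Nat.eqb a)) faces). split; [|split].
  - now rewrite length_map, (Permutation_length perm).
  - intros Z HZ. apply in_map_iff in HZ as (a & <- & Ha). split.
    + destruct (bounded a Ha) as (e & He & Hsep). apply all_drawn in He. eauto.
    + intros v e He Hsep Hinc.
      assert (Hv : In v (rev V')).
      { rewrite <- in_rev. destruct Hinc as [<-|<-];
          [now apply (left_end_in _ _ _ _ plane)|now apply (right_end_in _ _ _ _ plane)]. }
      destruct (parity_false_exists_other _ (star lf rg E v) e
        (NoDup_filter _ (edges_distinct _ _ _ _ plane)) (even v (Nat.eqb a) Hv))
        as (e' & He' & Hne & Hsep'); auto.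
      { now apply in_star. }
      apply in_star in He' as [HeE' Hinc']. exists e'; auto.
  - intros e _. rewrite filter_map_swap, length_map. change 2%nat with (length [up e; dn e]).
    apply NoDup_cons_iff in faces_distinct as [_ faces_distinct].
    apply NoDup_incl_length; [now apply NoDup_filter|].
    intros a Ha. apply filter_In in Ha as [_ Ha]. unfold separates in Ha.
    destruct (Nat.eqb_spec a (up e)); [simpl; auto|].
    destruct (Nat.eqb_spec a (dn e)); [simpl; auto|easy].
Qed.

Lemma double_count {T U} (r : T -> U -> bool) (g h : nat) (l : list T) (k : list U) :
  (forall y, In y k -> (g <= length (filter (fun x => r x y) l))%nat) ->
  (forall x, In x l -> (length (filter (r x) k) <= h)%nat) ->
  (g * length k <= h * length l)%nat.
Proof.
  intros col_ge row_le.
  assert (Hcols : (g * length k <=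
    list_sum (map (fun y => length (filter (fun x => r x y) l)) k))%nat).
  { clear row_le. induction k as [|y k IH]; simpl; [lia|].
    specialize (IH (fun z Hz => col_ge z (or_intror Hz))).
    specialize (col_ge y (or_introl eq_refl)). lia. }
  assert (Hrows : (list_sum (map (fun x => length (filter (r x) k)) l) <= h * length l)%nat).
  { clear col_ge Hcols. induction l as [|x l IH]; simpl; [lia|].
    specialize (IH (fun z Hz => row_le z (or_intror Hz))).
    specialize (row_le x (or_introl eq_refl)). lia. }
  enough (list_sum (map (fun y => length (filter (fun x => r x y) l)) k) =
          list_sum (map (fun x => length (filter (r x) k)) l)) by lia.
  clear. induction l as [|x l IH]; simpl.
  - induction k; simpl; auto.
  - rewrite <- IH. clear. induction k as [|y k IH]; simpl; auto.
    destruct (r x y); simpl; lia.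
Qed.

Definition euler_bound {T U} (lf rg : T -> U) (E : list T) (V : list U) : Prop :=
  forall g, (forall Z, leafless lf rg E Z ->
      exists l, NoDup l /\ length l = g /\ forall e, In e l -> In e E /\ Z e = true) ->
  (g * length E <= 2 * length E + g * length V)%nat.

Lemma plane_graph_euler_bound {T} (eq_dec : forall e f : T, {e = f} + {e <> f})
    (lf rg : T -> point) (E : list T) (V : list point) :
  plane_graph lf rg E V -> NoDup (map fst V) -> euler_bound lf rg E V.
Proof.
  intros plane distinct_x g girth.
  destruct (plane_graph_faces eq_dec lf rg E V plane distinct_x)
    as (Zs & count & faces_leafless & at_most_two).
  assert (Hcount := double_count (fun e (Z : T -> bool) => Z e) g 2 E Zs).
  assert (g * length Zs <= 2 * length E)%nat; [|nia].
  apply Hcount; auto. intros Z HZ.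
  destruct (girth Z (faces_leafless Z HZ)) as (l & distinct & <- & Hl).
  apply NoDup_incl_length; auto. intros e He. apply filter_In. auto.
Qed.

(** * Hall's condition for small sets in bipartite graphs obeying Euler's bound *)

Lemma split_triple_free {T} (r : T -> T -> Prop) (l : list T) :
  (forall x y, r x y -> r y x) -> NoDup l ->
  (forall x y z, In x l -> In y l -> In z l -> NoDup [x; y; z] -> r x y -> r x z -> False) ->
  exists l1 l2, Permutation l (l1 ++ l2) /\
    (forall x y, In x l1 -> In y l1 -> x <> y -> ~ r x y) /\
    (forall x y, In x l2 -> In y l2 -> x <> y -> ~ r x y).
Proof.
  intros r_sym distinct triple_free.
  assert (extend : forall a l', (~ exists y, In y l' /\ r a y) ->
    (forall x y, In x l' -> In y l' -> x <> y -> ~ r x y) ->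
    forall x y, In x (a :: l') -> In y (a :: l') -> x <> y -> ~ r x y).
  { intros a l' isolated unrelated x y [<-|Hx] [<-|Hy] Hne Hr; [easy| | |].
    - apply isolated; eauto.
    - apply isolated; eauto.
    - exact (unrelated x y Hx Hy Hne Hr). }
  induction distinct as [|a l a_new distinct IH].
  - exists [], []; repeat split; auto.
  - destruct IH as (l1 & l2 & perm & unrelated1 & unrelated2).
    { intros x y z Hx Hy Hz; apply triple_free; simpl; auto. }
    destruct (classic (exists y, In y l1 /\ r a y)) as [(y & Hy & Hay)|isolated].
    + destruct (classic (exists z, In z l2 /\ r a z)) as [(z & Hz & Haz)|isolated].
      * exfalso. assert (distinct' := Permutation_NoDup perm distinct).
        assert (Hyl : In y l) by (rewrite perm, in_app_iff; auto).
        assert (Hzl : In z l) by (rewrite perm, in_app_iff; auto).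
        apply (triple_free a y z); simpl; auto.
        assert (y <> z).
        { intros ->. apply in_split in Hy as (u1 & u2 & ->).
          rewrite <- app_assoc in distinct'. apply NoDup_remove_2 in distinct'.
          apply distinct'. rewrite !in_app_iff; auto. }
        repeat constructor; simpl; intuition congruence.
      * exists l1, (a :: l2). split; [now apply Permutation_cons_app|]. eauto.
    + exists (a :: l1), l2. split; [now constructor|]. eauto.
Qed.

Section BipartiteGraph.
Context {U : Type} (eq_dec : forall x y : U, {x = y} + {x <> y}).

Definition bipartite (B R : list U) (E : list (U * U)) : Prop :=
  forall b o, In (b, o) E -> In b B /\ In o R.

Section EulerBound.
Variables (B R : list U) (E : list (U * U)).
Hypothesis disjoint : forall c, In c B -> ~ In c R.
Hypothesis E_bipartite : bipartite B R E.

Definition selected (Z : U * U -> bool) (e : U * U) : Prop := In e E /\ Z e = true.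

Lemma leafless_other_snd Z b o :
  leafless fst snd E Z -> selected Z (b, o) -> exists o', selected Z (b, o') /\ o' <> o.
Proof.
  intros [_ no_leaf] [He HZ].
  destruct (no_leaf b (b, o) He HZ (or_introl eq_refl))
    as ([b' o'] & He' & Hne & HZ' & [Hb|Ho]); simpl in *; subst.
  - exists o'. repeat split; auto. congruence.
  - exfalso. apply (disjoint b); [apply (E_bipartite b o He)|apply (E_bipartite b' b He')].
Qed.

Lemma leafless_other_fst Z b o :
  leafless fst snd E Z -> selected Z (b, o) -> exists b', selected Z (b', o) /\ b' <> b.
Proof.
  intros [_ no_leaf] [He HZ].
  destruct (no_leaf o (b, o) He HZ (or_intror eq_refl))
    as ([b' o'] & He' & Hne & HZ' & [Hb|Ho]); simpl in *; subst.
  - exfalso. apply (disjoint o); [apply (E_bipartite o o' He')|apply (E_bipartite b o He)].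
  - exists b'. repeat split; auto. congruence.
Qed.

Lemma leafless_path Z :
  leafless fst snd E Z -> exists b0 o0 o1 b1 o2,
    selected Z (b0, o0) /\ selected Z (b0, o1) /\ selected Z (b1, o1) /\ selected Z (b1, o2) /\
    o1 <> o0 /\ b1 <> b0 /\ o2 <> o1.
Proof.
  intros Hleafless. destruct (proj1 Hleafless) as ([b0 o0] & He & HZ).
  destruct (leafless_other_snd Z b0 o0) as (o1 & edge01 & Ho1); [auto|split; auto|].
  destruct (leafless_other_fst Z b0 o1) as (b1 & edge11 & Hb1); auto.
  destruct (leafless_other_snd Z b1 o1) as (o2 & edge12 & Ho2); auto.
  exists b0, o0, o1, b1, o2. unfold selected in *. tauto.
Qed.

Hypothesis euler : euler_bound fst snd E (B ++ R).

Lemma bipartite_length_edges_le : (length E <= 2 * (length B + length R))%nat.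
Proof.
  assert (bound := euler 4%nat). rewrite length_app in bound.
  enough (4 * length E <= 2 * length E + 4 * (length B + length R))%nat by lia.
  apply bound. intros Z HZ.
  destruct (leafless_path Z HZ) as
    (b0 & o0 & o1 & b1 & o2 & edge00 & edge01 & edge11 & edge12 & Ho1 & Hb1 & Ho2).
  exists [(b0, o0); (b0, o1); (b1, o1); (b1, o2)]. split; [|split].
  - repeat constructor; simpl; intuition congruence.
  - reflexivity.
  - intros e [<-|[<-|[<-|[<-|[]]]]]; auto.
Qed.

Definition neighbours (E' : list (U * U)) (b : U) : list U :=
  map snd (filter (fun e => eqb_of eq_dec (fst e) b) E').

Lemma in_neighbours E' b o : In o (neighbours E' b) <-> In (b, o) E'.
Proof.
  unfold neighbours. rewrite in_map_iff. split.
  - intros ([b' o'] & <- & He). apply filter_In in He as [He Hb].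
    apply eqb_of_eq in Hb. simpl in *; congruence.
  - intros He. exists (b, o). split; auto. apply filter_In. split; auto.
    now apply eqb_of_eq.
Qed.

Lemma NoDup_neighbours E' b : NoDup E' -> NoDup (neighbours E' b).
Proof.
  intros distinct. unfold neighbours. apply NoDup_map_NoDup_ForallPairs; [|now apply NoDup_filter].
  intros [b1 o1] [b2 o2] He1 He2 Ho. apply filter_In in He1 as [_ Hb1], He2 as [_ Hb2].
  apply eqb_of_eq in Hb1, Hb2. simpl in *; congruence.
Qed.

(* Without a 4-cycle a leafless set follows a path of six edges. *)
Lemma bipartite_girth6_length_edges_le :
  (forall b, In b B -> (length (neighbours E b) <= 2)%nat) ->
  (forall b b' o o', b <> b' -> o <> o' ->
     In (b, o) E -> In (b, o') E -> In (b', o) E -> In (b', o') E -> False) ->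
  (2 * length E <= 3 * (length B + length R))%nat.
Proof.
  intros degree_le no_square. assert (bound := euler 6%nat). rewrite length_app in bound.
  enough (6 * length E <= 2 * length E + 6 * (length B + length R))%nat by lia.
  apply bound. intros Z HZ.
  destruct (leafless_path Z HZ) as
    (b0 & o0 & o1 & b1 & o2 & edge00 & edge01 & edge11 & edge12 & Ho1 & Hb1 & Ho2).
  assert (Ho20 : o2 <> o0).
  { intros ->. unfold selected in *. apply (no_square b0 b1 o0 o1); intuition congruence. }
  destruct (leafless_other_fst Z b1 o2) as (b2 & edge22 & Hb2); auto.
  assert (Hb20 : b2 <> b0).
  { intros ->. assert (three : (length [o0; o1; o2] <= length (neighbours E b0))%nat).
    { apply NoDup_incl_length; [repeat constructor; simpl; intuition congruence|].
      intros o [<-|[<-|[<-|[]]]]; apply in_neighbours; unfold selected in *; tauto. }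
    assert (Hb0 : In b0 B) by (apply (E_bipartite b0 o0), edge00).
    specialize (degree_le b0 Hb0). simpl in three. lia. }
  destruct (leafless_other_snd Z b2 o2) as (o3 & edge23 & Ho3); auto.
  exists [(b0, o0); (b0, o1); (b1, o1); (b1, o2); (b2, o2); (b2, o3)]. split; [|split].
  - repeat constructor; simpl; intuition congruence.
  - reflexivity.
  - intros e [<-|[<-|[<-|[<-|[<-|[<-|[]]]]]]]; auto.
Qed.

End EulerBound.

Definition edges_from (E : list (U * U)) (B : list U) : list (U * U) :=
  filter (fun e => memb eq_dec B (fst e)) E.

Lemma in_edges_from E B b o : In (b, o) (edges_from E B) <-> In (b, o) E /\ In b B.
Proof. unfold edges_from. now rewrite filter_In, memb_in. Qed.

Lemma neighbours_edges_from E B b :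
  In b B -> neighbours (edges_from E B) b = neighbours E b.
Proof.
  intros Hb. unfold neighbours, edges_from. f_equal. induction E as [|e E IH]; simpl; auto.
  destruct (memb eq_dec B (fst e)) eqn:e_from; simpl.
  - now rewrite IH.
  - rewrite IH. destruct (eqb_of eq_dec (fst e) b) eqn:e_b; auto.
    apply eqb_of_eq in e_b. rewrite e_b in e_from. apply memb_in with (eq_dec := eq_dec) in Hb.
    congruence.
Qed.

Lemma length_edges_ge E B d :
  NoDup B -> (forall b, In b B -> (d <= length (neighbours E b))%nat) ->
  (d * length B <= length E)%nat.
Proof.
  intros distinct degree_ge.
  assert (count := double_count (fun e b => eqb_of eq_dec (fst e) b) d 1 E B).
  rewrite Nat.mul_1_l in count. apply count.
  - intros b Hb. specialize (degree_ge b Hb). unfold neighbours in degree_ge.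
    now rewrite length_map in degree_ge.
  - intros e _. change 1%nat with (length [fst e]).
    apply NoDup_incl_length; [now apply NoDup_filter|].
    intros b Hb. apply filter_In in Hb as [_ Hb]. apply eqb_of_eq in Hb. simpl; auto.
Qed.

Definition small_hall (k : nat) (B R : list U) (E : list (U * U)) : Prop :=
  forall Bs Rs, NoDup Bs -> incl Bs B -> incl Rs R ->
  (length Rs < length Bs <= k)%nat -> exists b o, In b Bs /\ In (b, o) E /\ ~ In o Rs.

Section SmallHall.
Variables (B R : list U) (E : list (U * U)).
Hypothesis disjoint : forall c, In c B -> ~ In c R.
Hypothesis E_bipartite : bipartite B R E.
Hypothesis B_distinct : NoDup B.
Hypothesis E_distinct : NoDup E.
Hypothesis euler : forall B', incl B' B -> NoDup B' ->
  euler_bound fst snd (edges_from E B') (B' ++ R).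
Hypothesis hall : small_hall 3 B R E.

Definition degree (b : U) : nat := length (neighbours E b).

Lemma edges_from_bipartite B' : bipartite B' R (edges_from E B').
Proof.
  intros b o He. apply in_edges_from in He as [He Hb]. split; auto. now apply (E_bipartite b o).
Qed.

Lemma degree_edges_from B' d :
  NoDup B' -> (forall b, In b B' -> (d <= degree b)%nat) ->
  (d * length B' <= length (edges_from E B'))%nat.
Proof.
  intros distinct degree_ge. apply length_edges_ge; auto.
  intros b Hb. rewrite neighbours_edges_from by auto. exact (degree_ge b Hb).
Qed.

Lemma degree_pos b : In b B -> (1 <= degree b)%nat.
Proof.
  intros Hb. destruct (hall [b] []) as (b' & o & [<-|[]] & He & _); simpl; auto.
  - repeat constructor; auto.
  - intros x [<-|[]]; auto.
  - easy.
  - apply in_neighbours in He. unfold degree. destruct (neighbours E b); [easy|simpl; lia].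
Qed.

Lemma degree_one_le B' :
  incl B' B -> NoDup B' -> (forall b, In b B' -> degree b = 1%nat) ->
  (length B' <= length R)%nat.
Proof.
  intros B'_sub distinct degree_1.
  assert (single : forall b, In b B' -> exists o, neighbours E b = [o]).
  { intros b Hb. specialize (degree_1 b Hb). unfold degree in degree_1.
    destruct (neighbours E b) as [|o [|]]; simpl in degree_1; try lia. eauto. }
  assert (in_R : forall b o, In o (neighbours E b) -> In o R)
    by (intros b o Ho; apply in_neighbours in Ho; now apply (E_bipartite b o)).
  set (only := fun b => hd b (neighbours E b)).
  rewrite <- (length_map only). apply NoDup_incl_length.
  - apply NoDup_map_NoDup_ForallPairs; auto. intros b b' Hb Hb' same. apply NNPP; intros Hne.
    destruct (single b Hb) as (o & Eo). destruct (single b' Hb') as (o' & Eo').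
    unfold only in same. rewrite Eo, Eo' in same. simpl in same. subst o'.
    destruct (hall [b; b'] [o]) as (c & p & Hc & Hp & p_new); simpl; auto.
    + repeat constructor; simpl; intuition congruence.
    + intros x [<-|[<-|[]]]; auto.
    + intros x [<-|[]]. apply (in_R b). rewrite Eo. now left.
    + apply in_neighbours in Hp. apply p_new.
      destruct Hc as [<-|[<-|[]]]; [now rewrite Eo in Hp|now rewrite Eo' in Hp].
  - intros o Ho. apply in_map_iff in Ho as (b & <- & Hb). unfold only.
    destruct (single b Hb) as (o & Eo). apply (in_R b). rewrite Eo. now left.
Qed.

Lemma degree_ge_three_le B' :
  incl B' B -> NoDup B' -> (forall b, In b B' -> (3 <= degree b)%nat) ->
  (length B' <= 2 * length R)%nat.
Proof.
  intros B'_sub distinct degree_3.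
  assert (edges_ge := degree_edges_from B' 3 distinct degree_3).
  assert (edges_le := bipartite_length_edges_le B' R (edges_from E B')).
  enough (length (edges_from E B') <= 2 * (length B' + length R))%nat by lia.
  apply edges_le; auto. apply edges_from_bipartite.
Qed.

Lemma degree_two_distinct_neighbours_le B' :
  incl B' B -> NoDup B' -> (forall b, In b B' -> degree b = 2%nat) ->
  (forall b b', In b B' -> In b' B' -> b <> b' -> ~ incl (neighbours E b) (neighbours E b')) ->
  (length B' <= 3 * length R)%nat.
Proof.
  intros B'_sub distinct degree_2 distinct_neighbours.
  assert (edges_ge : (2 * length B' <= length (edges_from E B'))%nat).
  { apply degree_edges_from; auto. intros b Hb. now rewrite degree_2. }
  enough (2 * length (edges_from E B') <= 3 * (length B' + length R))%nat by lia.
  apply bipartite_girth6_length_edges_le; auto.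
  - apply edges_from_bipartite.
  - intros b Hb. rewrite neighbours_edges_from by auto.
    apply Nat.eq_le_incl, degree_2, Hb.
  - intros b b' o o' b_neq o_neq He1 He2 He3 He4.
    apply in_edges_from in He1 as [He1 Hb], He2 as [He2 _], He3 as [He3 Hb'], He4 as [He4 _].
    apply in_neighbours in He1, He2, He3, He4.
    apply (distinct_neighbours b b'); auto.
    specialize (degree_2 b Hb). unfold degree in degree_2.
    destruct (neighbours E b) as [|p [|q [|]]]; simpl in *; try lia.
    intros x [<-|[<-|[]]]; intuition (subst; auto; congruence).
Qed.

Lemma degree_two_le B' :
  incl B' B -> NoDup B' -> (forall b, In b B' -> degree b = 2%nat) ->
  (length B' <= 6 * length R)%nat.
Proof.
  intros B'_sub distinct degree_2.
  set (same_neighbours := fun b b' =>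
    incl (neighbours E b) (neighbours E b') /\ incl (neighbours E b') (neighbours E b)).
  assert (incl_same : forall b b', In b B' -> In b' B' ->
    incl (neighbours E b) (neighbours E b') -> same_neighbours b b').
  { intros b b' Hb Hb' Hincl. split; auto. apply NoDup_length_incl; auto.
    - now apply NoDup_neighbours.
    - apply degree_2 in Hb, Hb'. unfold degree in *. lia. }
  destruct (split_triple_free same_neighbours B') as (B1 & B2 & perm & distinct1 & distinct2); auto.
  - unfold same_neighbours; tauto.
  - intros b b' b'' Hb Hb' Hb'' triple [_ incl_b'] [_ incl_b''].
    destruct (hall [b; b'; b''] (neighbours E b)) as (c & o & Hc & Ho & o_new); auto.
    + intros x [<-|[<-|[<-|[]]]]; auto.
    + intros o Ho. apply in_neighbours in Ho. now apply (E_bipartite b o).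
    + apply degree_2 in Hb. unfold degree in Hb. simpl; lia.
    + apply in_neighbours in Ho. apply o_new. destruct Hc as [<-|[<-|[<-|[]]]]; auto.
  - assert (sub : forall b, In b B1 \/ In b B2 -> In b B')
      by (intros b Hb; now rewrite perm, in_app_iff).
    apply (Permutation_NoDup perm) in distinct.
    assert (B1_le : (length B1 <= 3 * length R)%nat).
    { apply degree_two_distinct_neighbours_le; auto.
      - intros b Hb; auto.
      - now apply NoDup_app_remove_r in distinct.
      - intros b b' Hb Hb' Hne Hincl. apply (distinct1 b b'); auto. }
    assert (B2_le : (length B2 <= 3 * length R)%nat).
    { apply degree_two_distinct_neighbours_le; auto.
      - intros b Hb; auto.
      - now apply NoDup_app_remove_l in distinct.
      - intros b b' Hb Hb' Hne Hincl. apply (distinct2 b b'); auto. }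
    rewrite (Permutation_length perm), length_app. lia.
Qed.

Lemma small_hall_length_le : (length B <= 9 * length R)%nat.
Proof.
  set (by_degree := fun p : nat -> bool => filter (fun b => p (degree b)) B).
  assert (sub : forall p, incl (by_degree p) B)
    by (intros p b Hb; apply filter_In in Hb; tauto).
  assert (distinct : forall p, NoDup (by_degree p)) by (intros p; now apply NoDup_filter).
  assert (le1 : (length (by_degree (Nat.eqb 1)) <= length R)%nat).
  { apply degree_one_le; auto. intros b Hb. apply filter_In in Hb as [_ Hb].
    now apply Nat.eqb_eq in Hb. }
  assert (le2 : (length (by_degree (Nat.eqb 2)) <= 6 * length R)%nat).
  { apply degree_two_le; auto. intros b Hb. apply filter_In in Hb as [_ Hb].
    now apply Nat.eqb_eq in Hb. }
  assert (le3 : (length (by_degree (Nat.leb 3)) <= 2 * length R)%nat).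
  { apply degree_ge_three_le; auto. intros b Hb. apply filter_In in Hb as [_ Hb].
    now apply Nat.leb_le in Hb. }
  enough (length B <= length (by_degree (Nat.eqb 1)) + length (by_degree (Nat.eqb 2))
    + length (by_degree (Nat.leb 3)))%nat by lia.
  unfold by_degree. assert (pos := degree_pos). clear - pos.
  induction B as [|b B' IH]; cbn [filter length]; auto.
  specialize (IH (fun x Hx => pos x (or_intror Hx))). specialize (pos b (or_introl eq_refl)).
  destruct (Nat.eqb_spec 1 (degree b)), (Nat.eqb_spec 2 (degree b)),
    (Nat.leb_spec 3 (degree b)); cbn [length]; lia.
Qed.

End SmallHall.
End BipartiteGraph.

(** * Distances in the plane *)

Definition sqdist (c p : point) : R := (fst p - fst c) ^ 2 + (snd p - snd c) ^ 2.

Lemma sqdist_sym a b : sqdist a b = sqdist b a.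
Proof. unfold sqdist; ring. Qed.

Lemma sqdist_refl a : sqdist a a = 0.
Proof. unfold sqdist; ring. Qed.

Lemma sqdist_nonneg a b : 0 <= sqdist a b.
Proof. apply Rplus_le_le_0_compat; apply pow2_ge_0. Qed.

Lemma sqdist_pos a b : a <> b -> 0 < sqdist a b.
Proof.
  intros a_neq_b. destruct (sqdist_nonneg a b) as [|zero]; auto. exfalso; apply a_neq_b.
  destruct a as [ax ay], b as [bx by_]. unfold sqdist in zero; cbn [fst snd] in zero.
  destruct (Rplus_sqr_eq_0 (bx - ax) (by_ - ay)) as [Hx Hy]; [unfold Rsqr; lra|].
  f_equal; lra.
Qed.

Definition convex_comb (s : R) (a b : point) : point :=
  ((1 - s) * fst a + s * fst b, (1 - s) * snd a + s * snd b).

Lemma sqdist_convex_comb s a b q :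
  sqdist (convex_comb s a b) q =
  (1 - s) * sqdist a q + s * sqdist b q - s * (1 - s) * sqdist a b.
Proof. unfold sqdist, convex_comb; cbn [fst snd]; ring. Qed.

Lemma orthogonal_to_same_parallel dx dy ux uy vx vy :
  ~ (dx = 0 /\ dy = 0) -> dx * ux + dy * uy = 0 -> dx * vx + dy * vy = 0 ->
  ux * vy = uy * vx.
Proof.
  intros d_nonzero u_orth v_orth. apply Rminus_diag_uniq.
  apply Rmult_eq_reg_r with (dx * dx + dy * dy).
  - transitivity ((dx * vy - dy * vx) * (dx * ux + dy * uy)
      + (dy * ux - dx * uy) * (dx * vx + dy * vy)); [ring|].
    rewrite u_orth, v_orth; ring.
  - intros zero. apply d_nonzero. now apply Rplus_sqr_eq_0.
Qed.

Lemma parallel_convex_comb a b c :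
  a <> b ->
  (fst b - fst a) * (snd c - snd a) = (snd b - snd a) * (fst c - fst a) ->
  exists s, c = convex_comb s a b.
Proof.
  intros a_neq_b parallel. assert (ab_pos := sqdist_pos a b a_neq_b).
  set (s := ((fst c - fst a) * (fst b - fst a) + (snd c - snd a) * (snd b - snd a))
    / sqdist a b).
  exists s. destruct a as [ax ay], b as [bx by_], c as [cx cy].
  unfold s, sqdist, convex_comb in *; cbn [fst snd] in *.
  f_equal; field_simplify_eq; try lra; apply Rminus_diag_uniq.
  - transitivity ((by_ - ay) * ((by_ - ay) * (cx - ax) - (bx - ax) * (cy - ay))); [ring|].
    rewrite parallel; ring.
  - transitivity ((bx - ax) * ((bx - ax) * (cy - ay) - (by_ - ay) * (cx - ax))); [ring|].
    rewrite parallel; ring.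
Qed.

Lemma circumcentre_unique q q' a b c :
  a <> b -> a <> c -> b <> c ->
  sqdist a q = sqdist b q -> sqdist a q = sqdist c q ->
  sqdist a q' = sqdist b q' -> sqdist a q' = sqdist c q' -> q = q'.
Proof.
  intros a_neq_b a_neq_c b_neq_c ab_q ac_q ab_q' ac_q'. apply NNPP; intros q_neq.
  assert (orthogonal : forall x, sqdist a q = sqdist x q -> sqdist a q' = sqdist x q' ->
    (fst q - fst q') * (fst x - fst a) + (snd q - snd q') * (snd x - snd a) = 0).
  { unfold sqdist. intros x x_q x_q'. lra. }
  destruct (parallel_convex_comb a b c a_neq_b) as [s c_comb].
  { apply (orthogonal_to_same_parallel (fst q - fst q') (snd q - snd q')); auto.
    intros [Hx Hy]. apply q_neq. destruct q, q'; simpl in *; f_equal; lra. }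
  assert (c_dist := sqdist_convex_comb s a b q). rewrite <- c_comb in c_dist.
  assert (ab_pos := sqdist_pos a b a_neq_b).
  assert (s_ends : s * (1 - s) = 0).
  { apply Rmult_eq_reg_r with (sqdist a b); [|lra]. rewrite <- ab_q, <- ac_q in c_dist. lra. }
  apply Rmult_integral in s_ends as [Hs|Hs].
  - apply a_neq_c. rewrite c_comb, Hs. destruct a; unfold convex_comb; simpl; f_equal; ring.
  - apply b_neq_c. rewrite c_comb. replace s with 1 by lra.
    destruct b; unfold convex_comb; simpl; f_equal; ring.
Qed.

Fixpoint argmin {T} (k : T -> R) (x : T) (l : list T) : T :=
  match l with
  | [] => x
  | y :: l' => let z := argmin k y l' in if Rle_dec (k x) (k z) then x else z
  end.

Lemma argmin_spec {T} (k : T -> R) (x : T) (l : list T) :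
  In (argmin k x l) (x :: l) /\ forall y, In y (x :: l) -> k (argmin k x l) <= k y.
Proof.
  revert x; induction l as [|y l IH]; intros x; simpl argmin.
  - split; [now left|]. intros y [<-|[]]; lra.
  - destruct (IH y) as [min_in min_le]. destruct (Rle_dec (k x) (k (argmin k y l))) as [x_le|x_gt].
    + split; [now left|]. intros z [<-|Hz]; [lra|]. specialize (min_le z Hz); lra.
    + split; [now right|]. intros z [<-|Hz]; [lra|]. now apply min_le.
Qed.

Definition nearest (q : point) (l : list point) : point :=
  argmin (fun c => sqdist c q) (hd (0, 0) l) (tl l).

Lemma nearest_spec q l : l <> [] ->
  In (nearest q l) l /\ forall c, In c l -> sqdist (nearest q l) q <= sqdist c q.
Proof. destruct l as [|c l]; [easy|intros _]. apply (argmin_spec (fun x => sqdist x q)). Qed.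

(** * Exchange edges: chords of empty circles *)

(* All the affine functions [t |-> (1 - t) g x + t h x] are positive at [t = 1];
   the last zero belongs to the [x] with the least ratio [g x / h x]. *)
Lemma exists_last_zero {T} (g h : T -> R) (l : list T) (x0 : T) :
  (forall x, In x l -> 0 < h x) -> In x0 l -> g x0 <= 0 ->
  exists t y, 0 <= t < 1 /\ In y l /\ (1 - t) * g y + t * h y = 0 /\
    forall x, In x l -> 0 <= (1 - t) * g x + t * h x.
Proof.
  intros h_pos Hx0 g_x0. destruct l as [|x1 l]; [easy|].
  destruct (argmin_spec (fun x => g x / h x) x1 l) as [min_in min_le].
  set (y := argmin (fun x => g x / h x) x1 l) in *. set (s := - (g y / h y)).
  assert (g_y : g y = - s * h y)
    by (unfold s; field; specialize (h_pos y min_in); lra).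
  assert (g_ge : forall x, In x (x1 :: l) -> - s * h x <= g x).
  { intros x Hx. specialize (h_pos x Hx). specialize (min_le x Hx).
    apply Rmult_le_compat_r with (r := h x) in min_le; [|lra].
    replace (g x / h x * h x) with (g x) in min_le by (field; lra). unfold s. lra. }
  assert (s_nonneg : 0 <= s).
  { specialize (g_ge x0 Hx0). specialize (h_pos x0 Hx0). nra. }
  assert (inv_pos : 0 < / (1 + s)) by (apply Rinv_0_lt_compat; lra).
  assert (value : forall x, (1 - s / (1 + s)) * g x + s / (1 + s) * h x
    = (g x + s * h x) * / (1 + s)) by (intros x; field; lra).
  exists (s / (1 + s)), y. split; [|split; [exact min_in|split]].
  - split; [unfold Rdiv; nra|]. apply Rmult_lt_reg_r with (1 + s); [lra|]. field_simplify; lra.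
  - rewrite value, g_y. ring.
  - intros x Hx. rewrite value. specialize (g_ge x Hx).
    apply Rmult_le_pos; lra.
Qed.

Definition balanced (L O : list point) (q : point) : Prop :=
  L <> [] /\ O <> [] /\ sqdist (nearest q L) q = sqdist (nearest q O) q.

Lemma balanced_sym L O q : balanced L O q -> balanced O L q.
Proof. unfold balanced. intuition. Qed.

(* Move from [p] towards its nearest centre [o] in [O], as far as the last point
   where some centre of [L] is as near as [o]. *)
Lemma exists_balanced_of_nearer (L O : list point) p :
  L <> [] -> O <> [] -> (forall c, In c L -> ~ In c O) ->
  sqdist (nearest p L) p <= sqdist (nearest p O) p ->
  exists q, balanced L O q /\
    sqdist (nearest q L) p <= sqdist (nearest p O) p /\
    sqdist (nearest q O) p <= sqdist (nearest p O) p.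
Proof.
  intros L_nonempty O_nonempty disjoint nearer.
  destruct (nearest_spec p L L_nonempty) as [l_in l_min].
  destruct (nearest_spec p O O_nonempty) as [o_in o_min].
  set (o := nearest p O) in *.
  destruct (exists_last_zero (fun c => sqdist c p - sqdist o p) (fun c => sqdist c o) L
    (nearest p L)) as (t & l & Ht & Hl & l_zero & L_nonneg); auto.
  { intros c Hc. apply sqdist_pos. intros ->. eapply disjoint; eauto. }
  { lra. }
  set (q := convex_comb t p o).
  assert (dist_diff : forall c, sqdist c q - sqdist o q =
    (1 - t) * (sqdist c p - sqdist o p) + t * sqdist c o).
  { intros c. unfold q. rewrite !(sqdist_sym _ (convex_comb _ _ _)), !sqdist_convex_comb.
    rewrite !(sqdist_sym _ c), !(sqdist_sym _ o), sqdist_refl. ring. }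
  assert (equidistant_near : forall c, sqdist c q = sqdist o q -> sqdist c p <= sqdist o p).
  { intros c Hc. specialize (dist_diff c). assert (0 <= sqdist c o) by apply sqdist_nonneg. nra. }
  assert (L_far : forall c, In c L -> sqdist o q <= sqdist c q)
    by (intros c Hc; specialize (dist_diff c); specialize (L_nonneg c Hc); lra).
  assert (O_far : forall c, In c O -> sqdist o q <= sqdist c q).
  { intros c Hc. specialize (dist_diff c). specialize (o_min c Hc).
    assert (0 <= sqdist c o) by apply sqdist_nonneg. nra. }
  destruct (nearest_spec q L L_nonempty) as [l'_in l'_min].
  destruct (nearest_spec q O O_nonempty) as [o'_in o'_min].
  assert (l'_dist : sqdist (nearest q L) q = sqdist o q).
  { specialize (L_far _ l'_in). specialize (l'_min l Hl). specialize (dist_diff l). lra. }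
  assert (o'_dist : sqdist (nearest q O) q = sqdist o q).
  { specialize (O_far _ o'_in). specialize (o'_min o o_in). lra. }
  exists q. repeat split; auto. congruence.
Qed.

Lemma exists_balanced (L O : list point) p l o r :
  (forall c, In c L -> ~ In c O) ->
  In l L -> sqdist l p <= r -> In o O -> sqdist o p <= r ->
  exists q, balanced L O q /\ sqdist (nearest q L) p <= r /\ sqdist (nearest q O) p <= r.
Proof.
  intros disjoint Hl l_near Ho o_near.
  assert (L_nonempty : L <> []) by (intros ->; easy).
  assert (O_nonempty : O <> []) by (intros ->; easy).
  assert (l_min := proj2 (nearest_spec p L L_nonempty) l Hl).
  assert (o_min := proj2 (nearest_spec p O O_nonempty) o Ho).
  destruct (Rle_lt_dec (sqdist (nearest p L) p) (sqdist (nearest p O) p)) as [nearer|nearer].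
  - destruct (exists_balanced_of_nearer L O p) as (q & Hq & near_l & near_o); auto.
    exists q. repeat split; try apply Hq; lra.
  - destruct (exists_balanced_of_nearer O L p) as (q & Hq & near_o & near_l); auto; try lra.
    { intros c Hc Hc'. eapply disjoint; eauto. }
    exists q. split; [now apply balanced_sym|lra].
Qed.

Definition exchange_edge (L O : list point) (q : point) : point * point :=
  (nearest q L, nearest q O).

Section ExchangeEdges.
Variables L O : list point.
Hypothesis disjoint : forall c, In c L -> ~ In c O.

Lemma balanced_circle_empty q c :
  balanced L O q -> In c L \/ In c O -> sqdist (nearest q L) q <= sqdist c q.
Proof.
  intros (L_nonempty & O_nonempty & same_dist) [Hc|Hc].
  - now apply nearest_spec.
  - rewrite same_dist. now apply nearest_spec.
Qed.

Lemma exchange_edge_ends q :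
  balanced L O q -> In (nearest q L) L /\ In (nearest q O) O /\ nearest q L <> nearest q O.
Proof.
  intros (L_nonempty & O_nonempty & _). destruct (nearest_spec q L L_nonempty) as [l_in _].
  destruct (nearest_spec q O O_nonempty) as [o_in _]. repeat split; auto.
  intros same. rewrite same in l_in. eapply disjoint; eauto.
Qed.

Lemma exchange_edge_avoids q s c :
  balanced L O q -> In c L \/ In c O -> 0 < s < 1 ->
  convex_comb s (nearest q L) (nearest q O) <> c.
Proof.
  intros Hq Hc Hs on_edge. assert (outside := balanced_circle_empty q c Hq Hc).
  destruct (exchange_edge_ends q Hq) as (_ & _ & ends_neq).
  assert (c_dist := sqdist_convex_comb s (nearest q L) (nearest q O) q).
  rewrite on_edge in c_dist. destruct Hq as (_ & _ & same_dist). rewrite <- same_dist in c_dist.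
  assert (0 < s * (1 - s) * sqdist (nearest q L) (nearest q O)).
  { apply Rmult_lt_0_compat; [nra|now apply sqdist_pos]. }
  lra.
Qed.

(* The power of a common interior point with respect to both empty circles shows
   that each circle passes through all four end points. *)
Lemma crossing_edges_cocircular q q' s t :
  balanced L O q -> balanced L O q' -> 0 < s < 1 -> 0 < t < 1 ->
  convex_comb s (nearest q L) (nearest q O) = convex_comb t (nearest q' L) (nearest q' O) ->
  sqdist (nearest q' L) q = sqdist (nearest q L) q /\
  sqdist (nearest q' O) q = sqdist (nearest q L) q.
Proof.
  intros Hq Hq' Hs Ht meet.
  destruct (exchange_edge_ends q Hq) as (l_in & o_in & _).
  destruct (exchange_edge_ends q' Hq') as (l'_in & o'_in & _).
  assert (l'_out := balanced_circle_empty q _ Hq (or_introl l'_in)).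
  assert (o'_out := balanced_circle_empty q _ Hq (or_intror o'_in)).
  assert (l_out := balanced_circle_empty q' _ Hq' (or_introl l_in)).
  assert (o_out := balanced_circle_empty q' _ Hq' (or_intror o_in)).
  destruct Hq as (_ & _ & same_q). destruct Hq' as (_ & _ & same_q').
  set (l := nearest q L) in *. set (o := nearest q O) in *.
  set (l' := nearest q' L) in *. set (o' := nearest q' O) in *.
  assert (z_q := sqdist_convex_comb s l o q). rewrite meet, sqdist_convex_comb in z_q.
  assert (z_q' := sqdist_convex_comb s l o q'). rewrite meet, sqdist_convex_comb in z_q'.
  assert (power : s * (1 - s) * sqdist l o = t * (1 - t) * sqdist l' o')
    by (apply Rle_antisym; nra).
  assert (mean : (1 - t) * (sqdist l' q - sqdist l q) + t * (sqdist o' q - sqdist l q) = 0)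
    by nra.
  split; nra.
Qed.

Lemma exchange_edges_cross q q' s t :
  balanced L O q -> balanced L O q' -> 0 < s < 1 -> 0 < t < 1 ->
  convex_comb s (nearest q L) (nearest q O) = convex_comb t (nearest q' L) (nearest q' O) ->
  exchange_edge L O q = exchange_edge L O q'.
Proof.
  intros Hq Hq' Hs Ht meet.
  destruct (crossing_edges_cocircular q q' s t Hq Hq' Hs Ht meet) as [l'_q o'_q].
  destruct (crossing_edges_cocircular q' q t s Hq' Hq Ht Hs (eq_sym meet)) as [l_q' o_q'].
  destruct (exchange_edge_ends q Hq) as (l_in & o_in & ends_neq).
  destruct (exchange_edge_ends q' Hq') as (l'_in & o'_in & _).
  destruct Hq as (_ & _ & same_q). destruct Hq' as (_ & _ & same_q').
  destruct (point_eq_dec q q') as [<-|q_neq]; [reflexivity|].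
  unfold exchange_edge. f_equal; apply NNPP; intros end_neq; apply q_neq.
  - apply (circumcentre_unique q q' (nearest q L) (nearest q O) (nearest q' L)); auto; try lra.
    intros same. apply (disjoint (nearest q' L)); auto. now rewrite <- same.
  - apply (circumcentre_unique q q' (nearest q L) (nearest q O) (nearest q' O)); auto; try lra.
    intros same. apply (disjoint (nearest q L)); auto. now rewrite same.
Qed.

End ExchangeEdges.

(** * The exchange graph is plane *)

Lemma exists_notin (l : list R) : exists r, ~ In r l.
Proof.
  destruct (argmin_spec (fun x => - x) 0 l) as [_ min_le].
  exists (argmin (fun x => - x) 0 l + 1). intros Hin.
  specialize (min_le _ (or_intror Hin)). simpl in min_le. lra.
Qed.

Definition shear (lam : R) (c : point) : point := (fst c + lam * snd c, snd c).

Lemma shear_inj lam u v : shear lam u = shear lam v -> u = v.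
Proof.
  destruct u as [ux uy], v as [vx vy]. unfold shear; simpl. intros same.
  injection same as same_x same_y. subst. f_equal; lra.
Qed.

Lemma exists_generic_shear (V : list point) :
  exists lam, forall u v, In u V -> In v V ->
    fst (shear lam u) = fst (shear lam v) -> u = v.
Proof.
  destruct (exists_notin (map (fun w => - (fst (fst w) - fst (snd w)) / (snd (fst w) - snd (snd w)))
     (list_prod V V))) as [lam generic].
  exists lam. intros u v Hu Hv same_x. simpl in same_x.
  destruct (Req_EM_T (snd u) (snd v)) as [same_y|y_neq].
  - rewrite same_y in same_x. destruct u, v; simpl in *. f_equal; lra.
  - exfalso; apply generic. apply in_map_iff. exists (u, v). split; [|now apply in_prod].
    simpl. field_simplify_eq; lra.
Qed.

Section ShearedEdges.
Variable lam : R.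

Definition left_end (e : point * point) : point :=
  if Rlt_dec (fst (shear lam (fst e))) (fst (shear lam (snd e)))
  then shear lam (fst e) else shear lam (snd e).

Definition right_end (e : point * point) : point :=
  if Rlt_dec (fst (shear lam (fst e))) (fst (shear lam (snd e)))
  then shear lam (snd e) else shear lam (fst e).

Lemma sheared_edge_point e x :
  fst (left_end e) < x < fst (right_end e) ->
  exists s, 0 < s < 1 /\
    shear lam (convex_comb s (fst e) (snd e)) = (x, height left_end right_end e x).
Proof.
  intros Hx. set (l := left_end e) in *. set (r := right_end e) in *.
  set (s := (x - fst l) / (fst r - fst l)).
  assert (s_mul : s * (fst r - fst l) = x - fst l) by (unfold s; field; lra).
  assert (s_range : 0 < s < 1) by (split; apply Rmult_lt_reg_r with (fst r - fst l); lra).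
  assert (comb : convex_comb s l r = (x, height left_end right_end e x)).
  { unfold convex_comb, height, slope. fold l r. f_equal; [lra|unfold s; field; lra]. }
  rewrite <- comb. unfold l, r, left_end, right_end, shear, convex_comb in *.
  cbn [fst snd] in *. destruct (Rlt_dec _ _).
  - exists s. split; auto. cbn [fst snd]. f_equal; ring.
  - exists (1 - s). split; [lra|]. cbn [fst snd]. f_equal; ring.
Qed.

Lemma incident_sheared e v :
  incident left_end right_end (shear lam v) e <-> incident fst snd v e.
Proof.
  assert (shear_iff : forall u, shear lam u = shear lam v <-> u = v)
    by (intros u; split; [apply shear_inj|congruence]).
  unfold incident, left_end, right_end. destruct (Rlt_dec _ _); rewrite !shear_iff; tauto.
Qed.

Lemma leafless_sheared E Z : leafless left_end right_end E Z -> leafless fst snd E Z.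
Proof.
  intros [nonempty no_leaf]. split; auto. intros v e He HZ Hinc.
  destruct (no_leaf (shear lam v) e He HZ) as (e' & He' & Hne & HZ' & Hinc').
  { now apply incident_sheared. }
  exists e'. apply incident_sheared in Hinc'. auto.
Qed.

End ShearedEdges.

Section ExchangeGraph.
Variables L O : list point.
Hypothesis disjoint : forall c, In c L -> ~ In c O.

Definition all_exchange_edges (E : list (point * point)) : Prop :=
  forall e, In e E -> exists q, balanced L O q /\ e = exchange_edge L O q.

Variables (B : list point) (E : list (point * point)).
Hypothesis B_sub : incl B L.
Hypothesis E_distinct : NoDup E.
Hypothesis E_exchange : all_exchange_edges E.
Hypothesis E_bipartite : bipartite B O E.

Lemma exchange_plane_graph lam :
  (forall u v, In u (L ++ O) -> In v (L ++ O) ->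
     fst (shear lam u) = fst (shear lam v) -> u = v) ->
  plane_graph (left_end lam) (right_end lam) E (map (shear lam) (B ++ O)).
Proof.
  intros generic.
  assert (ends_in : forall e, In e E -> In (fst e) (B ++ O) /\ In (snd e) (B ++ O)).
  { intros [b o] He. destruct (E_bipartite b o He). rewrite !in_app_iff; auto. }
  split; auto.
  - intros e He. destruct (E_exchange e He) as (q & Hq & ->).
    destruct (exchange_edge_ends L O disjoint q Hq) as (l_in & o_in & ends_neq).
    assert (fst (shear lam (nearest q L)) <> fst (shear lam (nearest q O)))
      by (intros same; apply ends_neq, generic; rewrite ?in_app_iff; auto).
    unfold left_end, right_end, exchange_edge. cbn [fst snd] in *. destruct (Rlt_dec _ _); lra.
  - intros e He. destruct (ends_in e He). unfold left_end.
    destruct (Rlt_dec _ _); now apply in_map.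
  - intros e He. destruct (ends_in e He). unfold right_end.
    destruct (Rlt_dec _ _); now apply in_map.
  - intros e f x He Hf e_neq_f e_x f_x same_height. apply e_neq_f.
    destruct (sheared_edge_point lam e x e_x) as (s & Hs & e_point).
    destruct (sheared_edge_point lam f x f_x) as (t & Ht & f_point).
    rewrite <- same_height, <- e_point in f_point. apply shear_inj in f_point.
    destruct (E_exchange e He) as (q & Hq & ->). destruct (E_exchange f Hf) as (q' & Hq' & ->).
    now apply (exchange_edges_cross L O disjoint q q' s t).
  - intros e v He Hv v_x same_height.
    destruct (sheared_edge_point lam e (fst v) v_x) as (s & Hs & e_point).
    rewrite same_height, <- surjective_pairing in e_point.
    apply in_map_iff in Hv as (c & <- & Hc). apply shear_inj in e_point.
    destruct (E_exchange e He) as (q & Hq & ->).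
    apply (exchange_edge_avoids L O disjoint q s c Hq) in e_point; auto.
    apply in_app_iff in Hc as [Hc|Hc]; auto.
Qed.

Lemma exchange_euler_bound : NoDup B -> NoDup O -> euler_bound fst snd E (B ++ O).
Proof.
  intros B_distinct O_distinct. destruct (exists_generic_shear (L ++ O)) as [lam generic].
  assert (distinct_x : NoDup (map fst (map (shear lam) (B ++ O)))).
  { rewrite map_map. apply NoDup_map_NoDup_ForallPairs.
    - assert (sub : incl (B ++ O) (L ++ O)) by (apply incl_app_app; [auto|apply incl_refl]).
      intros u v Hu Hv. apply generic; auto.
    - apply NoDup_app; auto. }
  assert (edge_eq_dec : forall e f : point * point, {e = f} + {e <> f})
    by (decide equality; apply point_eq_dec).
  assert (bound := plane_graph_euler_bound edge_eq_dec _ _ _ _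
    (exchange_plane_graph lam generic) distinct_x).
  intros g girth. rewrite <- (length_map (shear lam)). apply bound.
  intros Z HZ. apply girth. now apply (leafless_sheared lam).
Qed.

End ExchangeGraph.

Lemma exists_exchange_graph (L O P : list point) :
  (forall c, In c L -> ~ In c O) ->
  exists E, NoDup E /\ all_exchange_edges L O E /\ bipartite L O E /\
    forall p l o, In p P -> In l L -> In o O -> in_unit_disk l p -> in_unit_disk o p ->
      exists l' o', In (l', o') E /\ in_unit_disk l' p /\ in_unit_disk o' p.
Proof.
  intros disjoint.
  enough (exists E, all_exchange_edges L O E /\
    forall p l o, In p P -> In l L -> In o O -> in_unit_disk l p -> in_unit_disk o p ->
      exists l' o', In (l', o') E /\ in_unit_disk l' p /\ in_unit_disk o' p)
    as (E & E_exchange & E_covers).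
  { assert (edge_eq_dec : forall e f : point * point, {e = f} + {e <> f})
      by (decide equality; apply point_eq_dec).
    exists (nodup edge_eq_dec E). split; [apply NoDup_nodup|].
    assert (E_exchange' : all_exchange_edges L O (nodup edge_eq_dec E))
      by (intros e He; apply nodup_In in He; auto).
    split; [auto|split].
    - intros l o He. destruct (E_exchange' _ He) as (q & Hq & same). injection same as -> ->.
      destruct (exchange_edge_ends L O disjoint q Hq) as (l_in & o_in & _). auto.
    - intros p l o Hp Hl Ho l_p o_p.
      destruct (E_covers p l o Hp Hl Ho l_p o_p) as (l' & o' & He & cover).
      exists l', o'. split; auto. now apply nodup_In. }
  induction P as [|p P (E & E_exchange & E_covers)]; [exists []; split; easy|].
  destruct (classic (exists l o, In l L /\ In o O /\ in_unit_disk l p /\ in_unit_disk o p))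
    as [(l & o & Hl & Ho & l_p & o_p)|uncovered].
  - destruct (exists_balanced L O p l o 1 disjoint Hl l_p Ho o_p) as (q & Hq & near_l & near_o).
    exists (exchange_edge L O q :: E). split.
    + intros e [<-|He]; eauto.
    + intros p' l' o' [<-|Hp'] Hl' Ho' l'_p o'_p.
      * exists (nearest q L), (nearest q O). split; [now left|auto].
      * destruct (E_covers p' l' o') as (l'' & o'' & He & cover); auto.
        exists l'', o''. split; [now right|auto].
  - exists E. split; auto. intros p' l' o' [<-|Hp'] Hl' Ho' l'_p o'_p.
    + exfalso; apply uncovered. exists l', o'; auto.
    + now apply (E_covers p' l' o').
Qed.

(** * Local optima *)

Definition disk_cover (P S : list point) : Prop :=
  forall p, In p P -> exists c, In c S /\ in_unit_disk c p.

Definition exchanged (L As Ds : list point) : list point := difference point_eq_dec L As ++ Ds.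

Lemma in_exchanged L As Ds c :
  In c (exchanged L As Ds) <-> (In c L /\ ~ In c As) \/ In c Ds.
Proof. unfold exchanged. now rewrite in_app_iff, in_difference. Qed.

Definition locally_optimal (k : nat) (P D L : list point) : Prop :=
  forall As Ds, NoDup As -> incl As L -> incl Ds D -> (length Ds < length As <= k)%nat ->
  ~ disk_cover P (exchanged L As Ds).

(* A smaller exchange is padded by disks that are removed and put back. *)
Lemma locally_optimal_of_exact k P D L :
  NoDup L -> incl L D -> (k <= length L)%nat ->
  (forall As Ds, NoDup As -> incl As L -> incl Ds D -> length As = k ->
     (length Ds < k)%nat -> ~ disk_cover P (exchanged L As Ds)) ->
  locally_optimal k P D L.
Proof.
  intros L_distinct L_sub k_le exact As Ds As_distinct As_sub Ds_sub [Ds_lt As_le] cover.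
  set (kept := difference point_eq_dec L As).
  assert (kept_distinct : NoDup kept) by now apply NoDup_filter.
  assert (in_kept : forall c, In c kept <-> In c L /\ ~ In c As)
    by (intros c; apply in_difference).
  assert (kept_ge := length_difference_ge point_eq_dec L As L_distinct). fold kept in kept_ge.
  set (pad := firstn (k - length As) kept).
  assert (pad_length : length pad = (k - length As)%nat) by (apply firstn_length_le; lia).
  assert (kept_split := firstn_skipn (k - length As) kept). fold pad in kept_split.
  assert (pad_sub : incl pad kept) by (intros c Hc; rewrite <- kept_split, in_app_iff; auto).
  apply (exact (As ++ pad) (Ds ++ pad)).
  - apply NoDup_app; auto.
    + rewrite <- kept_split in kept_distinct. now apply NoDup_app_remove_r in kept_distinct.
    + intros c Hc Hpad. apply pad_sub, in_kept in Hpad. tauto.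
  - intros c Hc. apply in_app_iff in Hc as [Hc|Hc]; auto. apply in_kept; auto.
  - intros c Hc. apply in_app_iff in Hc as [Hc|Hc]; auto. apply L_sub, in_kept; auto.
  - rewrite length_app. lia.
  - rewrite length_app. lia.
  - intros p Hp. destruct (cover p Hp) as (c & Hc & c_p). exists c. split; auto.
    rewrite in_exchanged in *. rewrite !in_app_iff.
    destruct (in_dec point_eq_dec c pad); tauto.
Qed.

Section LocalOptimum.
Variables (P D L O : list point).
Hypothesis L_distinct : NoDup L.
Hypothesis O_distinct : NoDup O.
Hypothesis O_sub : incl O D.
Hypothesis L_covers : disk_cover P L.
Hypothesis O_covers : disk_cover P O.

Lemma locally_optimal_small_hall k (E : list (point * point)) :
  let B := difference point_eq_dec L O in
  let R := difference point_eq_dec O L in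
  locally_optimal k P D L -> bipartite B R E ->
  (forall p l o, In p P -> In l B -> In o R -> in_unit_disk l p -> in_unit_disk o p ->
     exists l' o', In (l', o') E /\ in_unit_disk l' p /\ in_unit_disk o' p) ->
  small_hall k B R E.
Proof.
  intros B R optimal E_bipartite E_covers Bs Rs Bs_distinct Bs_sub Rs_sub lengths.
  apply NNPP; intros no_edge.
  assert (in_B : forall c, In c B <-> In c L /\ ~ In c O) by (intros c; apply in_difference).
  assert (in_R : forall c, In c R <-> In c O /\ ~ In c L) by (intros c; apply in_difference).
  apply (optimal Bs Rs); auto.
  { intros c Hc. apply Bs_sub, in_B in Hc. tauto. }
  { intros c Hc. apply Rs_sub, in_R in Hc. apply O_sub; tauto. }
  intros p Hp. destruct (L_covers p Hp) as (l & Hl & l_p).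
  destruct (O_covers p Hp) as (o & Ho & o_p).
  assert (keep : forall c, In c L -> ~ In c Bs -> in_unit_disk c p ->
    exists c, In c (exchanged L Bs Rs) /\ in_unit_disk c p).
  { intros c Hc Hn c_p. exists c. rewrite in_exchanged; auto. }
  assert (common : forall c, In c L -> In c O -> ~ In c Bs)
    by (intros c HcL HcO Hc; apply Bs_sub, in_B in Hc; tauto).
  destruct (in_dec point_eq_dec l O) as [l_O|l_O]; [apply (keep l); auto|].
  destruct (in_dec point_eq_dec o L) as [o_L|o_L]; [apply (keep o); auto|].
  destruct (E_covers p l o) as (l' & o' & He & l'_p & o'_p); auto.
  { now apply in_B. }
  { now apply in_R. }
  destruct (in_dec point_eq_dec l' Bs) as [l'_Bs|l'_Bs].
  - exists o'. split; auto. apply in_exchanged. right.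
    apply NNPP; intros o'_Rs. apply no_edge. eauto.
  - destruct (E_bipartite l' o' He) as [Hl' _]. apply in_B in Hl'. apply (keep l'); tauto.
Qed.

Lemma locally_optimal_ratio : locally_optimal 3 P D L -> (length L <= 9 * length O)%nat.
Proof.
  intros optimal. apply (length_le_of_difference_le point_eq_dec); auto; [lia|].
  set (B := difference point_eq_dec L O). set (R := difference point_eq_dec O L).
  assert (disjoint : forall c, In c B -> ~ In c R)
    by (intros c; unfold B, R; rewrite !in_difference; tauto).
  assert (B_distinct : NoDup B) by now apply NoDup_filter.
  assert (R_distinct : NoDup R) by now apply NoDup_filter.
  destruct (exists_exchange_graph B R P disjoint)
    as (E & E_distinct & E_exchange & E_bipartite & E_covers).
  apply (small_hall_length_le point_eq_dec B R E disjoint E_bipartite B_distinct E_distinct).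
  - intros B' B'_sub B'_distinct. apply (exchange_euler_bound B R); auto.
    + now apply NoDup_filter.
    + intros e He. apply filter_In in He as [He _]. auto.
    + intros b o He. apply in_edges_from in He as [He Hb]. split; auto.
      now apply (E_bipartite b o).
  - now apply locally_optimal_small_hall.
Qed.

End LocalOptimum.

(** * A structured language over the real RAM *)

Definition memory : Type := ((nat -> Z) * (nat -> R))%type.

Definition at_pc (p : nat) (s : memory) : mstate := MState p (fst s) (snd s).

Inductive test : Type :=
| ILt (a b : nat)
| RLe (a b : nat).

Definition holds (tst : test) (s : memory) : Prop :=
  match tst with
  | ILt a b => (fst s a < fst s b)%Z
  | RLe a b => snd s a <= snd s b
  end.

Definition jump (tst : test) (t : nat) : instr :=
  match tst with ILt a b => JmpILt a b t | RLe a b => JmpRLe a b t end.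

Inductive com : Type :=
| Skip
| Op (i : instr)
| Seq (c1 c2 : com)
| If (tst : test) (c1 c2 : com)
| While (tst : test) (c : com).

Notation "c1 ;; c2" := (Seq c1 c2) (at level 80, right associativity).

Fixpoint size (c : com) : nat :=
  match c with
  | Skip => 0
  | Op _ => 1
  | Seq c1 c2 => size c1 + size c2
  | If _ c1 c2 => 2 + size c2 + size c1
  | While _ c => 3 + size c
  end.

Fixpoint compile (p : nat) (c : com) : program :=
  match c with
  | Skip => []
  | Op i => [i]
  | Seq c1 c2 => compile p c1 ++ compile (p + size c1) c2
  | If tst c1 c2 =>
      jump tst (p + 2 + size c2) :: compile (p + 1) c2 ++
      Jmp (p + 2 + size c2 + size c1) :: compile (p + 2 + size c2) c1
  | While tst c =>
      jump tst (p + 2) :: Jmp (p + 3 + size c) :: compile (p + 2) c ++ [Jmp p]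
  end.

Lemma length_compile c p : length (compile p c) = size c.
Proof.
  revert p; induction c as [| |c1 IH1 c2 IH2|tst c1 IH1 c2 IH2|tst c IH]; intros p; simpl; auto.
  - now rewrite length_app, IH1, IH2.
  - rewrite length_app. simpl. rewrite IH1, IH2. lia.
  - rewrite length_app. simpl. rewrite IH. lia.
Qed.

Definition code_at (prg : program) (p : nat) (l : program) : Prop :=
  forall k i, nth_error l k = Some i -> nth_error prg (p + k) = Some i.

Lemma code_at_app prg p l1 l2 :
  code_at prg p (l1 ++ l2) -> code_at prg p l1 /\ code_at prg (p + length l1) l2.
Proof.
  intros code; split; intros k i Hk.
  - apply code. rewrite nth_error_app1; auto. apply nth_error_Some. congruence.
  - rewrite <- Nat.add_assoc. apply code. rewrite nth_error_app2 by lia.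
    now replace (length l1 + k - length l1)%nat with k by lia.
Qed.

Lemma code_at_cons prg p i l :
  code_at prg p (i :: l) -> nth_error prg p = Some i /\ code_at prg (S p) l.
Proof.
  intros code; split.
  - rewrite <- (Nat.add_0_r p). now apply code.
  - intros k j Hk. rewrite Nat.add_succ_comm. now apply code.
Qed.

Lemma run_S prg t s : run prg (S t) s = run prg t (step prg s).
Proof. reflexivity. Qed.

Lemma run_add prg t1 t2 s : run prg (t1 + t2) s = run prg t2 (run prg t1 s).
Proof. revert s; induction t1; simpl; auto. Qed.

Lemma step_Jmp prg p t s : nth_error prg p = Some (Jmp t) -> step prg (at_pc p s) = at_pc t s.
Proof. intros Hp. unfold step, at_pc. now rewrite Hp. Qed.

Lemma step_jump_true prg p tst t s :
  nth_error prg p = Some (jump tst t) -> holds tst s -> step prg (at_pc p s) = at_pc t s.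
Proof.
  intros Hp Hs. unfold step, at_pc. rewrite Hp. destruct tst as [a b|a b]; simpl in *.
  - apply Z.ltb_lt in Hs. now rewrite Hs.
  - now destruct (Rle_dec (snd s a) (snd s b)).
Qed.

Lemma step_jump_false prg p tst t s :
  nth_error prg p = Some (jump tst t) -> ~ holds tst s -> step prg (at_pc p s) = at_pc (S p) s.
Proof.
  intros Hp Hs. unfold step, at_pc. rewrite Hp. destruct tst as [a b|a b]; simpl in *.
  - rewrite <- Z.ltb_lt in Hs. apply not_true_is_false in Hs. now rewrite Hs.
  - now destruct (Rle_dec (snd s a) (snd s b)).
Qed.

Definition wp (c : com) (s : memory) (Q : memory -> Prop) (T : nat) : Prop :=
  forall prg p, code_at prg p (compile p c) ->
  exists t s', (t <= T)%nat /\ run prg t (at_pc p s) = at_pc (p + size c) s' /\ Q s'.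

Lemma wp_conseq c s (Q Q' : memory -> Prop) T T' :
  wp c s Q T -> (forall s', Q s' -> Q' s') -> (T <= T')%nat -> wp c s Q' T'.
Proof.
  intros Hwp HQ HT prg p code. destruct (Hwp prg p code) as (t & s' & Ht & Hrun & Hs').
  exists t, s'. repeat split; auto. lia.
Qed.

Lemma wp_time c s Q T T' : wp c s Q T -> (T <= T')%nat -> wp c s Q T'.
Proof. intros Hwp HT. eapply wp_conseq; eauto. Qed.

Lemma wp_skip s (Q : memory -> Prop) : Q s -> wp Skip s Q 0.
Proof. intros HQ prg p _. exists 0%nat, s. simpl. now rewrite Nat.add_0_r. Qed.

Lemma wp_seq c1 c2 s (Q1 Q : memory -> Prop) T1 T2 :
  wp c1 s Q1 T1 -> (forall f g, Q1 (f, g) -> wp c2 (f, g) Q T2) ->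
  wp (c1 ;; c2) s Q (T1 + T2).
Proof.
  intros Hwp1 Hwp2 prg p code. apply code_at_app in code as [code1 code2].
  rewrite length_compile in code2.
  destruct (Hwp1 prg p code1) as (t1 & [f g] & Ht1 & Hrun1 & HQ1).
  destruct (Hwp2 f g HQ1 prg _ code2) as (t2 & s2 & Ht2 & Hrun2 & HQ).
  exists (t1 + t2)%nat, s2. split; [lia|split; auto].
  rewrite run_add, Hrun1, Hrun2. simpl. now rewrite Nat.add_assoc.
Qed.

Lemma wp_instr i c f g s' Q T :
  (forall prg p, nth_error prg p = Some i -> step prg (MState p f g) = at_pc (S p) s') ->
  wp c s' Q T -> wp (Op i ;; c) (f, g) Q (S T).
Proof.
  intros Hstep Hwp. apply (wp_seq _ _ _ (fun s => s = s') _ 1); [|now intros f' g' ->].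
  intros prg p code. apply code_at_cons in code as [Hp _].
  exists 1%nat, s'. split; auto. split; auto. simpl size. rewrite Nat.add_1_r. apply Hstep, Hp.
Qed.

Lemma wp_if tst c1 c2 s Q T :
  (holds tst s -> wp c1 s Q T) -> (~ holds tst s -> wp c2 s Q T) ->
  wp (If tst c1 c2) s Q (2 + T).
Proof.
  intros Htrue Hfalse prg p code. simpl in code.
  apply code_at_cons in code as [Hjump code]. apply code_at_app in code as [code2 code].
  rewrite length_compile in code. apply code_at_cons in code as [Hexit code1].
  replace (p + 2 + size c2)%nat with (S (S p + size c2)) in * by lia.
  replace (p + 1)%nat with (S p) in * by lia.
  destruct (classic (holds tst s)) as [Hs|Hs].
  - destruct (Htrue Hs prg _ code1) as (t & s' & Ht & Hrun & HQ).
    exists (S t), s'. split; [lia|split; auto].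
    rewrite run_S, (step_jump_true _ _ _ _ _ Hjump Hs), Hrun. cbn [run size]. f_equal; lia.
  - destruct (Hfalse Hs prg _ code2) as (t & s' & Ht & Hrun & HQ).
    exists (S (t + 1)), s'. split; [lia|split; auto].
    rewrite run_S, (step_jump_false _ _ _ _ _ Hjump Hs), run_add, Hrun, run_S.
    rewrite (step_Jmp _ _ _ _ Hexit). cbn [run size]. f_equal; lia.
Qed.

Lemma wp_while tst c (Inv : nat -> memory -> Prop) T :
  (forall k s, Inv k s -> holds tst s ->
     wp c s (fun s' => exists j, (j < k)%nat /\ Inv j s') T) ->
  forall k s, Inv k s ->
  wp (While tst c) s (fun s' => (exists j, Inv j s') /\ ~ holds tst s') (k * (T + 2) + 2).
Proof.
  intros Hbody k. induction k as [k IH] using lt_wf_ind. intros s HInv prg p code.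
  assert (loop := code). simpl in code.
  apply code_at_cons in code as [Hjump code]. apply code_at_cons in code as [Hexit code].
  apply code_at_app in code as [code_body code]. rewrite length_compile in code.
  apply code_at_cons in code as [Hback _].
  replace (p + 2)%nat with (S (S p)) in * by lia.
  destruct (classic (holds tst s)) as [Hs|Hs].
  - destruct (Hbody k s HInv Hs prg _ code_body) as (t1 & s1 & Ht1 & Hrun1 & j & Hj & HInv1).
    destruct (IH j Hj s1 HInv1 prg p loop) as (t2 & s2 & Ht2 & Hrun2 & HQ).
    exists (S (t1 + S t2)), s2. split; [nia|split; auto].
    rewrite run_S, (step_jump_true _ _ _ _ _ Hjump Hs), run_add, Hrun1.
    now rewrite run_S, (step_Jmp _ _ _ _ Hback).
  - exists 2%nat, s. split; [lia|split; [|eauto]].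
    rewrite !run_S, (step_jump_false _ _ _ _ _ Hjump Hs), (step_Jmp _ _ _ _ Hexit).
    cbn [run size]. f_equal; lia.
Qed.

Lemma updZ_same f k v : updZ f k v k = v.
Proof. unfold updZ. now rewrite Nat.eqb_refl. Qed.

Lemma updZ_other f k v i : i <> k -> updZ f k v i = f i.
Proof. unfold updZ. intros Hi. apply Nat.eqb_neq in Hi. now rewrite Hi. Qed.

Lemma updR_same f k v : updR f k v k = v.
Proof. unfold updR. now rewrite Nat.eqb_refl. Qed.

Lemma updR_other f k v i : i <> k -> updR f k v i = f i.
Proof. unfold updR. intros Hi. apply Nat.eqb_neq in Hi. now rewrite Hi. Qed.

Section InstructionRules.
Variables (c : com) (f : nat -> Z) (g : nat -> R) (Q : memory -> Prop) (T : nat).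

Lemma wp_IConst d z :
  wp c (updZ f d z, g) Q T -> wp (Op (IConst d z) ;; c) (f, g) Q (S T).
Proof. apply wp_instr. intros prg p Hp. unfold step. now rewrite Hp. Qed.

Lemma wp_IAdd d a b (x y : nat) :
  f a = Z.of_nat x -> f b = Z.of_nat y ->
  wp c (updZ f d (Z.of_nat (x + y)), g) Q T -> wp (Op (IAdd d a b) ;; c) (f, g) Q (S T).
Proof.
  intros Ha Hb. apply wp_instr. intros prg p Hp. unfold step.
  now rewrite Hp, Ha, Hb, <- Nat2Z.inj_add.
Qed.

Lemma wp_ILoadI d a (k : nat) (x : Z) :
  f a = Z.of_nat k -> f k = x ->
  wp c (updZ f d x, g) Q T -> wp (Op (ILoadI d a) ;; c) (f, g) Q (S T).
Proof.
  intros Ha <-. apply wp_instr. intros prg p Hp. unfold step. now rewrite Hp, Ha, Nat2Z.id.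
Qed.

Lemma wp_IStoreI a b (k : nat) (x : Z) :
  f a = Z.of_nat k -> f b = x ->
  wp c (updZ f k x, g) Q T -> wp (Op (IStoreI a b) ;; c) (f, g) Q (S T).
Proof.
  intros Ha <-. apply wp_instr. intros prg p Hp. unfold step. now rewrite Hp, Ha, Nat2Z.id.
Qed.

Lemma wp_RConst d z :
  wp c (f, updR g d (IZR z)) Q T -> wp (Op (RConst d z) ;; c) (f, g) Q (S T).
Proof. apply wp_instr. intros prg p Hp. unfold step. now rewrite Hp. Qed.

Lemma wp_RAdd d a b (x y : R) :
  g a = x -> g b = y ->
  wp c (f, updR g d (x + y)) Q T -> wp (Op (RAdd d a b) ;; c) (f, g) Q (S T).
Proof. intros <- <-. apply wp_instr. intros prg p Hp. unfold step. now rewrite Hp. Qed.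

Lemma wp_RSub d a b (x y : R) :
  g a = x -> g b = y ->
  wp c (f, updR g d (x - y)) Q T -> wp (Op (RSub d a b) ;; c) (f, g) Q (S T).
Proof. intros <- <-. apply wp_instr. intros prg p Hp. unfold step. now rewrite Hp. Qed.

Lemma wp_RMul d a b (x y : R) :
  g a = x -> g b = y ->
  wp c (f, updR g d (x * y)) Q T -> wp (Op (RMul d a b) ;; c) (f, g) Q (S T).
Proof. intros <- <-. apply wp_instr. intros prg p Hp. unfold step. now rewrite Hp. Qed.

Lemma wp_RLoadI d a (k : nat) (x : R) :
  f a = Z.of_nat k -> g k = x ->
  wp c (f, updR g d x) Q T -> wp (Op (RLoadI d a) ;; c) (f, g) Q (S T).
Proof.
  intros Ha <-. apply wp_instr. intros prg p Hp. unfold step. now rewrite Hp, Ha, Nat2Z.id.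
Qed.

Lemma wp_RStoreI a b (k : nat) (x : R) :
  f a = Z.of_nat k -> g b = x ->
  wp c (f, updR g k x) Q T -> wp (Op (RStoreI a b) ;; c) (f, g) Q (S T).
Proof.
  intros Ha <-. apply wp_instr. intros prg p Hp. unfold step. now rewrite Hp, Ha, Nat2Z.id.
Qed.

End InstructionRules.

Lemma wp_if_lt a b c1 c2 (x y : nat) f g Q T1 T2 :
  f a = Z.of_nat x -> f b = Z.of_nat y ->
  ((x < y)%nat -> wp c1 (f, g) Q T1) -> ((y <= x)%nat -> wp c2 (f, g) Q T2) ->
  wp (If (ILt a b) c1 c2) (f, g) Q (2 + (T1 + T2)).
Proof.
  intros Ha Hb Htrue Hfalse. apply wp_if; simpl; rewrite Ha, Hb; intros Htest.
  - eapply wp_time; [apply Htrue; lia|lia].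
  - eapply wp_time; [apply Hfalse; lia|lia].
Qed.

Lemma wp_if_rle a b c1 c2 (x y : R) f g Q T1 T2 :
  g a = x -> g b = y ->
  (x <= y -> wp c1 (f, g) Q T1) -> (y < x -> wp c2 (f, g) Q T2) ->
  wp (If (RLe a b) c1 c2) (f, g) Q (2 + (T1 + T2)).
Proof.
  intros <- <- Htrue Hfalse. apply wp_if; simpl; intros Htest.
  - eapply wp_time; [auto|lia].
  - eapply wp_time; [apply Hfalse; lra|lia].
Qed.

(** * Exchanges in a selection of indices *)

Definition chosen (m : nat) (C : nat -> bool) : list nat := filter C (seq 0 m).

Lemma in_chosen m C j : In j (chosen m C) <-> (j < m)%nat /\ C j = true.
Proof. unfold chosen. rewrite filter_In, in_seq. intuition lia. Qed.

Lemma NoDup_chosen m C : NoDup (chosen m C).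
Proof. apply NoDup_filter, seq_NoDup. Qed.

Lemma chosen_S m C : chosen (S m) C = chosen m C ++ (if C m then [m] else []).
Proof. unfold chosen. now rewrite seq_S, filter_app. Qed.

Lemma length_chosen_le m C : (length (chosen m C) <= m)%nat.
Proof. unfold chosen. rewrite <- (length_seq m 0) at 2. apply filter_length_le. Qed.

Definition without (C : nat -> bool) (out : list nat) : nat -> bool :=
  fun j => C j && negb (memb Nat.eq_dec out j).

Definition swap (C : nat -> bool) (out inn : list nat) : nat -> bool :=
  fun j => memb Nat.eq_dec inn j || without C out j.

Lemma Permutation_chosen_without m C out :
  NoDup out -> incl out (chosen m C) ->
  Permutation (chosen m C) (out ++ chosen m (without C out)).
Proof.
  intros distinct sub.
  assert (in_rest : forall j, In j (chosen m (without C out)) <-> In j (chosen m C) /\ ~ In j out).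
  { intros j. rewrite !in_chosen. unfold without.
    rewrite andb_true_iff, negb_true_iff, <- not_true_iff_false, memb_in. tauto. }
  apply NoDup_Permutation; [apply NoDup_chosen| |].
  - apply (NoDup_app distinct (NoDup_chosen _ _)). intros j Hout Hrest.
    apply in_rest in Hrest. tauto.
  - intros j. rewrite in_app_iff, in_rest. destruct (in_dec Nat.eq_dec j out); intuition.
Qed.

Lemma in_chosen_swap m C out inn j :
  incl inn (seq 0 m) ->
  In j (chosen m (swap C out inn)) <-> In j inn \/ In j (chosen m (without C out)).
Proof.
  intros inn_lt. rewrite !in_chosen. unfold swap. rewrite orb_true_iff, memb_in.
  assert (In j inn -> (j < m)%nat) by (intros Hj; apply inn_lt, in_seq in Hj; lia). tauto.
Qed.

Lemma length_chosen_swap_le m C out inn :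
  NoDup out -> incl out (chosen m C) -> incl inn (seq 0 m) ->
  (length (chosen m (swap C out inn)) + length out <= length inn + length (chosen m C))%nat.
Proof.
  intros distinct sub inn_lt.
  rewrite (Permutation_length (Permutation_chosen_without m C out distinct sub)), length_app.
  enough (length (chosen m (swap C out inn)) <= length (inn ++ chosen m (without C out)))%nat
    by (rewrite length_app in *; lia).
  apply NoDup_incl_length; [apply NoDup_chosen|]. intros j Hj.
  now rewrite in_app_iff, <- in_chosen_swap.
Qed.

Definition multiplicity (mat : nat -> nat -> bool) (l : list nat) (i : nat) : nat :=
  list_sum (map (fun j => Nat.b2n (mat i j)) l).

Lemma multiplicity_app mat l1 l2 i :
  multiplicity mat (l1 ++ l2) i = (multiplicity mat l1 i + multiplicity mat l2 i)%nat.
Proof. unfold multiplicity. now rewrite map_app, list_sum_app. Qed.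

Lemma multiplicity_Permutation mat l1 l2 i :
  Permutation l1 l2 -> multiplicity mat l1 i = multiplicity mat l2 i.
Proof. intros perm. unfold multiplicity. now rewrite perm. Qed.

Lemma multiplicity_pos mat l i :
  (0 < multiplicity mat l i)%nat <-> exists j, In j l /\ mat i j = true.
Proof.
  unfold multiplicity. induction l as [|j l IH]; simpl.
  - split; [lia|intros (j & [] & _)].
  - destruct (mat i j) eqn:Hj; simpl.
    + split; [intros _; exists j; auto|lia].
    + rewrite IH. split; intros (j' & Hj' & Hmat); exists j'; intuition congruence.
Qed.

Lemma multiplicity_chosen_S mat m C i :
  multiplicity mat (chosen (S m) C) i =
  (multiplicity mat (chosen m C) i + (if C m then Nat.b2n (mat i m) else 0))%nat.
Proof.
  rewrite chosen_S, multiplicity_app. unfold multiplicity. destruct (C m); simpl; lia.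
Qed.

Definition feasible (n m : nat) (mat : nat -> nat -> bool) (C : nat -> bool) : Prop :=
  forall i, (i < n)%nat -> (0 < multiplicity mat (chosen m C) i)%nat.

Lemma multiplicity_swap_pos m mat C out inn i :
  NoDup out -> incl out (chosen m C) -> incl inn (seq 0 m) ->
  (0 < multiplicity mat (chosen m (swap C out inn)) i)%nat <->
  (multiplicity mat out i < multiplicity mat (chosen m C) i + multiplicity mat inn i)%nat.
Proof.
  intros distinct sub inn_lt.
  rewrite (multiplicity_Permutation mat _ _ i (Permutation_chosen_without m C out distinct sub)).
  rewrite multiplicity_app, <- Nat.add_assoc.
  assert (shift : forall x y, (x < x + y)%nat <-> (0 < y)%nat) by (intros; lia).
  rewrite shift, Nat.add_comm, <- multiplicity_app, !multiplicity_pos.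
  assert (Hin := fun j => in_chosen_swap m C out inn j inn_lt).
  split; intros (j & Hj & Hmat); exists j; (split; [|exact Hmat]).
  - now rewrite in_app_iff, <- Hin.
  - now rewrite Hin, <- in_app_iff.
Qed.

Definition improving (n m : nat) (mat : nat -> nat -> bool) (C : nat -> bool)
    (a b c d e : nat) : Prop :=
  (a < b < c)%nat /\ incl [a; b; c] (chosen m C) /\ incl [d; e] (seq 0 m) /\
  forall i, (i < n)%nat -> (multiplicity mat [a; b; c] i <
    multiplicity mat (chosen m C) i + multiplicity mat [d; e] i)%nat.

Lemma improving_swap n m mat C a b c d e :
  improving n m mat C a b c d e ->
  feasible n m mat (swap C [a; b; c] [d; e]) /\
  (length (chosen m (swap C [a; b; c] [d; e])) < length (chosen m C))%nat.
Proof.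
  intros (order & out_sub & inn_sub & gain).
  assert (distinct : NoDup [a; b; c]) by (repeat constructor; simpl; lia).
  split.
  - intros i Hi. apply multiplicity_swap_pos; auto.
  - assert (shorter := length_chosen_swap_le m C _ _ distinct out_sub inn_sub).
    simpl in shorter. lia.
Qed.

Definition swap_optimal (n m : nat) (mat : nat -> nat -> bool) (C : nat -> bool) : Prop :=
  forall a b c d e, ~ improving n m mat C a b c d e.

Lemma swap_optimal_exchange n m mat C out inn :
  swap_optimal n m mat C -> NoDup out -> incl out (chosen m C) -> length out = 3%nat ->
  incl inn (seq 0 m) -> (length inn <= 2)%nat -> ~ feasible n m mat (swap C out inn).
Proof.
  intros optimal out_distinct out_sub out_length inn_sub inn_length Hfeasible.
  destruct (exists_strictly_sorted_permutation INR out) as (out' & perm & sorted).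
  { apply NoDup_map_NoDup_ForallPairs; auto. intros x y _ _. apply INR_eq. }
  assert (out_length' := Permutation_length perm). rewrite out_length in out_length'.
  destruct out' as [|a [|b [|c [|]]]]; try discriminate.
  assert (padded : exists d e, incl [d; e] (seq 0 m) /\
    forall i, (multiplicity mat inn i <= multiplicity mat [d; e] i)%nat).
  { unfold multiplicity. destruct inn as [|x [|y [|]]]; simpl in inn_length; try lia.
    - assert (Ha : (a < m)%nat)
        by (apply (in_chosen m C), out_sub; rewrite perm; now left).
      exists a, a. split; [intros z [<-|[<-|[]]]; apply in_seq; lia|simpl; lia].
    - exists x, x. split; [intros z [<-|[<-|[]]]; apply inn_sub; now left|simpl; lia].
    - exists x, y. split; [exact inn_sub|reflexivity]. }
  destruct padded as (d & e & padded_sub & padded_ge). apply (optimal a b c d e).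
  apply StronglySorted_inv in sorted as [sorted a_min].
  apply StronglySorted_inv in sorted as [_ b_min].
  apply Forall_inv in a_min, b_min. apply INR_lt in a_min, b_min.
  split; [auto|split; [|split; [exact padded_sub|]]].
  - intros x Hx. apply out_sub. now rewrite perm.
  - intros i Hi. specialize (Hfeasible i Hi).
    apply multiplicity_swap_pos in Hfeasible; auto.
    rewrite <- (multiplicity_Permutation mat _ _ i perm). specialize (padded_ge i). lia.
Qed.

(** * The local search program *)

Local Notation rN := 0%nat (only parsing).
Local Notation rM := 1%nat (only parsing).
Local Notation rZero := 2%nat (only parsing).
Local Notation rOne := 3%nat (only parsing).
Local Notation rCover := 4%nat (only parsing).
Local Notation rCount := 5%nat (only parsing).
Local Notation rMat := 6%nat (only parsing).
Local Notation rSize := 7%nat (only parsing).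
Local Notation rData := 8%nat (only parsing).
Local Notation rI := 9%nat (only parsing).
Local Notation rJ := 10%nat (only parsing).
Local Notation rAddr := 11%nat (only parsing).
Local Notation rVal := 12%nat (only parsing).
Local Notation rSum := 13%nat (only parsing).
Local Notation rOut := 14%nat (only parsing).
Local Notation rRow := 15%nat (only parsing).
Local Notation rPoint := 16%nat (only parsing).
Local Notation rDisk := 17%nat (only parsing).
Local Notation rFound := 20%nat (only parsing).
Local Notation rA := 21%nat (only parsing).
Local Notation rB := 22%nat (only parsing).
Local Notation rC := 23%nat (only parsing).
Local Notation rD := 24%nat (only parsing).
Local Notation rE := 25%nat (only parsing).
Local Notation rGood := 26%nat (only parsing).
Local Notation rBestA := 31%nat (only parsing).
Local Notation rBestB := 32%nat (only parsing).
Local Notation rBestC := 33%nat (only parsing).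
Local Notation rBestD := 34%nat (only parsing).
Local Notation rBestE := 35%nat (only parsing).
Local Notation registers := 40%nat (only parsing).
Local Notation real_registers := 16%nat (only parsing).

Definition const (d k : nat) : com := Op (IConst d (Z.of_nat k)).

Definition When (tst : test) (c : com) : com := If tst c Skip.

Definition For (r lim : nat) (c : com) : com :=
  const r 0 ;; While (ILt r lim) (c ;; Op (IAdd r r rOne) ;; Skip).

Definition for_time (k T : nat) : nat := k * (T + 3) + 3.

Lemma wp_const d k c f g Q T :
  wp c (updZ f d (Z.of_nat k), g) Q T -> wp (const d k ;; c) (f, g) Q (S T).
Proof. apply wp_IConst. Qed.

Lemma wp_when_lt a b c (x y : nat) f g Q T :
  f a = Z.of_nat x -> f b = Z.of_nat y ->
  ((x < y)%nat -> wp c (f, g) Q T) -> ((y <= x)%nat -> Q (f, g)) ->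
  wp (When (ILt a b) c) (f, g) Q (2 + T).
Proof.
  intros Ha Hb Htrue Hfalse. rewrite <- (Nat.add_0_r T).
  apply (wp_if_lt _ _ _ _ x y); auto. intros Htest. apply wp_skip; auto.
Qed.

Lemma wp_for r lim c (k : nat) (Inv : nat -> memory -> Prop) f g T :
  Inv 0%nat (updZ f r (Z.of_nat 0), g) ->
  (forall j f g, Inv j (f, g) -> f r = Z.of_nat j /\ f lim = Z.of_nat k) ->
  (forall j f g, (j < k)%nat -> Inv j (f, g) ->
     wp c (f, g) (fun s => fst s r = Z.of_nat j /\ fst s rOne = Z.of_nat 1 /\
        Inv (S j) (updZ (fst s) r (Z.of_nat (S j)), snd s)) T) ->
  wp (For r lim c) (f, g) (Inv k) (for_time k T).
Proof.
  intros Inv0 counter body. unfold For, for_time.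
  replace (k * (T + 3) + 3)%nat with (S (k * ((T + 1) + 2) + 2)) by lia. apply wp_const.
  eapply wp_conseq; [|clear f g Inv0|apply Nat.le_refl].
  - apply (wp_while (ILt r lim) _ (fun n s => exists j, (j + n = k)%nat /\ Inv j s) (T + 1))
      with (k := k); [|exists 0%nat; auto].
    clear f g Inv0. intros n [f g] (j & Hj & HInv) Htest.
    destruct (counter j f g HInv) as [r_j lim_k]. simpl in Htest. rewrite r_j, lim_k in Htest.
    eapply wp_seq; [apply (body j f g); auto; lia|].
    intros f' g' (r_j' & one & HInv'). cbn [fst snd] in *.
    eapply wp_IAdd; [exact r_j'|exact one|]. apply wp_skip. rewrite Nat.add_1_r.
    exists (n - 1)%nat. split; [lia|]. exists (S j). split; [lia|auto].
  - intros [f g] ((n & j & Hj & HInv) & Htest).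
    destruct (counter j f g HInv) as [r_j lim_k]. simpl in Htest. rewrite r_j, lim_k in Htest.
    now replace k with j by lia.
Qed.

Section Memory.
Variables (n m : nat) (mat : nat -> nat -> bool).

Local Notation count_base := (registers + m)%nat (only parsing).
Local Notation matrix_base := (count_base + n)%nat (only parsing).
Local Notation input_base := (real_registers + 2 * (n + m))%nat (only parsing).

(* The registers from [rSize] on are work registers. *)
Record constants (f : nat -> Z) : Prop := {
  reg_n : f rN = Z.of_nat n;
  reg_m : f rM = Z.of_nat m;
  reg_zero : f rZero = Z.of_nat 0;
  reg_one : f rOne = Z.of_nat 1;
  reg_cover : f rCover = Z.of_nat registers;
  reg_count : f rCount = Z.of_nat count_base;
  reg_mat : f rMat = Z.of_nat matrix_base }.

Definition cover_at (C : nat -> bool) (f : nat -> Z) : Prop :=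
  forall j, (j < m)%nat -> f (registers + j)%nat = Z.of_nat (Nat.b2n (C j)).

Definition counts_at (C : nat -> bool) (k : nat) (f : nat -> Z) : Prop :=
  forall i, (i < k)%nat -> f (count_base + i)%nat = Z.of_nat (multiplicity mat (chosen m C) i).

(* [k] is the number of entries present, in row-major order. *)
Definition matrix_at (k : nat) (f : nat -> Z) : Prop :=
  forall i j, (j < m)%nat -> (i * m + j < k)%nat ->
  f (matrix_base + i * m + j)%nat = Z.of_nat (Nat.b2n (mat i j)).

Definition input_at (enc : nat -> R) (g : nat -> R) : Prop :=
  forall k, (k < 2 * (n + m))%nat -> g (input_base + k)%nat = enc k.

Definition input_point (enc : nat -> R) (k : nat) : point :=
  (enc (2 * k)%nat, enc (2 * k + 1)%nat).

Definition search_data (C : nat -> bool) (f : nat -> Z) : Prop :=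
  constants f /\ cover_at C f /\ matrix_at (n * m) f.

Lemma constants_updZ f d v : (rSize <= d)%nat -> constants f -> constants (updZ f d v).
Proof. intros Hd []. split; rewrite updZ_other by lia; auto. Qed.

Lemma cover_at_updZ C f d v : (d < registers)%nat -> cover_at C f -> cover_at C (updZ f d v).
Proof. intros Hd HC j Hj. rewrite updZ_other by lia. auto. Qed.

Lemma counts_at_updZ C k f d v :
  (d < registers)%nat -> counts_at C k f -> counts_at C k (updZ f d v).
Proof. intros Hd Hcounts i Hi. rewrite updZ_other by lia. auto. Qed.

Lemma matrix_at_updZ k f d v :
  (d < matrix_base)%nat -> matrix_at k f -> matrix_at k (updZ f d v).
Proof. intros Hd Hmat i j Hj Hij. rewrite updZ_other by lia. auto. Qed.

Lemma input_at_updR enc g d v :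
  (d < real_registers)%nat -> input_at enc g -> input_at enc (updR g d v).
Proof. intros Hd Henc k Hk. rewrite updR_other by lia. auto. Qed.

Lemma search_data_updZ C f d v :
  (rSize <= d < registers)%nat -> search_data C f -> search_data C (updZ f d v).
Proof.
  intros Hd (Hconst & HC & Hmat). split; [|split].
  - apply constants_updZ; auto. lia.
  - apply cover_at_updZ; auto. lia.
  - apply matrix_at_updZ; auto. lia.
Qed.

Ltac constant_register :=
  match goal with
  | H : constants ?f |- ?f _ = _ =>
      first [exact (reg_n _ H) | exact (reg_m _ H) | exact (reg_zero _ H)
            | exact (reg_one _ H) | exact (reg_cover _ H) | exact (reg_count _ H)
            | exact (reg_mat _ H)]
  end.

Ltac read :=
  cbn [fst snd];
  repeat first [rewrite updZ_same | rewrite updR_same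
               | rewrite updZ_other by lia | rewrite updR_other by lia];
  first [ eassumption | constant_register | reflexivity | apply (f_equal Z.of_nat); lia
        | match goal with
          | H : ?f ?r = _ |- ?f ?r = _ => rewrite H; apply (f_equal Z.of_nat); lia
          end ].

Ltac exec_op :=
  first [ apply wp_const
        | eapply wp_IAdd; [read|read|]
        | eapply wp_ILoadI; [read|read|]
        | eapply wp_IStoreI; [read|read|]
        | apply wp_RConst
        | eapply wp_RAdd; [read|read|]
        | eapply wp_RSub; [read|read|]
        | eapply wp_RMul; [read|read|]
        | eapply wp_RLoadI; [read|read|]
        | eapply wp_RStoreI; [read|read|] ].

Ltac exec := repeat exec_op; try apply wp_skip.

Ltac unchanged :=
  repeat match goal with
  | |- constants (updZ _ _ _) => apply constants_updZ; [lia|]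
  | |- cover_at _ (updZ _ _ _) => apply cover_at_updZ; [lia|]
  | |- counts_at _ _ (updZ _ _ _) => apply counts_at_updZ; [lia|]
  | |- matrix_at _ (updZ _ _ _) => apply matrix_at_updZ; [lia|]
  | |- search_data _ (updZ _ _ _) => apply search_data_updZ; [lia|]
  | |- input_at _ (updR _ _ _) => apply input_at_updR; [lia|]
  end;
  assumption.

Ltac check :=
  cbn [fst snd];
  repeat match goal with |- _ /\ _ => split end;
  try match goal with |- _ = _ => read | |- _ => unchanged end.

Definition move_input : com :=
  const rZero 0 ;; const rOne 1 ;; const rCover registers ;; Op (IAdd rCount rCover rM) ;;
  Op (IAdd rMat rCount rN) ;; Op (IAdd rSize rN rM) ;; Op (IAdd rSize rSize rSize) ;;
  const rData real_registers ;; Op (IAdd rData rData rSize) ;;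
  For rI rSize (Op (RLoadI 0 rI) ;; Op (IAdd rAddr rData rI) ;; Op (RStoreI rAddr 0) ;; Skip).

(* The input is moved past the first real registers, which are then free;
   [R[0]] serves as the only temporary because it is moved first. *)
Lemma move_input_spec f enc :
  f rN = Z.of_nat n -> f rM = Z.of_nat m ->
  wp move_input (f, enc)
    (fun s => constants (fst s) /\ fst s rData = Z.of_nat input_base /\
       input_at enc (snd s))
    (9 + for_time (2 * (n + m)) 3).
Proof.
  intros Hn Hm. unfold move_input. exec.
  match goal with |- wp _ (?f', _) _ _ => set (f1 := f') end.
  assert (Hconst : constants f1) by (unfold f1; split; read).
  assert (Hdata : f1 rData = Z.of_nat input_base) by (unfold f1; read).
  assert (Hsize : f1 rSize = Z.of_nat (2 * (n + m))) by (unfold f1; read).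
  clearbody f1. clear f Hn Hm. eapply wp_conseq; [|clear f1 Hconst Hdata Hsize|apply Nat.le_refl].
  - apply (wp_for rI rSize _ _ (fun j s => constants (fst s) /\
      fst s rData = Z.of_nat input_base /\ fst s rSize = Z.of_nat (2 * (n + m)) /\
      fst s rI = Z.of_nat j /\
      (forall k, (k < j)%nat -> snd s (input_base + k)%nat = enc k) /\
      (forall k, (j <= k < 2 * (n + m))%nat -> snd s k = enc k))).
    + check; [lia|auto].
    + cbn [fst snd]. tauto.
    + clear f1 Hconst Hdata Hsize. cbn [fst snd].
      intros j f g Hj (Hconst & Hdata & Hsize & HrI & moved & unmoved).
      exec. check.
      * intros k Hk. destruct (Nat.eq_dec k j) as [->|].
        { rewrite updR_same. apply unmoved; lia. }
        rewrite !updR_other by lia. apply moved; lia.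
      * intros k Hk. rewrite !updR_other by lia. apply unmoved; lia.
  - cbn [fst snd]. intros [f g] (Hconst & Hdata & _ & _ & moved & _). auto.
Qed.

Section IncidenceMatrix.
Variable enc : nat -> R.
Hypothesis mat_disk : forall i j, (i < n)%nat -> (j < m)%nat ->
  mat i j = true <-> in_unit_disk (input_point enc (n + j)) (input_point enc i).

Definition matrix_entry : com :=
  Op (RLoadI 1 rDisk) ;; Op (IAdd rAddr rDisk rOne) ;; Op (RLoadI 2 rAddr) ;;
  Op (RLoadI 3 rPoint) ;; Op (IAdd rAddr rPoint rOne) ;; Op (RLoadI 4 rAddr) ;;
  Op (RSub 1 3 1) ;; Op (RMul 1 1 1) ;; Op (RSub 2 4 2) ;; Op (RMul 2 2 2) ;;
  Op (RAdd 1 1 2) ;; Op (RConst 5 1) ;;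
  If (RLe 1 5) (const rVal 1 ;; Skip) (const rVal 0 ;; Skip) ;;
  Op (IStoreI rRow rVal) ;; Op (IAdd rRow rRow rOne) ;;
  Op (IAdd rDisk rDisk rOne) ;; Op (IAdd rDisk rDisk rOne) ;; Skip.

Definition fill_matrix : com :=
  Op (IAdd rPoint rData rZero) ;; Op (IAdd rRow rMat rZero) ;;
  For rI rN (
    Op (IAdd rDisk rData rN) ;; Op (IAdd rDisk rDisk rN) ;;
    For rJ rM matrix_entry ;;
    Op (IAdd rPoint rPoint rOne) ;; Op (IAdd rPoint rPoint rOne) ;; Skip).

Definition row_state (i j : nat) (s : memory) : Prop :=
  constants (fst s) /\ fst s rData = Z.of_nat input_base /\ input_at enc (snd s) /\
  fst s rI = Z.of_nat i /\ fst s rPoint = Z.of_nat (input_base + 2 * i) /\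
  fst s rRow = Z.of_nat (matrix_base + i * m + j) /\ matrix_at (i * m + j) (fst s).

Definition entry_state (i j : nat) (s : memory) : Prop :=
  row_state i j s /\ fst s rJ = Z.of_nat j /\
  fst s rDisk = Z.of_nat (input_base + 2 * (n + j)).

Lemma matrix_at_S i j f f' :
  (j < m)%nat -> matrix_at (i * m + j) f ->
  f' (matrix_base + i * m + j)%nat = Z.of_nat (Nat.b2n (mat i j)) ->
  (forall k, k <> (matrix_base + i * m + j)%nat -> (registers <= k)%nat -> f' k = f k) ->
  matrix_at (i * m + S j) f'.
Proof.
  intros Hj Hmat new_entry same i' j' Hj' before.
  destruct (Nat.eq_dec (i' * m + j') (i * m + j)) as [same_entry|other_entry].
  - assert (i' = i) as -> by nia. assert (j' = j) as -> by lia. exact new_entry.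
  - rewrite same by lia. apply Hmat; lia.
Qed.

Lemma disk_test_entry i j :
  (i < n)%nat -> (j < m)%nat ->
  let dx := enc (2 * i)%nat - enc (2 * (n + j))%nat in
  let dy := enc (2 * i + 1)%nat - enc (2 * (n + j) + 1)%nat in
  mat i j = true <-> dx * dx + dy * dy <= 1.
Proof.
  intros Hi Hj dx dy. rewrite mat_disk by auto. unfold in_unit_disk, input_point.
  cbn [fst snd]. replace (dx * dx + dy * dy) with (dx ^ 2 + dy ^ 2) by ring. reflexivity.
Qed.

Lemma matrix_entry_spec i j f g :
  (i < n)%nat -> (j < m)%nat -> entry_state i j (f, g) ->
  wp matrix_entry (f, g) (fun s => fst s rJ = Z.of_nat j /\ fst s rOne = Z.of_nat 1 /\
    entry_state i (S j) (updZ (fst s) rJ (Z.of_nat (S j)), snd s)) 20.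
Proof.
  intros Hi Hj ((Hconst & Hdata & Henc & HrI & Hpoint & Hrow & Hmat) & HrJ & Hdisk).
  cbn [fst snd] in *. assert (entry := disk_test_entry i j Hi Hj). cbv zeta in entry.
  assert (disk_x := Henc (2 * (n + j))%nat ltac:(lia)).
  assert (disk_y := Henc (2 * (n + j) + 1)%nat ltac:(lia)).
  assert (point_x := Henc (2 * i)%nat ltac:(lia)).
  assert (point_y := Henc (2 * i + 1)%nat ltac:(lia)).
  rewrite Nat.add_assoc in disk_y, point_y. unfold matrix_entry. exec.
  match goal with |- wp _ (?f', ?g') _ _ => set (f1 := f'); set (g1 := g') end.
  assert (Henc1 : input_at enc g1) by (unfold g1; unchanged).
  apply (wp_seq _ _ _ (fun s => s = (updZ f1 rVal (Z.of_nat (Nat.b2n (mat i j))), g1)) _ 4 4).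
  - eapply (wp_if_rle _ _ _ _ _ _ _ _ _ 1 1); [unfold g1; read|unfold g1; read| |];
      intros Htest; exec.
    + apply entry in Htest. now rewrite Htest.
    + destruct (mat i j); [|reflexivity].
      apply Rlt_not_le in Htest. now destruct Htest; apply entry.
  - intros f2 g2 same_state. injection same_state as -> ->. clearbody g1. unfold f1. exec.
    unfold entry_state, row_state. check.
    apply (matrix_at_S i j f); auto; [read|].
    intros k Hk k_high. now rewrite !updZ_other by lia.
Qed.

Lemma fill_matrix_spec f g :
  constants f -> f rData = Z.of_nat input_base -> input_at enc g ->
  wp fill_matrix (f, g) (fun s => constants (fst s) /\ matrix_at (n * m) (fst s))
    (2 + for_time n (2 + (for_time m 20 + 2))).
Proof.
  intros Hconst Hdata Henc. unfold fill_matrix. exec.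
  eapply wp_conseq; [apply (wp_for rI rN _ n (fun i => row_state i 0))| |apply Nat.le_refl].
  - unfold row_state. check. intros i j _ before; lia.
  - unfold row_state; cbn [fst snd]. intros i f' g' (Hconst' & _ & _ & HrI & _).
    split; [exact HrI|apply Hconst'].
  - clear f g Hconst Hdata Henc. intros i f g Hi Hrow_state.
    assert (Hrow := Hrow_state).
    destruct Hrow as (Hconst & Hdata & Henc & HrI & Hpoint & Hrow & Hmat). cbn [fst snd] in *.
    exec. apply (wp_seq _ _ _ (entry_state i m)).
    + apply (wp_for rJ rM _ m (entry_state i)).
      * unfold entry_state, row_state. check.
      * unfold entry_state, row_state; cbn [fst snd].
        intros j f' g' ((Hconst' & _) & HrJ & _). split; [exact HrJ|apply Hconst'].
      * intros j f' g' Hj. now apply matrix_entry_spec.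
    + clear f g Hrow_state Hconst Hdata Henc HrI Hpoint Hrow Hmat.
      intros f g ((Hconst & Hdata & Henc & HrI & Hpoint & Hrow & Hmat) & _). cbn [fst snd] in *.
      exec. unfold row_state. check.
      replace (S i * m + 0)%nat with (i * m + m)%nat by lia. unchanged.
  - unfold row_state. intros s (Hconst' & _ & _ & _ & _ & _ & Hmat).
    rewrite Nat.add_0_r in Hmat. auto.
Qed.

End IncidenceMatrix.

Definition select_all : com :=
  For rJ rM (Op (IAdd rAddr rCover rJ) ;; Op (IStoreI rAddr rOne) ;; Skip).

Lemma matrix_entry_at f i j :
  matrix_at (n * m) f -> (i < n)%nat -> (j < m)%nat ->
  f (matrix_base + i * m + j)%nat = Z.of_nat (Nat.b2n (mat i j)).
Proof. intros Hmat Hi Hj. apply Hmat; auto. nia. Qed.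

Lemma select_all_spec f g :
  constants f -> matrix_at (n * m) f ->
  wp select_all (f, g) (fun s => search_data (fun _ => true) (fst s)) (for_time m 2).
Proof.
  intros Hconst Hmat. unfold select_all.
  eapply wp_conseq; [|clear f g Hconst Hmat|apply Nat.le_refl].
  - apply (wp_for rJ rM _ m (fun j s => constants (fst s) /\ matrix_at (n * m) (fst s) /\
      fst s rJ = Z.of_nat j /\ forall j', (j' < j)%nat -> fst s (registers + j')%nat = Z.of_nat 1)).
    + check. lia.
    + cbn [fst snd]. intros j f' g' (Hconst' & _ & HrJ & _). split; [exact HrJ|apply Hconst'].
    + clear f g Hconst Hmat. intros j f g Hj (Hconst & Hmat & HrJ & filled). cbn [fst snd] in *.
      exec. check.
      intros j' Hj'. destruct (Nat.eq_dec j' j) as [->|]; [read|].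
      rewrite !updZ_other by lia. apply filled; lia.
  - intros [f g] (Hconst & Hmat & _ & filled). cbn [fst snd] in *. split; [auto|split; auto].
Qed.

Section FixedCover.
Variable C : nat -> bool.

Definition count_entry : com :=
  Op (IAdd rAddr rCover rJ) ;; Op (ILoadI rVal rAddr) ;;
  When (ILt rZero rVal)
    (Op (IAdd rAddr rRow rJ) ;; Op (ILoadI rVal rAddr) ;; Op (IAdd rSum rSum rVal) ;; Skip).

Definition count_cover : com :=
  Op (IAdd rRow rMat rZero) ;;
  For rI rN (
    const rSum 0 ;; For rJ rM count_entry ;;
    Op (IAdd rAddr rCount rI) ;; Op (IStoreI rAddr rSum) ;; Op (IAdd rRow rRow rM) ;; Skip).

Definition count_state (i : nat) (f : nat -> Z) : Prop :=
  search_data C f /\ f rI = Z.of_nat i /\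
  f rRow = Z.of_nat (matrix_base + i * m) /\ counts_at C i f.

Lemma count_entry_spec i j f g :
  (i < n)%nat -> (j < m)%nat -> count_state i f -> f rJ = Z.of_nat j ->
  f rSum = Z.of_nat (multiplicity mat (chosen j C) i) ->
  wp count_entry (f, g) (fun s => count_state i (fst s) /\ fst s rJ = Z.of_nat j /\
    fst s rSum = Z.of_nat (multiplicity mat (chosen (S j) C) i)) 7.
Proof.
  intros Hi Hj (Hdata & HrI & Hrow & Hcounts) HrJ Hsum.
  assert (Hparts := Hdata). destruct Hparts as (Hconst & HC & Hmat).
  assert (bit := HC j Hj). assert (entry := matrix_entry_at f i j Hmat Hi Hj).
  unfold count_entry. exec.
  eapply (wp_when_lt _ _ _ 0 (Nat.b2n (C j))); [read|read| |]; intros Htest;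
    rewrite multiplicity_chosen_S; unfold count_state.
  - exec. destruct (C j); [|simpl in Htest; lia]. check.
  - destruct (C j); [simpl in Htest; lia|]. rewrite Nat.add_0_r. check.
Qed.

Lemma count_cover_spec f g :
  search_data C f ->
  wp count_cover (f, g) (fun s => search_data C (fst s) /\ counts_at C n (fst s))
    (1 + for_time n (1 + (for_time m 7 + 3))).
Proof.
  intros Hdata. assert (Hconst := proj1 Hdata). unfold count_cover. exec.
  eapply wp_conseq;
    [apply (wp_for rI rN _ n (fun i s => count_state i (fst s)))| |apply Nat.le_refl].
  - unfold count_state. check. intros i Hi; lia.
  - unfold count_state; cbn [fst snd]. intros i f' g' ((Hconst' & _) & HrI & _).
    split; [exact HrI|apply Hconst'].
  - clear f g Hdata Hconst. intros i f g Hi (Hdata & HrI & Hrow & Hcounts). cbn [fst snd] in *.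
    assert (Hconst := proj1 Hdata). exec.
    apply (wp_seq _ _ _ (fun s => count_state i (fst s) /\ fst s rJ = Z.of_nat m /\
      fst s rSum = Z.of_nat (multiplicity mat (chosen m C) i))).
    + apply (wp_for rJ rM _ m (fun j s => count_state i (fst s) /\ fst s rJ = Z.of_nat j /\
        fst s rSum = Z.of_nat (multiplicity mat (chosen j C) i))).
      * unfold count_state. check.
      * unfold count_state; cbn [fst snd]. intros j f' g' (((Hconst' & _) & _) & HrJ & _).
        split; [exact HrJ|apply Hconst'].
      * clear f g Hdata HrI Hrow Hcounts Hconst. cbn [fst snd].
        intros j f g Hj (Hstate & HrJ & Hsum).
        eapply wp_conseq; [apply (count_entry_spec i j); auto| |apply Nat.le_refl].
        intros [f' g'] ((Hdata & HrI & Hrow & Hcounts) & HrJ' & Hsum'). cbn [fst snd] in *.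
        assert (Hconst := proj1 Hdata). unfold count_state. check.
    + clear f g Hdata HrI Hrow Hcounts Hconst.
      intros f g ((Hdata & HrI & Hrow & Hcounts) & _ & Hsum). cbn [fst snd] in *.
      destruct Hdata as (Hconst & HC & Hmat). exec. unfold count_state, search_data. check.
      * intros j Hj. rewrite !updZ_other by lia. auto.
      * intros i' Hi'. destruct (Nat.eq_dec i' i) as [->|]; [read|].
        rewrite !updZ_other by lia. apply Hcounts; lia.
  - unfold count_state. intros s (Hdata' & _ & _ & Hcounts). auto.
Qed.

Definition found_at (f : nat -> Z) : Prop :=
  f rFound = Z.of_nat 0 \/
  (f rFound = Z.of_nat 1 /\ exists a b c d e,
     f rBestA = Z.of_nat a /\ f rBestB = Z.of_nat b /\ f rBestC = Z.of_nat c /\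
     f rBestD = Z.of_nat d /\ f rBestE = Z.of_nat e /\ improving n m mat C a b c d e).

Definition same_result (f f' : nat -> Z) : Prop :=
  forall r, (r = rFound \/ rBestA <= r <= rBestE)%nat -> f' r = f r.

Lemma found_at_same f f' : same_result f f' -> found_at f -> found_at f'.
Proof. intros same. unfold found_at. rewrite !same by lia. auto. Qed.

Lemma same_result_updZ f f' d v :
  (rSize <= d < rFound \/ rFound < d < rBestA)%nat -> same_result f f' -> same_result f (updZ f' d v).
Proof. intros Hd same r Hr. rewrite updZ_other by lia. auto. Qed.

(* [rho] lists the search loops in force: their registers with the current values. *)
Definition frame (rho : list (nat * nat)) (f : nat -> Z) : Prop :=
  search_data C f /\ counts_at C n f /\
  forall r v, In (r, v) rho -> (rA <= r <= rE)%nat /\ f r = Z.of_nat v.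

Lemma frame_updZ rho f d v :
  (rSize <= d < rA \/ rE < d < registers)%nat -> frame rho f -> frame rho (updZ f d v).
Proof.
  intros Hd (Hdata & Hcounts & Hrho).
  split; [apply search_data_updZ; auto; lia|split; [apply counts_at_updZ; auto; lia|]].
  intros r x Hr. destruct (Hrho r x Hr). split; auto. rewrite updZ_other by lia. auto.
Qed.

Lemma frame_tail rho r v f : frame ((r, v) :: rho) f -> frame rho f.
Proof. intros (Hdata & Hcounts & Hrho). split; [|split]; auto. intros; apply Hrho; now right. Qed.

Lemma frame_push rho r v f :
  (rA <= r <= rE)%nat -> ~ In r (map fst rho) ->
  frame rho f -> frame ((r, v) :: rho) (updZ f r (Z.of_nat v)).
Proof.
  intros Hr r_new (Hdata & Hcounts & Hrho).
  split; [apply search_data_updZ; auto; lia|split; [apply counts_at_updZ; auto; lia|]].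
  intros r' x [same|Hin]; [injection same as -> ->; split; auto; apply updZ_same|].
  destruct (Hrho r' x Hin). split; auto. rewrite updZ_other; auto.
  intros ->. apply r_new. change r with (fst (r, x)). now apply in_map.
Qed.

(* [c] records an improving exchange, if there is one among those it covers; if
   it leaves [rFound] at 0, there is none, as expressed by [none]. *)
Definition searches (rho : list (nat * nat)) (c : com) (none : Prop) (T : nat) : Prop :=
  forall f g, frame rho f -> found_at f ->
  wp c (f, g) (fun s => frame rho (fst s) /\ found_at (fst s) /\
     (fst s rFound = Z.of_nat 0 -> f rFound = Z.of_nat 0 /\ none)) T.

Lemma searches_for rho r c (none : nat -> Prop) T :
  (rA <= r <= rE)%nat -> ~ In r (map fst rho) ->
  (forall j, (j < m)%nat -> searches ((r, j) :: rho) c (none j) T) ->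
  searches rho (For r rM c) (forall j, (j < m)%nat -> none j) (for_time m T).
Proof.
  intros Hr r_new body f g Hframe Hfound.
  eapply wp_conseq; [|clear g Hframe Hfound|apply Nat.le_refl].
  - apply (wp_for r rM _ m (fun j s => frame ((r, j) :: rho) (fst s) /\ found_at (fst s) /\
      (fst s rFound = Z.of_nat 0 ->
       f rFound = Z.of_nat 0 /\ forall j', (j' < j)%nat -> none j'))).
    + cbn [fst snd]. split; [now apply frame_push|split].
      * revert Hfound. apply found_at_same, same_result_updZ; [lia|]. intros r' _; reflexivity.
      * rewrite updZ_other by lia. split; auto. lia.
    + cbn [fst snd]. intros j f' g' ((Hdata & _ & Hrho) & _). split.
      * now apply Hrho; left.
      * apply Hdata.
    + cbn [fst snd]. intros j f1 g1 Hj (Hframe1 & Hfound1 & Hnone1).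
      eapply wp_conseq; [now apply (body j Hj)| |apply Nat.le_refl].
      intros [f2 g2] (Hframe2 & Hfound2 & Hnone2). cbn [fst snd] in *.
      split; [now apply Hframe2; left|split; [apply (proj1 (proj1 Hframe2))|split; [|split]]].
      * apply frame_push; auto. now apply frame_tail in Hframe2.
      * revert Hfound2. apply found_at_same, same_result_updZ; [lia|]. intros r' _; reflexivity.
      * rewrite updZ_other by lia. intros none_found.
        destruct (Hnone2 none_found) as [found1 none_j].
        destruct (Hnone1 found1) as [found none_before]. split; auto.
        intros j' Hj'. destruct (Nat.eq_dec j' j) as [->|]; auto. apply none_before; lia.
  - cbn [fst snd]. intros s (Hframe & Hfound & Hnone). split; [|auto].
    now apply frame_tail in Hframe.
Qed.

Lemma searches_until_found rho c none T :
  searches rho c none T -> searches rho (When (ILt rFound rOne) c) none (2 + T).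
Proof.
  intros Hc f g Hframe Hfound. assert (Hfound' := Hfound).
  assert (Hconst := proj1 (proj1 Hframe)).
  destruct Hfound' as [found|(found & _)].
  - eapply wp_when_lt; [exact found|read|intros _; now apply Hc|lia].
  - eapply wp_when_lt; [exact found|read|lia|intros _; cbn [fst snd]].
    split; [auto|split; [auto|]]. rewrite found. discriminate.
Qed.

Lemma searches_when_lt rho a b x y c (none : Prop) T :
  In (a, x) rho -> In (b, y) rho ->
  ((x < y)%nat -> searches rho c none T) -> ((y <= x)%nat -> none) ->
  searches rho (When (ILt a b) c) none (2 + T).
Proof.
  intros Ha Hb Htrue Hfalse f g Hframe Hfound.
  assert (Hrho := proj2 (proj2 Hframe)).
  eapply wp_when_lt; [apply (Hrho _ _ Ha)|apply (Hrho _ _ Hb)| |]; intros Htest.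
  - now apply Htrue.
  - cbn [fst snd]. auto.
Qed.

Definition when_chosen (a : nat) (c : com) : com :=
  Op (IAdd rAddr rCover a) ;; Op (ILoadI rVal rAddr) ;; When (ILt rZero rVal) c.

Lemma searches_when_chosen rho a x c (none : Prop) T :
  In (a, x) rho -> (x < m)%nat ->
  (C x = true -> searches rho c none T) -> (C x = false -> none) ->
  searches rho (when_chosen a c) none (4 + T).
Proof.
  intros Ha Hx Htrue Hfalse f g Hframe Hfound.
  assert (Hparts := Hframe). destruct Hparts as ((Hconst & HC & _) & _ & Hrho).
  destruct (Hrho _ _ Ha) as [_ a_x]. assert (bit := HC x Hx).
  unfold when_chosen. exec.
  match goal with |- wp _ (?f', _) _ _ => set (f1 := f') end.
  assert (Hframe1 : frame rho f1) by (unfold f1; repeat (apply frame_updZ; [lia|]); auto).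
  assert (same : same_result f f1).
  { unfold f1. repeat (apply same_result_updZ; [lia|]). intros r _; reflexivity. }
  assert (Hfound1 := found_at_same _ _ same Hfound).
  assert (Hval : f1 rVal = Z.of_nat (Nat.b2n (C x))) by (unfold f1; read).
  assert (Hzero : f1 rZero = Z.of_nat 0) by apply (proj1 (proj1 Hframe1)).
  assert (same_found : f1 rFound = f rFound) by (apply same; auto).
  clearbody f1. eapply wp_when_lt; [exact Hzero|exact Hval| |]; intros Htest.
  - rewrite <- same_found. apply Htrue; auto. now destruct (C x); [|simpl in Htest; lia].
  - cbn [fst snd]. rewrite same_found. split; [auto|split; [auto|]]. intros found.
    split; auto. apply Hfalse. now destruct (C x); [simpl in Htest; lia|].
Qed.

Definition add_entry (acc r : nat) (c : com) : com :=
  Op (IAdd rAddr rRow r) ;; Op (ILoadI rVal rAddr) ;; Op (IAdd acc acc rVal) ;; c.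

Definition check_gain_at : com :=
  Op (IAdd rAddr rCount rI) ;; Op (ILoadI rSum rAddr) ;;
  add_entry rSum rD (add_entry rSum rE (
  const rOut 0 ;; add_entry rOut rA (add_entry rOut rB (add_entry rOut rC (
  Op (IAdd rRow rRow rM) ;;
  If (ILt rOut rSum) Skip (const rGood 0 ;; Skip)))))).

Definition check_gain : com :=
  const rGood 1 ;; Op (IAdd rRow rMat rZero) ;; For rI rN check_gain_at.

Definition record_exchange : com :=
  const rFound 1 ;; Op (IAdd rBestA rA rZero) ;; Op (IAdd rBestB rB rZero) ;;
  Op (IAdd rBestC rC rZero) ;; Op (IAdd rBestD rD rZero) ;; Op (IAdd rBestE rE rZero) ;; Skip.

Section Candidate.
Variables a b c d e : nat.
Hypothesis out_sub : incl [a; b; c] (chosen m C).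
Hypothesis inn_sub : incl [d; e] (seq 0 m).

Let rho : list (nat * nat) := [(rE, e); (rD, d); (rC, c); (rB, b); (rA, a)].

Definition gain (i : nat) : Prop :=
  (multiplicity mat [a; b; c] i < multiplicity mat (chosen m C) i + multiplicity mat [d; e] i)%nat.

Definition good_up_to (i : nat) (f : nat -> Z) : Prop :=
  exists good, f rGood = Z.of_nat (Nat.b2n good) /\
    (good = true <-> forall i', (i' < i)%nat -> gain i').

Lemma good_up_to_S i f f' :
  good_up_to i f ->
  (gain i -> f' rGood = f rGood) -> (~ gain i -> f' rGood = Z.of_nat 0) ->
  good_up_to (S i) f'.
Proof.
  intros (good & Hgood & good_iff) keep reset.
  destruct (classic (gain i)) as [Hi|Hi].
  - exists good. rewrite (keep Hi). split; auto. rewrite good_iff. split; intros Hgain i' Hi'.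
    + destruct (Nat.eq_dec i' i) as [->|]; auto. apply Hgain; lia.
    + apply Hgain; lia.
  - exists false. split; auto. split; [easy|]. intros Hgain. exfalso; apply Hi, Hgain; lia.
Qed.

Lemma candidate_lt r v : In (r, v) rho -> (v < m)%nat.
Proof.
  intros Hr. assert (Hv : In v [a; b; c] \/ In v [d; e]).
  { unfold rho in Hr; simpl in *. intuition congruence. }
  destruct Hv as [Hv|Hv]; [apply out_sub, in_chosen in Hv|apply inn_sub, in_seq in Hv]; lia.
Qed.

Lemma candidate_cells f i r v :
  frame rho f -> (i < n)%nat -> In (r, v) rho ->
  f r = Z.of_nat v /\ f (matrix_base + i * m + v)%nat = Z.of_nat (Nat.b2n (mat i v)).
Proof.
  intros ((_ & _ & Hmat) & _ & Hrho) Hi Hr. split; [now apply Hrho|].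
  apply matrix_entry_at; auto. now apply (candidate_lt r).
Qed.

Definition check_state (f0 : nat -> Z) (i : nat) (f : nat -> Z) : Prop :=
  frame rho f /\ same_result f0 f /\ f rI = Z.of_nat i /\
  f rRow = Z.of_nat (matrix_base + i * m) /\ good_up_to i f.

Lemma check_gain_at_spec f0 i f g :
  (i < n)%nat -> check_state f0 i f ->
  wp check_gain_at (f, g) (fun s => fst s rI = Z.of_nat i /\ fst s rOne = Z.of_nat 1 /\
    check_state f0 (S i) (updZ (fst s) rI (Z.of_nat (S i)))) 22.
Proof.
  intros Hi (Hframe & same & HrI & Hrow & Hgood).
  assert (Hconst := proj1 (proj1 Hframe)). assert (count := proj1 (proj2 Hframe) i Hi).
  assert (cells := fun r v => candidate_cells f i r v Hframe Hi).
  destruct (cells rA a ltac:(simpl; tauto)) as [reg_a entry_a].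
  destruct (cells rB b ltac:(simpl; tauto)) as [reg_b entry_b].
  destruct (cells rC c ltac:(simpl; tauto)) as [reg_c entry_c].
  destruct (cells rD d ltac:(simpl; tauto)) as [reg_d entry_d].
  destruct (cells rE e ltac:(simpl; tauto)) as [reg_e entry_e]. clear cells.
  unfold check_gain_at, add_entry. exec.
  match goal with |- wp _ (?f', _) _ _ => set (f1 := f') end.
  assert (Hframe1 : frame rho f1) by (unfold f1; repeat (apply frame_updZ; [lia|]); auto).
  assert (same1 : same_result f0 f1)
    by (unfold f1; repeat (apply same_result_updZ; [lia|]); auto).
  assert (HrI1 : f1 rI = Z.of_nat i) by (unfold f1; read).
  assert (Hrow1 : f1 rRow = Z.of_nat (matrix_base + S i * m)) by (unfold f1; read).
  assert (Hgood1 : f1 rGood = f rGood) by (unfold f1; read).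
  set (bit := fun j => Nat.b2n (mat i j)).
  assert (Hout : f1 rOut = Z.of_nat (multiplicity mat [a; b; c] i)).
  { change (multiplicity mat [a; b; c] i) with (bit a + (bit b + (bit c + 0)))%nat.
    unfold f1, bit. read. }
  assert (Hsum : f1 rSum = Z.of_nat (multiplicity mat (chosen m C) i + multiplicity mat [d; e] i)).
  { change (multiplicity mat [d; e] i) with (bit d + (bit e + 0))%nat. unfold f1, bit. read. }
  clearbody f1. assert (Hconst1 := proj1 (proj1 Hframe1)).
  apply (wp_if_lt _ _ _ _ _ _ _ _ _ 0 1 Hout Hsum); intros Htest; exec; unfold check_state;
    repeat match goal with |- _ /\ _ => split end; try read.
  - apply frame_updZ; [lia|auto].
  - apply same_result_updZ; [lia|auto].
  - apply (good_up_to_S i f); [exact Hgood|intros _; read|intros no_gain; now destruct no_gain].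
  - repeat (apply frame_updZ; [lia|]); auto.
  - repeat (apply same_result_updZ; [lia|]); auto.
  - apply (good_up_to_S i f); [exact Hgood|unfold gain; lia|intros _; read].
Qed.

Lemma check_gain_spec f g :
  frame rho f ->
  wp check_gain (f, g) (fun s => frame rho (fst s) /\ same_result f (fst s) /\
    good_up_to n (fst s)) (2 + for_time n 22).
Proof.
  intros Hframe. assert (Hconst := proj1 (proj1 Hframe)). unfold check_gain. exec.
  eapply wp_conseq;
    [apply (wp_for rI rN _ n (fun i s => check_state f i (fst s)))| |apply Nat.le_refl].
  - unfold check_state. cbn [fst snd]. repeat match goal with |- _ /\ _ => split end; try read.
    + repeat (apply frame_updZ; [lia|]); auto.
    + repeat (apply same_result_updZ; [lia|]). intros r _; reflexivity.
    + exists true. split; [read|]. split; [lia|auto].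
  - unfold check_state; cbn [fst snd]. intros i f' g' (Hframe' & _ & HrI & _).
    split; [exact HrI|apply (proj1 (proj1 Hframe'))].
  - intros i f' g' Hi. now apply check_gain_at_spec.
  - unfold check_state. intros s (Hframe' & same & _ & _ & Hgood). auto.
Qed.

Lemma searches_candidate :
  (a < b < c)%nat ->
  searches rho (check_gain ;; When (ILt rZero rGood) record_exchange)
    (~ improving n m mat C a b c d e) (2 + for_time n 22 + 8).
Proof.
  intros order f g Hframe Hfound.
  apply (wp_seq _ _ _ _ _ _ 8 (check_gain_spec f g Hframe)).
  clear g Hframe. intros f1 g1 (Hframe & same & good & Hgood & good_iff). cbn [fst snd] in *.
  assert (Hconst := proj1 (proj1 Hframe)).
  eapply (wp_when_lt _ _ _ 0 (Nat.b2n good)); [read|exact Hgood| |]; intros Htest.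
  - assert (good = true) by (destruct good; auto; simpl in Htest; lia).
    assert (value := fun r v Hr => proj2 (proj2 (proj2 Hframe) r v Hr)).
    assert (reg_a := value rA a ltac:(simpl; tauto)).
    assert (reg_b := value rB b ltac:(simpl; tauto)).
    assert (reg_c := value rC c ltac:(simpl; tauto)).
    assert (reg_d := value rD d ltac:(simpl; tauto)).
    assert (reg_e := value rE e ltac:(simpl; tauto)). clear value.
    unfold record_exchange. exec. cbn [fst snd]. split; [|split].
    + repeat (apply frame_updZ; [lia|]); auto.
    + right. split; [read|]. exists a, b, c, d, e.
      repeat match goal with |- _ /\ _ => split end; try read.
      split; [auto|split; [auto|split; [auto|]]]. now apply good_iff.
    + repeat first [rewrite updZ_same | rewrite updZ_other by lia]. discriminate.
  - cbn [fst snd]. split; [auto|split; [now apply (found_at_same f)|]].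
    rewrite same by auto. intros found. split; auto. intros (_ & _ & _ & gains).
    assert (good = true) as -> by now apply good_iff. simpl in Htest; lia.
Qed.

End Candidate.

Definition search_body : com :=
  When (ILt rFound rOne) (When (ILt rA rB) (When (ILt rB rC)
  (when_chosen rA (when_chosen rB (when_chosen rC
  (check_gain ;; When (ILt rZero rGood) record_exchange)))))).

Definition search : com := For rA rM (For rB rM (For rC rM (For rD rM (For rE rM search_body)))).

Definition search_body_time : nat := 18 + (2 + for_time n 22 + 8).

Lemma searches_body a b c d e :
  (a < m)%nat -> (b < m)%nat -> (c < m)%nat -> (d < m)%nat -> (e < m)%nat ->
  searches [(rE, e); (rD, d); (rC, c); (rB, b); (rA, a)] search_body
    (~ improving n m mat C a b c d e) search_body_time.
Proof.
  intros Ha Hb Hc Hd He.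
  assert (chosen_all : improving n m mat C a b c d e ->
    (a < b < c)%nat /\ C a = true /\ C b = true /\ C c = true).
  { intros (order & out_sub & _). split; auto.
    repeat split; refine (proj2 (proj1 (in_chosen m C _) (out_sub _ _))); simpl; auto. }
  unfold search_body, search_body_time.
  apply searches_until_found.
  apply (searches_when_lt _ _ _ a b); [simpl; tauto..| |
    intros Hba Himp; apply chosen_all in Himp; lia].
  intros Hab.
  apply (searches_when_lt _ _ _ b c); [simpl; tauto..| |
    intros Hcb Himp; apply chosen_all in Himp; lia].
  intros Hbc.
  apply (searches_when_chosen _ _ a); [simpl; tauto|auto| |
    intros not_a Himp; apply chosen_all in Himp; intuition congruence].
  intros chosen_a.
  apply (searches_when_chosen _ _ b); [simpl; tauto|auto| |
    intros not_b Himp; apply chosen_all in Himp; intuition congruence].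
  intros chosen_b.
  apply (searches_when_chosen _ _ c); [simpl; tauto|auto| |
    intros not_c Himp; apply chosen_all in Himp; intuition congruence].
  intros chosen_c.
  apply searches_candidate; auto.
  - intros x [<-|[<-|[<-|[]]]]; apply in_chosen; auto.
  - intros x [<-|[<-|[]]]; apply in_seq; lia.
Qed.

Definition search_time : nat :=
  for_time m (for_time m (for_time m (for_time m (for_time m search_body_time)))).

Lemma searches_all :
  searches [] search
    (forall a, (a < m)%nat -> forall b, (b < m)%nat -> forall c, (c < m)%nat ->
     forall d, (d < m)%nat -> forall e, (e < m)%nat -> ~ improving n m mat C a b c d e)
    search_time.
Proof.
  unfold search, search_time.
  apply searches_for; [lia|simpl; lia|]. intros a Ha.
  apply searches_for; [lia|simpl; lia|]. intros b Hb.
  apply searches_for; [lia|simpl; lia|]. intros c Hc.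
  apply searches_for; [lia|simpl; lia|]. intros d Hd.
  apply searches_for; [lia|simpl; lia|]. intros e He.
  now apply searches_body.
Qed.

End FixedCover.

Definition assign (C : nat -> bool) (j : nat) (b : bool) : nat -> bool :=
  fun x => if eqb_of Nat.eq_dec x j then b else C x.

Lemma cover_at_assign C f j b :
  cover_at C f -> cover_at (assign C j b) (updZ f (registers + j) (Z.of_nat (Nat.b2n b))).
Proof.
  intros HC x Hx. unfold assign, eqb_of. destruct (Nat.eq_dec x j) as [->|Hne].
  - apply updZ_same.
  - rewrite updZ_other by lia. auto.
Qed.

Lemma swap_assign C a b c d e x :
  swap C [a; b; c] [d; e] x =
  assign (assign (assign (assign (assign C a false) b false) c false) d true) e true x.
Proof.
  unfold swap, without, assign. rewrite !memb_cons.
  destruct (eqb_of Nat.eq_dec x e), (eqb_of Nat.eq_dec x d), (eqb_of Nat.eq_dec x c),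
    (eqb_of Nat.eq_dec x b), (eqb_of Nat.eq_dec x a), (C x); reflexivity.
Qed.

Definition write_bit (r src : nat) (c : com) : com :=
  Op (IAdd rAddr rCover r) ;; Op (IStoreI rAddr src) ;; c.

Definition apply_exchange : com :=
  When (ILt rZero rFound)
    (write_bit rBestA rZero (write_bit rBestB rZero (write_bit rBestC rZero
    (write_bit rBestD rOne (write_bit rBestE rOne Skip))))).

Definition pass : com := count_cover ;; const rFound 0 ;; search ;; apply_exchange.

Definition pass_time : nat :=
  1 + for_time n (1 + (for_time m 7 + 3)) + (1 + (search_time + 12)).

Definition pass_result (C : nat -> bool) (f : nat -> Z) : Prop :=
  (f rFound = Z.of_nat 0 /\ search_data C f /\ swap_optimal n m mat C) \/
  (f rFound = Z.of_nat 1 /\ exists a b c d e,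
     improving n m mat C a b c d e /\ search_data (swap C [a; b; c] [d; e]) f).

Lemma apply_exchange_spec C f g :
  search_data C f -> found_at C f -> (f rFound = Z.of_nat 0 -> swap_optimal n m mat C) ->
  wp apply_exchange (f, g) (fun s => pass_result C (fst s)) 12.
Proof.
  intros Hdata Hfound none_found. assert (Hparts := Hdata).
  destruct Hparts as (Hconst & HC & Hmat). unfold apply_exchange, write_bit.
  destruct Hfound as
    [found|(found & a & b & c & d & e & best_a & best_b & best_c & best_d & best_e & Himp)].
  - eapply (wp_when_lt _ _ _ 0 0); [read|exact found|lia|]. intros _. left. auto.
  - eapply (wp_when_lt _ _ _ 0 1); [read|exact found| |lia]. intros _. exec.
    assert (lt_m : forall x, In x [a; b; c; d; e] -> (x < m)%nat).
    { destruct Himp as (_ & out_sub & inn_sub & _). intros x Hx.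
      assert (Hx' : In x [a; b; c] \/ In x [d; e]) by (simpl in *; tauto).
      destruct Hx' as [Hx'|Hx'];
        [apply out_sub, in_chosen in Hx'|apply inn_sub, in_seq in Hx']; lia. }
    assert (a_lt := lt_m a ltac:(simpl; auto)). assert (b_lt := lt_m b ltac:(simpl; auto)).
    assert (c_lt := lt_m c ltac:(simpl; auto)). assert (d_lt := lt_m d ltac:(simpl; auto)).
    assert (e_lt := lt_m e ltac:(simpl; auto 6)). clear lt_m.
    right. cbn [fst snd]. split; [read|]. exists a, b, c, d, e. split; [auto|].
    split; [unchanged|split; [|unchanged]].
    intros x Hx. rewrite swap_assign. revert x Hx.
    repeat first [ apply (cover_at_assign _ _ _ true) | apply (cover_at_assign _ _ _ false)
                 | apply cover_at_updZ; [lia|] ].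
    exact HC.
Qed.

Lemma pass_spec C f g :
  search_data C f -> wp pass (f, g) (fun s => pass_result C (fst s)) pass_time.
Proof.
  intros Hdata. unfold pass, pass_time.
  apply (wp_seq _ _ _ _ _ _ _ (count_cover_spec C f g Hdata)).
  clear f g Hdata. intros f g (Hdata & Hcounts). cbn [fst snd] in *. exec.
  eapply wp_seq.
  - apply (searches_all C).
    + split; [unchanged|split; [unchanged|easy]].
    + left. apply updZ_same.
  - intros f1 g1 ((Hdata1 & _) & Hfound & Hnone). cbn [fst snd] in *.
    apply apply_exchange_spec; auto. intros found a b c d e Himp.
    destruct (Hnone found) as [_ none].
    assert (bounds := Himp). destruct bounds as (_ & out_sub & inn_sub & _).
    assert (out_lt : forall x, In x [a; b; c] -> (x < m)%nat)
      by (intros x Hx; apply out_sub, in_chosen in Hx; tauto).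
    assert (inn_lt : forall x, In x [d; e] -> (x < m)%nat)
      by (intros x Hx; apply inn_sub, in_seq in Hx; lia).
    apply (none a) with (b := b) (c := c) (d := d) (e := e); simpl in *; auto.
Qed.

Definition improve : com := const rFound 1 ;; While (ILt rZero rFound) pass.

Lemma improve_spec f g :
  search_data (fun _ => true) f -> feasible n m mat (fun _ => true) ->
  wp improve (f, g) (fun s => exists C, search_data C (fst s) /\ feasible n m mat C /\
     swap_optimal n m mat C)
    (1 + ((m + 1) * (pass_time + 2) + 2)).
Proof.
  intros Hdata Hfeasible. unfold improve. exec.
  eapply wp_conseq.
  - apply (wp_while (ILt rZero rFound) _ (fun k s => exists C,
      search_data C (fst s) /\ feasible n m mat C /\
      ((fst s rFound = Z.of_nat 1 /\ (length (chosen m C) < k)%nat) \/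
       (fst s rFound = Z.of_nat 0 /\ swap_optimal n m mat C))) pass_time) with (k := (m + 1)%nat).
    + clear f g Hdata Hfeasible. intros k [f g] (C & Hdata & Hfeasible & progress) Htest.
      simpl in Htest. cbn [fst snd] in *. rewrite (reg_zero _ (proj1 Hdata)) in Htest.
      destruct progress as [[found lt_k]|[found _]]; [|rewrite found in Htest; lia].
      eapply wp_conseq; [now apply (pass_spec C)| |apply Nat.le_refl].
      intros s [(found' & Hdata' & optimal)|(found' & a & b & c & d & e & Himp & Hdata')].
      * exists 0%nat. split; [lia|]. exists C. auto.
      * destruct (improving_swap n m mat C a b c d e Himp) as [Hfeasible' shorter].
        exists (k - 1)%nat. split; [lia|]. exists (swap C [a; b; c] [d; e]).
        split; [auto|split; [auto|]]. left. split; auto. lia.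
    + exists (fun _ => true). cbn [fst snd]. split; [unchanged|split; [auto|]].
      left. split; [read|]. assert (Hle := length_chosen_le m (fun _ => true)). lia.
  - intros [f1 g1] ((k & C & Hdata' & Hfeasible' & progress) & Htest).
    simpl in Htest. cbn [fst snd] in *. rewrite (reg_zero _ (proj1 Hdata')) in Htest.
    exists C. split; [auto|split; [auto|]].
    destruct progress as [[found _]|[_ optimal]]; auto. rewrite found in Htest. lia.
  - apply Nat.le_refl.
Qed.

Definition list_at (base : nat) (l : list nat) (f : nat -> Z) : Prop :=
  f base = Z.of_nat (length l) /\
  forall t, (t < length l)%nat -> f (base + S t)%nat = Z.of_nat (nth t l 0%nat).

Definition collect_entry : com :=
  Op (IAdd rAddr rCover rJ) ;; Op (ILoadI rVal rAddr) ;;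
  When (ILt rZero rVal)
    (Op (IAdd rSum rSum rOne) ;; Op (IAdd rAddr rMat rSum) ;; Op (IStoreI rAddr rJ) ;; Skip).

(* The result is first laid out over the matrix: writing it to its final place
   [I[0], I[1], ...] destroys the working registers. *)
Definition collect : com :=
  const rSum 0 ;; For rJ rM collect_entry ;; Op (IStoreI rMat rSum) ;; Skip.

Definition collect_state (C : nat -> bool) (j : nat) (f : nat -> Z) : Prop :=
  constants f /\ cover_at C f /\ f rJ = Z.of_nat j /\
  f rSum = Z.of_nat (length (chosen j C)) /\
  forall t, (t < length (chosen j C))%nat ->
    f (matrix_base + S t)%nat = Z.of_nat (nth t (chosen j C) 0%nat).

Lemma collect_entry_spec C j f g :
  (j < m)%nat -> collect_state C j f ->
  wp collect_entry (f, g) (fun s => fst s rJ = Z.of_nat j /\ fst s rOne = Z.of_nat 1 /\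
    collect_state C (S j) (updZ (fst s) rJ (Z.of_nat (S j)))) 7.
Proof.
  intros Hj (Hconst & HC & HrJ & Hsum & listed). assert (bit := HC j Hj).
  unfold collect_entry. exec.
  eapply (wp_when_lt _ _ _ 0 (Nat.b2n (C j))); [read|read| |]; intros Htest;
    unfold collect_state; rewrite chosen_S, length_app;
    destruct (C j); try (simpl in Htest; lia).
  - exec. cbn [length]. check.
    + intros j' Hj'. rewrite !updZ_other by lia. auto.
    + intros t Ht. destruct (Nat.eq_dec t (length (chosen j C))) as [->|Hne].
      * rewrite nth_middle, <- (Nat.add_1_r (length (chosen j C))). read.
      * rewrite !updZ_other by lia. rewrite app_nth1 by lia. apply listed; lia.
  - cbn [length]. rewrite Nat.add_0_r, app_nil_r. check.
Qed.

Lemma collect_spec C f g :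
  search_data C f ->
  wp collect (f, g) (fun s => constants (fst s) /\
      list_at matrix_base (chosen m C) (fst s))
    (1 + (for_time m 7 + 1)).
Proof.
  intros (Hconst & HC & _). unfold collect. exec.
  apply (wp_seq _ _ _ (fun s => collect_state C m (fst s))).
  - apply (wp_for rJ rM _ m (fun j s => collect_state C j (fst s))).
    + unfold collect_state. check. simpl; lia.
    + unfold collect_state; cbn [fst snd]. intros j f' g' (Hconst' & _ & HrJ & _).
      split; [exact HrJ|apply Hconst'].
    + intros j f' g' Hj. now apply collect_entry_spec.
  - clear f g Hconst HC. intros f g (Hconst & HC & HrJ & Hsum & listed). cbn [fst snd] in *.
    exec. unfold list_at. check.
    intros t Ht. rewrite updZ_other by lia. auto.
Qed.

Definition copy_high : com :=
  For rJ rM (Op (IAdd rAddr rCover rJ) ;; Op (IAdd rVal rMat rAddr) ;; Op (ILoadI rVal rVal) ;;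
             Op (IStoreI rAddr rVal) ;; Skip).

Lemma copy_high_spec f g :
  constants f ->
  wp copy_high (f, g) (fun s => constants (fst s) /\
     (forall a, (matrix_base <= a)%nat -> fst s a = f a) /\
     (forall r, (r < m)%nat -> fst s (registers + r)%nat = f (matrix_base + (registers + r))%nat))
    (for_time m 4).
Proof.
  intros Hconst. unfold copy_high. eapply wp_conseq; [| |apply Nat.le_refl].
  - apply (wp_for rJ rM _ m (fun j s => constants (fst s) /\ fst s rJ = Z.of_nat j /\
      (forall a, (matrix_base <= a)%nat -> fst s a = f a) /\
      (forall r, (r < j)%nat ->
         fst s (registers + r)%nat = f (matrix_base + (registers + r))%nat))).
    + check.
      * intros a Ha. rewrite updZ_other by lia. auto.
      * lia.
    + cbn [fst snd]. intros j f' g' (Hconst' & HrJ & _). split; [exact HrJ|apply Hconst'].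
    + clear Hconst. intros j f1 g1 Hj (Hconst & HrJ & source & copied). cbn [fst snd] in *.
      assert (value := source (matrix_base + (registers + j))%nat ltac:(lia)). exec. check.
      * intros a Ha. rewrite !updZ_other by lia. auto.
      * intros r Hr. destruct (Nat.eq_dec r j) as [->|]; [read|].
        rewrite !updZ_other by lia. apply copied; lia.
  - cbn [fst snd]. intros s (Hconst' & _ & source & copied). auto.
Qed.

(* [I[0]] holds the address of the result; register [d] receives in turn [d],
   the address of the [d]th cell of the result, and the contents of that cell. *)
Fixpoint copy_low (d k : nat) : com :=
  match k with
  | O => Skip
  | S k' => const d d ;; Op (IAdd d d 0) ;; Op (ILoadI d d) ;; copy_low (S d) k'
  end.

Lemma copy_low_spec src k d f g :
  (registers <= src)%nat -> (1 <= d)%nat -> (d + k = registers)%nat -> f 0%nat = Z.of_nat src ->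
  wp (copy_low d k) (f, g) (fun s => fst s 0%nat = Z.of_nat src /\
     (forall a, (1 <= a < d \/ registers <= a)%nat -> fst s a = f a) /\
     (forall a, (d <= a < registers)%nat -> fst s a = f (src + a)%nat)) (3 * k).
Proof.
  intros Hsrc. revert d f. induction k as [|k IH]; intros d f Hd Hk f0.
  - apply wp_skip. cbn [fst snd]. split; [auto|split; [auto|lia]].
  - replace (3 * S k)%nat with (S (S (S (3 * k)))) by lia. cbn [copy_low].
    exec. eapply wp_conseq; [apply IH; [lia|lia|read]| |apply Nat.le_refl].
    intros s (low0 & unchanged_cells & copied). split; [auto|split].
    + intros a Ha. rewrite unchanged_cells by lia. now rewrite !updZ_other by lia.
    + intros a Ha. destruct (Nat.eq_dec a d) as [->|Hne].
      * rewrite unchanged_cells by lia. rewrite updZ_same. f_equal; lia.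
      * rewrite copied by lia. now rewrite !updZ_other by lia.
Qed.

Definition copy_result : com :=
  copy_high ;; Op (IAdd 0 rMat rZero) ;; copy_low 1 (pred registers) ;; Op (ILoadI 0 0) ;; Skip.

Lemma copy_result_spec l f g :
  (length l <= m)%nat -> constants f -> list_at matrix_base l f ->
  wp copy_result (f, g) (fun s => list_at 0 l (fst s)) (for_time m 4 + 119).
Proof.
  intros l_le Hconst (Hlen & Hentries).
  apply (wp_seq _ _ _ _ _ _ 119 (copy_high_spec f g Hconst)).
  intros f1 g1 (Hconst1 & source & copied). cbn [fst snd] in *.
  change 119%nat with (S (3 * pred registers + 1)). exec.
  eapply wp_seq; [apply (copy_low_spec matrix_base (pred registers)); [lia|lia|lia|read]|].
  intros f2 g2 (low0 & high_kept & low_copied). cbn [fst snd] in *.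
  eapply wp_ILoadI; [exact low0|reflexivity|]. apply wp_skip. split; cbn [fst snd].
  - rewrite updZ_same, high_kept by lia. rewrite updZ_other by lia. now rewrite source by lia.
  - intros t Ht. rewrite <- Hentries by auto. rewrite updZ_other by lia.
    destruct (le_lt_dec registers (S t)) as [high|low].
    + rewrite high_kept by lia. rewrite updZ_other by lia.
      replace (0 + S t)%nat with (registers + (S t - registers))%nat by lia. rewrite copied by lia.
      f_equal; lia.
    + rewrite low_copied by lia. rewrite updZ_other by lia. rewrite source by lia. f_equal; lia.
Qed.

Definition local_search : com :=
  move_input ;; fill_matrix ;; select_all ;; improve ;; collect ;; copy_result.

Definition local_search_time : nat :=
  9 + for_time (2 * (n + m)) 3 + (2 + for_time n (2 + (for_time m 20 + 2)) +
  (for_time m 2 + (1 + ((m + 1) * (pass_time + 2) + 2) +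
  (1 + (for_time m 7 + 1) + (for_time m 4 + 119))))).

Lemma local_search_spec (enc : nat -> R) f :
  (forall i j, (i < n)%nat -> (j < m)%nat ->
     mat i j = true <-> in_unit_disk (input_point enc (n + j)) (input_point enc i)) ->
  f 0%nat = Z.of_nat n -> f 1%nat = Z.of_nat m -> feasible n m mat (fun _ => true) ->
  wp local_search (f, enc) (fun s => exists C, feasible n m mat C /\ swap_optimal n m mat C /\
     list_at 0 (chosen m C) (fst s)) local_search_time.
Proof.
  intros Hmat f_n f_m Hfeasible.
  apply (wp_seq _ _ _ _ _ _ _ (move_input_spec f enc f_n f_m)).
  clear f f_n f_m. intros f g (Hconst & Hdata & Henc).
  apply (wp_seq _ _ _ _ _ _ _ (fill_matrix_spec enc Hmat f g Hconst Hdata Henc)).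
  clear f g Hconst Hdata Henc. intros f g (Hconst & Hincidence).
  apply (wp_seq _ _ _ _ _ _ _ (select_all_spec f g Hconst Hincidence)).
  clear f g Hconst Hincidence. intros f g Hdata.
  apply (wp_seq _ _ _ _ _ _ _ (improve_spec f g Hdata Hfeasible)).
  clear f g Hdata. intros f g (C & Hdata & feasible_C & optimal).
  apply (wp_seq _ _ _ _ _ _ _ (collect_spec C f g Hdata)).
  clear f g Hdata. intros f g (Hconst & Hlist).
  eapply wp_conseq; [|clear f g Hconst Hlist|apply Nat.le_refl].
  - apply copy_result_spec; eauto. apply length_chosen_le.
  - intros s Hlist. eauto.
Qed.

End Memory.

(** * Running time *)

Lemma for_time_le k T c x :
  (1 <= k)%nat -> (1 <= x)%nat -> (T <= c * x)%nat ->
  (for_time k T <= (c + 6) * (k * x))%nat.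
Proof.
  intros k_pos x_pos T_le. unfold for_time.
  assert (k * T <= k * (c * x))%nat by now apply Nat.mul_le_mono_l.
  assert (k <= k * x)%nat by nia. nia.
Qed.

Lemma search_time_le n m :
  (1 <= n)%nat -> (1 <= m)%nat -> (search_time n m <= 86 * (m ^ 5 * n))%nat.
Proof.
  intros n_pos m_pos.
  assert (bound : (search_body_time n <= 56 * n)%nat)
    by (unfold search_body_time, for_time; lia).
  do 5 (apply (for_time_le m) in bound; [|lia|nia]).
  unfold search_time. etransitivity; [exact bound|]. apply Nat.eq_le_incl. simpl. ring.
Qed.

Lemma local_search_time_le n m :
  (1 <= n)%nat -> (1 <= m)%nat -> (local_search_time n m <= 1000 * (m ^ 6 * n))%nat.
Proof.
  intros n_pos m_pos. assert (search_le := search_time_le n m n_pos m_pos).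
  assert (m5_pos : (1 <= m ^ 4)%nat) by (apply Nat.neq_0_lt_0, Nat.pow_nonzero; lia).
  set (X := (m ^ 5 * n)%nat) in *.
  assert (X_eq : X = (m ^ 4 * (n * m))%nat) by (unfold X; simpl; ring).
  assert (nm_le : (n * m <= X)%nat) by (rewrite X_eq; nia).
  assert (n_le : (n <= n * m)%nat) by nia. assert (m_le : (m <= n * m)%nat) by nia.
  replace (m ^ 6 * n)%nat with (m * X)%nat by (unfold X; simpl; ring).
  assert (X_le : (X <= m * X)%nat) by nia.
  assert (pass_le : (pass_time n m <= 123 * X)%nat)
    by (unfold pass_time, for_time; lia).
  assert (loop_le : ((m + 1) * (pass_time n m + 2) <= 2 * m * (125 * X))%nat)
    by (apply Nat.mul_le_mono; lia).
  unfold local_search_time, for_time. lia.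
Qed.

(** * From indices back to points *)

Definition pt (l : list point) (i : nat) : point := nth i l (0, 0).

Lemma map_nth_seq {T} (d : T) (l : list T) :
  map (fun i => nth i l d) (seq 0 (length l)) = l.
Proof.
  induction l as [|x l IH]; simpl; auto. f_equal. rewrite <- seq_shift, map_map. exact IH.
Qed.

Lemma map_pt_seq l : map (pt l) (seq 0 (length l)) = l.
Proof. apply map_nth_seq. Qed.

Lemma pt_inj l i j :
  NoDup l -> (i < length l)%nat -> (j < length l)%nat -> pt l i = pt l j -> i = j.
Proof. intros distinct Hi Hj. now apply (proj1 (NoDup_nth l (0, 0)) distinct). Qed.

Lemma incl_map_preimage {T U} (f : T -> U) (l : list T) (l' : list U) :
  incl l' (map f l) -> exists k, incl k l /\ l' = map f k.
Proof.
  induction l' as [|y l' IH]; intros sub.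
  - exists []. split; [easy|reflexivity].
  - destruct IH as (k & k_sub & ->). { intros z Hz. apply sub. now right. }
    assert (Hy := sub y (or_introl eq_refl)). apply in_map_iff in Hy as (x & <- & Hx).
    exists (x :: k). split; [now apply incl_cons|reflexivity].
Qed.

Lemma encode_real_nth_error P D k :
  encode_real P D k =
  match nth_error (P ++ D) (Nat.div k 2) with
  | Some q => if Nat.even k then fst q else snd q
  | None => 0
  end.
Proof.
  unfold encode_real. destruct (Nat.ltb_spec k (2 * length P)) as [Hk|Hk].
  - rewrite nth_error_app1; [reflexivity|]. apply Nat.Div0.div_lt_upper_bound; lia.
  - assert (shift : Nat.div k 2 = (Nat.div (k - 2 * length P) 2 + length P)%nat)
      by (rewrite <- Nat.div_add by lia; f_equal; lia).
    now rewrite shift, nth_error_app2, Nat.add_sub by lia.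
Qed.

Lemma input_point_encode P D k :
  (k < length P + length D)%nat -> input_point (encode_real P D) k = pt (P ++ D) k.
Proof.
  intros Hk. unfold input_point. rewrite !encode_real_nth_error.
  replace (Nat.div (2 * k) 2) with k by (apply Nat.div_unique with 0%nat; lia).
  replace (Nat.div (2 * k + 1) 2) with k by (apply Nat.div_unique with 1%nat; lia).
  rewrite (nth_error_nth' (P ++ D) (0, 0)) by (rewrite length_app; lia).
  rewrite Nat.even_even, Nat.even_odd. now rewrite <- surjective_pairing.
Qed.

Lemma disk_cover_incl P S S' : incl S S' -> disk_cover P S -> disk_cover P S'.
Proof. intros sub cover p Hp. destruct (cover p Hp) as (c & Hc & c_p). eauto. Qed.

Lemma covers_nonempty P D S : (1 <= length P)%nat -> covers P D S -> (1 <= length D)%nat.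
Proof.
  intros P_nonempty [bounds cover]. destruct P as [|p P]; [simpl in P_nonempty; lia|].
  destruct (cover p (or_introl eq_refl)) as (j & c & Hj & _). apply bounds in Hj. lia.
Qed.

Section Instance.
Variables P D : list point.
Hypothesis D_distinct : NoDup D.

Definition incidence (i j : nat) : bool :=
  if Rle_dec (sqdist (pt D j) (pt P i)) 1 then true else false.

Lemma incidence_true i j : incidence i j = true <-> in_unit_disk (pt D j) (pt P i).
Proof. unfold incidence, in_unit_disk, sqdist. destruct (Rle_dec _ _); intuition congruence. Qed.

Lemma incidence_encode i j :
  (i < length P)%nat -> (j < length D)%nat ->
  incidence i j = true <->
  in_unit_disk (input_point (encode_real P D) (length P + j)) (input_point (encode_real P D) i).
Proof.
  intros Hi Hj. rewrite incidence_true, !input_point_encode by lia.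
  unfold pt. rewrite app_nth2_plus, app_nth1 by lia. reflexivity.
Qed.

Lemma feasible_iff_disk_cover C :
  feasible (length P) (length D) incidence C <->
  disk_cover P (map (pt D) (chosen (length D) C)).
Proof.
  split.
  - intros positive p Hp. destruct (In_nth P p (0, 0) Hp) as (i & Hi & <-).
    destruct (proj1 (multiplicity_pos _ _ _) (positive i Hi)) as (j & Hj & Hincidence).
    apply incidence_true in Hincidence. exists (pt D j). split; auto. now apply in_map.
  - intros cover i Hi. apply multiplicity_pos.
    destruct (cover (pt P i) (nth_In _ _ Hi)) as (c & Hc & c_p).
    apply in_map_iff in Hc as (j & <- & Hj). exists j. now rewrite incidence_true.
Qed.

Lemma covers_iff_disk_cover S :
  covers P D S <-> incl S (seq 0 (length D)) /\ disk_cover P (map (pt D) S).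
Proof.
  assert (bounds : incl S (seq 0 (length D)) <-> forall j, In j S -> (j < length D)%nat).
  { split; intros sub j Hj; specialize (sub j Hj); [apply in_seq in sub|apply in_seq]; lia. }
  assert (disk : incl S (seq 0 (length D)) -> forall j, In j S -> nth_error D j = Some (pt D j))
    by (intros sub j Hj; apply nth_error_nth', bounds; auto).
  unfold covers. rewrite <- bounds. split; intros [sub cover]; split; auto; intros p Hp.
  - destruct (cover p Hp) as (j & c & Hj & Hc & c_p).
    rewrite disk in Hc by auto. injection Hc as <-. exists (pt D j). split; auto. now apply in_map.
  - destruct (cover p Hp) as (c & Hc & c_p).
    apply in_map_iff in Hc as (j & <- & Hj). exists j, (pt D j). auto.
Qed.

Lemma swap_optimal_locally_optimal C :
  swap_optimal (length P) (length D) incidence C -> (3 <= length (chosen (length D) C))%nat ->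
  locally_optimal 3 P D (map (pt D) (chosen (length D) C)).
Proof.
  intros optimal large. set (m := length D) in *.
  assert (chosen_lt : incl (chosen m C) (seq 0 m))
    by (intros j Hj; apply filter_In in Hj; tauto).
  assert (chosen_sub : incl (map (pt D) (chosen m C)) D)
    by (rewrite <- (map_pt_seq D) at 2; now apply incl_map).
  apply locally_optimal_of_exact; auto.
  { apply NoDup_map_NoDup_ForallPairs; [|apply NoDup_chosen].
    intros i j Hi Hj. apply in_chosen in Hi, Hj. apply pt_inj; tauto. }
  { now rewrite length_map. }
  intros As Ds As_distinct As_sub Ds_sub As_length Ds_lt cover.
  destruct (incl_map_preimage _ _ _ As_sub) as (out & out_sub & ->).
  rewrite <- (map_pt_seq D) in Ds_sub.
  destruct (incl_map_preimage _ _ _ Ds_sub) as (inn & inn_sub & ->).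
  rewrite length_map in *.
  apply (swap_optimal_exchange _ _ _ _ out inn optimal); auto; [|lia|].
  { now apply NoDup_map_inv in As_distinct. }
  apply feasible_iff_disk_cover. revert cover. apply disk_cover_incl.
  intros c Hc. apply in_exchanged in Hc as [[Hc not_out]|Hc];
    apply in_map_iff in Hc as (j & <- & Hj); apply in_map, in_chosen_swap; auto.
  right. apply in_chosen in Hj as [Hj Cj]. apply in_chosen. split; auto. unfold without.
  rewrite Cj. apply negb_true_iff, not_true_iff_false. rewrite memb_in.
  intros Hout. now apply not_out, in_map.
Qed.

Lemma swap_optimal_ratio C S' :
  P <> [] -> feasible (length P) (length D) incidence C ->
  swap_optimal (length P) (length D) incidence C ->
  NoDup S' -> covers P D S' -> (length (chosen (length D) C) <= 9 * length S')%nat.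
Proof.
  intros P_nonempty Hfeasible optimal S'_distinct S'_covers.
  apply covers_iff_disk_cover in S'_covers as [S'_lt S'_covers].
  destruct (le_lt_dec 3 (length (chosen (length D) C))) as [large|small].
  - assert (image_distinct : forall l, incl l (seq 0 (length D)) -> NoDup l ->
      NoDup (map (pt D) l)).
    { intros l l_lt distinct. apply NoDup_map_NoDup_ForallPairs; auto.
      intros i j Hi Hj. apply l_lt, in_seq in Hi, Hj. apply pt_inj; auto; lia. }
    rewrite <- (length_map (pt D) (chosen _ C)), <- (length_map (pt D) S').
    apply (locally_optimal_ratio P D); auto.
    + apply image_distinct; [|apply NoDup_chosen]. intros j Hj. apply filter_In in Hj; tauto.
    + rewrite <- (map_pt_seq D) at 2. now apply incl_map.
    + now apply feasible_iff_disk_cover.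
    + now apply swap_optimal_locally_optimal.
  - destruct P as [|p P']; [easy|].
    destruct (S'_covers p (or_introl eq_refl)) as (c & Hc & _).
    destruct S'; [easy|simpl; lia].
Qed.

Lemma local_search_outputs :
  covers P D (seq 0 (length D)) ->
  exists C, feasible (length P) (length D) incidence C /\
    swap_optimal (length P) (length D) incidence C /\
    outputs_within (compile 0 local_search) P D (local_search_time (length P) (length D))
      (chosen (length D) C).
Proof.
  intros all_cover. apply covers_iff_disk_cover in all_cover as [_ all_cover].
  assert (whole : code_at (compile 0 local_search) 0 (compile 0 local_search))
    by (intros k i; auto).
  assert (all_feasible : feasible (length P) (length D) incidence (fun _ => true)).
  { apply feasible_iff_disk_cover. unfold chosen.
    rewrite forallb_filter_id; [exact all_cover|]. now apply forallb_forall. }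
  destruct (local_search_spec (length P) (length D) incidence (encode_real P D)
    (encode_int P D) incidence_encode eq_refl eq_refl all_feasible _ 0%nat whole)
    as (t & s & Ht & Hrun & C & HC & optimal & Hlength & Hentries).
  exists C. split; [auto|split; [auto|]]. exists t. split; [auto|].
  change (init_state P D) with (at_pc 0 (encode_int P D, encode_real P D)). rewrite Hrun.
  assert (Hout : output (at_pc (0 + size local_search) s) = map Z.of_nat (chosen (length D) C)).
  { unfold output. simpl imem. rewrite Hlength, Nat2Z.id.
    rewrite <- (map_nth_seq 0%nat (chosen (length D) C)) at 2. rewrite map_map.
    apply map_ext_in. intros k Hk. apply in_seq in Hk. apply Hentries. lia. }
  rewrite Hout. split; [|split; [|split; [|reflexivity]]].
  - unfold halted. simpl pc. rewrite (proj2 (nth_error_None _ _)); [exact I|].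
    now rewrite length_compile.
  - simpl imem. rewrite Hlength. lia.
  - apply Forall_map, Forall_forall. intros j _. lia.
Qed.

End Instance.

Theorem theorem2 :
  forall eps : R, 0 < eps <= 6 ->
  exists (prg : program) (C : R), 0 < C /\
    forall P D : list point,
      NoDup P -> NoDup D -> (1 <= length P)%nat ->
      covers P D (seq 0 (length D)) ->
      let n := INR (length P) in
      let m := INR (length D) in
      exists (t : nat) (S : list nat),
        INR t <= C * Rmax (m ^ 6 * n) (Rpower m (2 * (1 + 6 / eps)) * n) /\
        outputs_within prg P D t S /\
        NoDup S /\ covers P D S /\
        forall S' : list nat, NoDup S' -> covers P D S' ->
          INR (length S) <= (9 + eps) * INR (length S').
Proof.
  intros eps eps_range. exists (compile 0 local_search), 1000. split; [lra|].
  intros P D _ D_distinct P_nonempty all_cover n m.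
  destruct (local_search_outputs P D all_cover) as (C & Hfeasible & optimal & Houtputs).
  exists (local_search_time (length P) (length D)), (chosen (length D) C).
  split; [|split; [exact Houtputs|split; [apply NoDup_chosen|split]]].
  - assert (D_nonempty := covers_nonempty P D _ P_nonempty all_cover).
    apply Rle_trans with (1000 * (m ^ 6 * n)).
    + assert (time_le := le_INR _ _ (local_search_time_le _ _ P_nonempty D_nonempty)).
      rewrite !mult_INR, pow_INR, (INR_IZR_INZ 1000) in time_le. exact time_le.
    + apply Rmult_le_compat_l; [lra|apply Rmax_l].
  - apply covers_iff_disk_cover. split; [intros j Hj; apply filter_In in Hj; tauto|].
    now apply feasible_iff_disk_cover.
  - intros S' S'_distinct S'_covers.
    assert (ratio : (length (chosen (length D) C) <= 9 * length S')%nat).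
    { apply (swap_optimal_ratio P D); auto. intros ->. simpl in P_nonempty; lia. }
    apply le_INR in ratio. rewrite mult_INR, (INR_IZR_INZ 9) in ratio. simpl IZR in ratio.
    assert (S'_nonneg := pos_INR (length S')). nra.
Qed.
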